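(* Let $\Sigma$ be a Borel subset of $\partial\mathbb D$, let $\{\alpha(n)\}_{n\ge0}$ be a sequence in $\mathbb D$, and let $\mathcal C$ be the associated one-sided CMV operator on $\ell^2(\mathbb Z_{\ge0})$. Suppose there are constants $\gamma_1,\gamma_2$ such that for each $z\in\Sigma$, every normalized solution $\eta(z)$ of the transfer matrix recursion at $z$ obeys the estimate $$C_1(z)L^{\gamma_1}\le\|\eta(z)\|_L\le C_2(z)L^{\gamma_2}$$ for $L>0$ sufficiently large, where $C_1(z),C_2(z)>0$ are constants that may depend on $z$. Let $\beta=2\gamma_1/(\gamma_1+\gamma_2)$. Then any extension $\mathcal E$ of $\mathcal C$ to $\ell^2(\mathbb Z)$ has purely $\beta$-continuous spectrum on $\Sigma$. Moreover, if $C_1(z)$ and $C_2(z)$ are independent of $z$, then for any $\varphi\in\ell^2(\mathbb Z)$ of compact (i.e. finite) support, the spectral measure of $(\mathcal E,\varphi)$ is uniformly $\beta$-Hölder continuous on $\Sigma$.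
   Context: $\mathbb D$ is the open unit disk in $\mathbb C$, $\partial\mathbb D$ is the unit circle, and $\rho(n)=\sqrt{1-|\alpha(n)|^2}$. One-sided CMV operator: with $\Theta_j=\begin{pmatrix}\overline{\alpha(j)}&\rho(j)\\ \rho(j)&-\alpha(j)\end{pmatrix}$, $\mathcal C=(\Theta_0\oplus\Theta_2\oplus\Theta_4\oplus\cdots)(1\oplus\Theta_1\oplus\Theta_3\oplus\cdots)$ acting on $\ell^2(\mathbb Z_{\ge0})$, where $1$ is the $1\times1$ identity. Extension: an extension $\mathcal E$ of $\mathcal C$ to $\ell^2(\mathbb Z)$ is the extended CMV matrix of any two-sided sequence $\{\alpha(n)\}_{n\in\mathbb Z}$ in $\mathbb D$ whose terms with $n\ge0$ are the given ones. The extended CMV matrix is the unitary operator on $\ell^2(\mathbb Z)$ whose entries $\mathcal E_{j,k}$ (row $j$, column $k$) are, for every $m\in\mathbb Z$: in row $2m$, $\mathcal E_{2m,2m-1}=\overline{\alpha(2m)}\rho(2m-1)$, $\mathcal E_{2m,2m}=-\overline{\alpha(2m)}\alpha(2m-1)$, $\mathcal E_{2m,2m+1}=\overline{\alpha(2m+1)}\rho(2m)$, $\mathcal E_{2m,2m+2}=\rho(2m+1)\rho(2m)$; in row $2m+1$, $\mathcal E_{2m+1,2m-1}=\rho(2m)\rho(2m-1)$, $\mathcal E_{2m+1,2m}=-\rho(2m)\alpha(2m-1)$, $\mathcal E_{2m+1,2m+1}=-\overline{\alpha(2m+1)}\alpha(2m)$, $\mathcal E_{2m+1,2m+2}=-\rho(2m+1)\alpha(2m)$;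 all other entries are $0$. Transfer matrix recursion at $z\in\partial\mathbb D$: a sequence $\eta=(\eta_j)_{j\ge0}$ of complex numbers is a solution if for all $n\ge0$ $$\begin{pmatrix}\eta_{2n+3}\\ \eta_{2n+2}\end{pmatrix}=\frac1{\rho(n)}\begin{pmatrix}z&-\overline{\alpha(n)}\\-\alpha(n)z&1\end{pmatrix}\begin{pmatrix}\eta_{2n+1}\\ \eta_{2n}\end{pmatrix}.$$ It is normalized if $|\eta_0|^2+|\eta_1|^2=2$. For an integer $n\ge 0$, $\|\eta\|_n=\big(\sum_{j=0}^n|\eta_j|^2\big)^{1/2}$; for non-integer $L>0$, $\|\eta\|_L$ is defined by linear interpolation between consecutive integers. The spectral measure $\mu_\varphi$ of $(\mathcal E,\varphi)$ is the Borel measure on $\partial\mathbb D$ with $\langle\varphi,(\mathcal E-w)^{-1}\varphi\rangle=\int\frac{d\mu_\varphi(\zeta)}{\zeta-w}$ for $w\in\mathbb C\setminus\partial\mathbb D$. $\mathcal E$ has purely $\beta$-continuous spectrum on $\Sigma$ if for every $\varphi\in\ell^2(\mathbb Z)$ the restriction of $\mu_\varphi$ to $\Sigma$ gives zero weight to every set of zero $\beta$-dimensional Hausdorff measure. A measure $\mu$ on $\partial\mathbb D$ is uniformly $\beta$-Hölder continuous on $\Sigma$ if there are $C,\epsilon_0>0$ such that $\mu(\{e^{i\theta}:|\theta-\Theta|\le\epsilon\})\le C\epsilon^\beta$ for all $e^{i\Theta}\in\Sigma$ and $0<\epsilon<\epsilon_0$.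
   Formalization: The formal theorem adds γ1 ≥ 0; without it the claim fails (α = 0, γ1 = −2, γ2 = 1 gives β = 4). ''L sufficiently large'' is read with a threshold common to all normalized solutions at z, and independent of z in the ''moreover'' part. *)

(* Defs.v *)
From HB Require Import structures.
From mathcomp Require Import all_boot all_order all_algebra.
From mathcomp Require Import complex.
From mathcomp Require Import all_classical all_reals all_analysis.

Set Implicit Arguments.
Unset Strict Implicit.
Unset Printing Implicit Defensive.

Import Order.TTheory GRing.Theory Num.Theory.
Import numFieldNormedType.Exports.
Import Normc.

Local Open Scope classical_set_scope.
Local Open Scope ring_scope.

Section Circle.
Variable R : realType.

(* [normc z : R] is the modulus; [`|z|] would live in [R[i]]. *)
Definition unit_disk : set R[i] := [set z | normc z < 1].
Definition unit_circle : set R[i] := [set z | normc z = 1].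

Definition cis (t : R) : R[i] := (cos t +i* sin t)%C.

(* The complex plane with its Borel sigma-algebra. *)
Definition borelC := g_sigma_algebraType [set U : set R[i]^o | open U].

End Circle.
Arguments unit_disk {R}.
Arguments unit_circle {R}.

Section CMV.
Variable R : realType.

Definition rho (a : R[i]) : R := Num.sqrt (1 - normc a ^+ 2).

Definition mx2 (a b c d : R[i]) : 'M[R[i]]_2 :=
  \matrix_(i, j) if i == 0 then (if j == 0 then a else b)
                 else (if j == 0 then c else d).

Definition col2 (a b : R[i]) : 'cV[R[i]]_2 := \col_i if i == 0 then a else b.

Definition Theta (a : R[i]) : 'M[R[i]]_2 :=
  mx2 a^*%C (rho a)%:C%C (rho a)%:C%C (- a).

(* Theta_0 (+) Theta_2 (+) ...; the block Theta_(2m) sits on {2m, 2m+1}. *)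
Definition cmv_even (alpha : nat -> R[i]) (j k : nat) : R[i] :=
  if j./2 == k./2 then Theta (alpha (j./2).*2) (inord (odd j)) (inord (odd k))
  else 0.

(* 1 (+) Theta_1 (+) Theta_3 (+) ...; Theta_(2m+1) sits on {2m+1, 2m+2}. *)
Definition cmv_odd (alpha : nat -> R[i]) (j k : nat) : R[i] :=
  match j, k with
  | 0, 0 => 1
  | j'.+1, k'.+1 =>
      if j'./2 == k'./2
      then Theta (alpha (j'./2).*2.+1) (inord (odd j')) (inord (odd k'))
      else 0
  | _, _ => 0
  end.

(* Matrix of the one-sided CMV operator. The product is a finite sum because  *)
(* row j of [cmv_even] vanishes beyond column j+1.                            *)
Definition cmv (alpha : nat -> R[i]) (j k : nat) : R[i] :=
  \sum_(l < j.+2) cmv_even alpha j l * cmv_odd alpha l k.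

Definition ecmv (alpha : int -> R[i]) (j k : int) : R[i] :=
  let m := (j %/ 2)%Z in
  let r n := (rho (alpha n))%:C%C in
  if j == 2 * m then
    if k == 2 * m - 1 then (alpha (2 * m))^*%C * r (2 * m - 1)
    else if k == 2 * m then - (alpha (2 * m))^*%C * alpha (2 * m - 1)
    else if k == 2 * m + 1 then (alpha (2 * m + 1))^*%C * r (2 * m)
    else if k == 2 * m + 2 then r (2 * m + 1) * r (2 * m)
    else 0
  else
    if k == 2 * m - 1 then r (2 * m) * r (2 * m - 1)
    else if k == 2 * m then - r (2 * m) * alpha (2 * m - 1)
    else if k == 2 * m + 1 then - (alpha (2 * m + 1))^*%C * alpha (2 * m)
    else if k == 2 * m + 2 then - r (2 * m + 1) * alpha (2 * m)
    else 0.

(* [E] extends the one-sided operator [C]. The coefficients with nonnegative  *)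
(* index are those of [C]: see [cmv_extensionP] below.                        *)
Definition cmv_extension (C : nat -> nat -> R[i]) (E : int -> int -> R[i]) :=
  exists alpha : int -> R[i],
    [/\ forall n, unit_disk (alpha n),
        C = cmv (fun n : nat => alpha n%:Z) & E = ecmv alpha].

Lemma rho_gt0 (a : R[i]) : unit_disk a -> 0 < rho a.
Proof.
rewrite /unit_disk /rho /= sqrtr_gt0 subr_gt0 => a1.
have a0 : 0 <= normc a by case: a {a1} => x y; rewrite sqrtr_ge0.
by rewrite expr_lt1.
Qed.

Lemma Theta00 (a : R[i]) : Theta a (inord false) (inord false) = a^*%C.
Proof. by rewrite !mxE -!val_eqE /= !inordK. Qed.

Lemma Theta01 (a : R[i]) : Theta a (inord false) (inord true) = (rho a)%:C%C.
Proof. by rewrite !mxE -!val_eqE /= !inordK. Qed.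

Lemma Theta10 (a : R[i]) : Theta a (inord true) (inord false) = (rho a)%:C%C.
Proof. by rewrite !mxE -!val_eqE /= !inordK. Qed.

Lemma cmv_double (alpha : nat -> R[i]) m k :
  cmv alpha m.*2 k = (alpha m.*2)^*%C * cmv_odd alpha m.*2 k
                     + (rho (alpha m.*2))%:C%C * cmv_odd alpha m.*2.+1 k.
Proof.
rewrite /cmv 2!big_ord_recr /= big1 ?add0r => [|l _]; last first.
  rewrite /cmv_even doubleK ifF ?mul0r //; apply/negbTE.
  by rewrite gtn_eqF // ltn_half_double ltn_ord.
by rewrite /cmv_even doubleK /= uphalf_double eqxx odd_double Theta00 Theta01.
Qed.

Lemma cmv_inj (a b : nat -> R[i]) :
  (forall n, unit_disk (a n)) -> cmv a = cmv b -> a = b.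
Proof.
move=> ad eab; apply/funext.
have rn n : (rho (a n))%:C%C != 0 by rewrite fmorph_eq0 gt_eqF // rho_gt0.
have even_odd m : a m.*2 = b m.*2 -> a m.*2.+1 = b m.*2.+1.
  move=> e; have := congr1 (fun C => C m.*2 m.*2.+1) eab.
  rewrite !cmv_double -e.
  have z c : cmv_odd c m.*2 m.*2.+1 = 0.
    case: m {e} => [//|m]; rewrite doubleS /=.
    by rewrite uphalf_double doubleK ifF // ltn_eqF.
  rewrite !z !mulr0 !add0r => /(mulfI (rn _)).
  rewrite /cmv_odd doubleK eqxx odd_double !Theta00.
  exact: (can_inj (@conjcK R)).
have odd_even m : a m.*2.+1 = b m.*2.+1 -> a m.+1.*2 = b m.+1.*2.
  move=> e; have := congr1 (fun C => C m.+1.*2 m.*2.+1) eab.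
  rewrite !cmv_double.
  have z c : cmv_odd c m.+1.*2.+1 m.*2.+1 = 0.
    by rewrite /cmv_odd !doubleK gtn_eqF.
  have r c : cmv_odd c m.+1.*2 m.*2.+1 = (rho (c m.*2.+1))%:C%C.
    by rewrite doubleS /= uphalf_double doubleK eqxx odd_double Theta10.
  rewrite !z !r !mulr0 !addr0 -e => /(mulIf (rn _)).
  exact: (can_inj (@conjcK R)).
have even m : a m.*2 = b m.*2.
  elim: m => [|m IH]; last exact/odd_even/even_odd.
  have := congr1 (fun C => C 0%N 0%N) eab.
  rewrite -[0%N]/(0.*2)%N !cmv_double /= !mulr1 !mulr0 !addr0.
  exact: (can_inj (@conjcK R)).
move=> n; rewrite -(odd_double_half n).
by case: (odd n); rewrite ?add1n ?add0n; [exact/even_odd | exact: even].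
Qed.

Lemma cmv_extensionP (alpha : nat -> R[i]) (E : int -> int -> R[i]) :
  (forall n, unit_disk (alpha n)) ->
  cmv_extension (cmv alpha) E <->
  exists a : int -> R[i],
    [/\ forall n, unit_disk (a n), forall n : nat, a n%:Z = alpha n
      & E = ecmv a].
Proof.
move=> ad; split=> -[a [au ae ->]]; exists a; split=> //.
  by move=> n; move/(cmv_inj ad): ae => ->.
by congr cmv; apply/funext => n; rewrite ae.
Qed.

End CMV.

Section Solutions.
Variable R : realType.

Definition transfer_matrix (z a : R[i]) : 'M[R[i]]_2 :=
  ((rho a)%:C%C)^-1 *: mx2 z (- a^*%C) (- a * z) 1.

Definition is_solution (alpha : nat -> R[i]) (z : R[i]) (eta : nat -> R[i]) :=
  forall n : nat, col2 (eta n.*2.+3) (eta n.*2.+2) =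
    transfer_matrix z (alpha n) *m col2 (eta n.*2.+1) (eta n.*2).

Definition normalized (eta : nat -> R[i]) :=
  normc (eta 0%N) ^+ 2 + normc (eta 1%N) ^+ 2 = 2.

Definition norm_upto (eta : nat -> R[i]) (n : nat) : R :=
  Num.sqrt (\sum_(j < n.+1) normc (eta j) ^+ 2).

(* Linear interpolation of [norm_upto eta] between consecutive integers. *)
Definition norm_interp (eta : nat -> R[i]) (L : R) : R :=
  let n := Num.truncn L in
  norm_upto eta n + (L - n%:R) * (norm_upto eta n.+1 - norm_upto eta n).

(* The constants, threshold [L0] included, serve all normalized solutions     *)
(* at the point [z].                                                          *)
Definition power_law_bounds (alpha : nat -> R[i]) (gamma1 gamma2 : R)
    (z : R[i]) (C1 C2 L0 : R) :=
  forall eta, is_solution alpha z eta -> normalized eta ->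
  forall L, 0 < L -> L0 <= L ->
    C1 * L `^ gamma1 <= norm_interp eta L <= C2 * L `^ gamma2.

End Solutions.

Section Spectral.
Variable R : realType.

Definition l2 (phi : int -> R[i]) :=
  (\esum_(n in [set: int]) (normc (phi n) ^+ 2)%:E < +oo)%E.

Definition finitely_supported (phi : int -> R[i]) :=
  finite_set [set n | phi n != 0].

(* Sum over the integers, as the limit of symmetric partial sums, taken on    *)
(* real and imaginary parts separately.                                       *)
Definition sumZ (f : int -> R[i]) : R[i] :=
  let S (N : nat) := \sum_(i < N.*2.+1) f (i%:Z - N%:Z) in
  ((limn (fun N => complex.Re (S N))) +i* (limn (fun N => complex.Im (S N))))%C.

(* Linear in the second argument. *)
Definition inner (phi psi : int -> R[i]) : R[i] :=
  sumZ (fun n => (phi n)^*%C * psi n).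

Definition apply_mx (E : int -> int -> R[i]) (psi : int -> R[i]) (j : int) :=
  sumZ (fun k => E j k * psi k).

(* psi = (E - w)^-1 phi *)
Definition is_resolvent (E : int -> int -> R[i]) (w : R[i])
    (phi psi : int -> R[i]) :=
  l2 psi /\ forall j, apply_mx E psi j - w * psi j = phi j.

Definition cauchy_transform (mu : {finite_measure set (borelC R) -> \bar R})
    (w : R[i]) : R[i] :=
  ((\int[mu]_(x in unit_circle) complex.Re (x - w)^-1) +i*
   (\int[mu]_(x in unit_circle) complex.Im (x - w)^-1))%C.

(* Measures on the circle are finite Borel measures on the plane which do not *)
(* charge its complement.                                                     *)
Definition is_spectral_measure (E : int -> int -> R[i]) (phi : int -> R[i])
    (mu : {finite_measure set (borelC R) -> \bar R}) :=
  mu (~` unit_circle) = 0%E /\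
  forall w : R[i], normc w != 1 ->
    exists2 psi, is_resolvent E w phi psi &
      inner phi psi = cauchy_transform mu w.

End Spectral.

Section Hausdorff.
Variable R : realType.

Definition diam (U : set R[i]) : \bar R :=
  ereal_sup [set (normc (p.1 - p.2))%:E | p in U `*` U].

(* [diam U] to the power [b]; the empty set has weight 0 even when b = 0. *)
Definition hausdorff_weight (b : R) (U : set R[i]) : \bar R :=
  if pselect (U = set0) then 0%E else (diam U `^ b)%E.

Definition hausdorff_premeasure (b delta : R) (S : set R[i]) : \bar R :=
  ereal_inf [set (\sum_(k <oo) hausdorff_weight b (U k))%E |
    U in [set U : nat -> set R[i] |
      S `<=` \bigcup_k U k /\ forall k, (diam (U k) <= delta%:E)%E]].

Definition hausdorff_measure (b : R) (S : set R[i]) : \bar R :=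
  ereal_sup [set hausdorff_premeasure b delta S | delta in [set d | 0 < d]].

Definition purely_continuous_spectrum (b : R) (E : int -> int -> R[i])
    (Sigma : set (borelC R)) :=
  forall phi, l2 phi -> forall mu, is_spectral_measure E phi mu ->
  forall S : set (borelC R), measurable S -> hausdorff_measure b S = 0%E ->
    mu (Sigma `&` S) = 0%E.

Definition circle_arc (t e : R) : set (borelC R) :=
  [set cis s | s in [set s | `|s - t| <= e]].

Definition uniformly_holder (b : R)
    (mu : {finite_measure set (borelC R) -> \bar R})
    (Sigma : set (borelC R)) :=
  exists C e0 : R, [/\ 0 < C, 0 < e0 &
    forall t e : R, Sigma (cis t) -> 0 < e < e0 ->
      (mu (circle_arc t e) <= (C * e `^ b)%:E)%E].

End Hausdorff.

(* Main.v *)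
(* Let [mu] be the spectral measure of [(E, phi)]. Suppose first that [phi]   *)
(* is finitely supported, fix [z] in [Sigma] and put [w = (1 + eps) z] and    *)
(* [y = (w - E)^-1 phi], truncated to a polynomial in [E]. The polynomial is  *)
(* of order [1 / eps] on the arc of radius [eps] at [z], so the arc has       *)
(* measure at most a multiple of [eps^2 |y|^2]. To the right of the support   *)
(* of [phi], the pairs [(y, M y)], where [E = L M] is the usual               *)
(* factorization into 2 x 2 blocks, follow the Szego recursion at [z] up to   *)
(* an error of size [eps |y|]. Write their initial value as [k] times a       *)
(* normalized solution [p], and let [r] be an orthogonal solution. Variation  *)
(* of constants up to the length [L] with [|p|_L |r|_L = 1 / eps] gives       *)
(* [k |p|_L <= c |y|], and the power laws then force                          *)
(* [|p|_L^2 >= c eps^-beta]. Since also [eps |y|^2 <= c (k + 1)] by           *)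
(* unitarity of [E], it follows that [eps^2 |y|^2 <= c eps^beta].             *)
(*                                                                            *)
(* For a general [phi] approximate it by a finitely supported [b]. If [B] is  *)
(* a finite union of arcs as above and [Q] is the sum of the corresponding    *)
(* [|q_i|^2], so that [Q >= 1] on [B], then [Q / (1 + Q)] is the parallel sum *)
(* of [1] and [Q], and therefore                                              *)
(*   [mu B / 2 <= int Q / (1 + Q) dmu <= |phi - b|^2 + sum_i |q_i(E) b|^2].   *)
(* Covering a null set of the beta-dimensional Hausdorff measure by arcs      *)
(* makes the last sum arbitrarily small.                                      *)

Require Import Defs.
From HB Require Import structures.
From mathcomp Require Import all_boot all_order all_algebra.
From mathcomp Require Import complex.
From mathcomp Require Import all_classical all_reals all_analysis.
From mathcomp Require Import measurable_realfun.
From mathcomp Require Import ring lra zify.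

Import Order.TTheory GRing.Theory Num.Theory.
Import numFieldNormedType.Exports.
Import Normc.

Local Open Scope classical_set_scope.
Local Open Scope ring_scope.

Set Implicit Arguments.
Unset Strict Implicit.
Unset Printing Implicit Defensive.

(** * Square-summable sequences and block operators *)

(** Two independent inputs meet. The dynamical one is [key_estimate]: for a finitely supported [b]
    and small [eps] there is a function [q] in the *-algebra generated by [x] with [|q| >= 1] on the
    circle within [eps] of [z] and [|q(E) b|^2 <= C eps^beta], with [C] uniform over all [z] that
    obey the power laws with given constants. The measure-theoretic one is [measure_bound], which
    turns such functions into upper bounds on [mu].

    The exponent comes from [balance_lower]. If [P] and [Q] are the squared norms of two normalized
    solutions up to length [l] and [P Q = eps^-2], eliminating [l] between [P >= c l^(2 g1)] and
    [Q <= C l^(2 g2)] leaves [P^(g1 + g2) >= c eps^(-2 g1)]. At this length [duhamel] still compares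
    the perturbed orbit with the exact one. Coefficients to the left of the support enter only
    through the unitarity of [E] and, on a bounded range, through [backward_bound]; this is why
    every extension behaves alike.

    The spectral theorem is not invoked. The Cauchy transform at large real [w] determines the
    moments ([moments]), and these give [ip_calc], the identity [Re <phi, f(E) phi> = int Re f dmu]
    for all [f] built by [calc].

    For [phi = b] one function [q] bounds an arc ([holder_measure]). For null sets, [Sigma] is
    exhausted by countably many sets on which the constants are uniform, [phi] is truncated, and a
    Hausdorff cover is fed to [measure_countable_union] ([hausdorff_null_small],
    [purely_continuous_measure]). *)

Section ComplexDot.
Variable R : realType.
Implicit Types x y c : R[i].

(* The real part of [x^* y]; real inner products suffice, since the imaginary *)
(* part is recovered by rotating one argument.                                *)
Definition rdot x y : R :=
  complex.Re x * complex.Re y + complex.Im x * complex.Im y.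
Definition nsq x : R := complex.Re x ^+ 2 + complex.Im x ^+ 2.

Lemma normc_nsq x : normc x ^+ 2 = nsq x.
Proof. by case: x => a b; rewrite /normc sqr_sqrtr // addr_ge0 ?sqr_ge0. Qed.

Lemma nsq_ge0 x : 0 <= nsq x.
Proof. by rewrite /nsq addr_ge0 ?sqr_ge0. Qed.

Lemma normc_sqrt_nsq x : normc x = Num.sqrt (nsq x).
Proof. by case: x. Qed.

Lemma normc_ge0 x : 0 <= normc x.
Proof. by rewrite normc_sqrt_nsq sqrtr_ge0. Qed.

Lemma nsq0 : nsq 0 = 0. Proof. by rewrite /nsq /= expr0n addr0. Qed.

Lemma rdotxx x : rdot x x = nsq x.
Proof. by rewrite /rdot /nsq !expr2. Qed.

Lemma rdotC x y : rdot x y = rdot y x.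
Proof. by rewrite /rdot; ring. Qed.

Lemma rdotDl x y z : rdot (x + y) z = rdot x z + rdot y z.
Proof. by case: x y z => a b [c d] [e f]; rewrite /rdot /=; ring. Qed.

Lemma rdotDr x y z : rdot x (y + z) = rdot x y + rdot x z.
Proof. by rewrite ![rdot x _]rdotC rdotDl. Qed.

Lemma rdotNr x y : rdot x (- y) = - rdot x y.
Proof. by case: x y => a b [c d]; rewrite /rdot /=; ring. Qed.

Lemma rdotZl c x y : rdot (c * x) y = rdot x (c^*%C * y).
Proof. by case: x y c => a b [c' d] [e f]; rewrite /rdot /=; ring. Qed.

Lemma rdotRr (r : R) x y : rdot x (r%:C%C * y) = r * rdot x y.
Proof. by case: x y => a b [c d]; rewrite /rdot /=; ring. Qed.

Lemma nsqM x y : nsq (x * y) = nsq x * nsq y.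
Proof. by case: x y => a b [c d]; rewrite /nsq /=; ring. Qed.

Lemma nsqJ x : nsq x^*%C = nsq x.
Proof. by case: x => a b; rewrite /nsq /=; ring. Qed.

Lemma nsqN x : nsq (- x) = nsq x.
Proof. by case: x => a b; rewrite /nsq /=; ring. Qed.

Lemma nsqR (r : R) : nsq r%:C%C = r ^+ 2.
Proof. by rewrite /nsq /=; ring. Qed.

Lemma nsqD x y : nsq (x + y) = nsq x + 2 * rdot x y + nsq y.
Proof. by case: x y => a b [c d]; rewrite /nsq /rdot /=; ring. Qed.

Lemma nsqB x y : nsq (x - y) = nsq x - 2 * rdot x y + nsq y.
Proof. by case: x y => a b [c d]; rewrite /nsq /rdot /=; ring. Qed.

Lemma rdot_le x y : 2 * `|rdot x y| <= nsq x + nsq y.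
Proof.
have := nsq_ge0 (x + y); have := nsq_ge0 (x - y); rewrite nsqB nsqD.
by case: ler0P => _; lra.
Qed.

Lemma nsqD_le x y : nsq (x + y) <= 2 * nsq x + 2 * nsq y.
Proof. by have := nsq_ge0 (x - y); rewrite nsqB nsqD; lra. Qed.

Lemma nsq_eq0 x : nsq x = 0 -> x = 0.
Proof. by move=> h; apply: eq0_normc; rewrite normc_sqrt_nsq h sqrtr0. Qed.

Lemma mulJ x : x^*%C * x = (nsq x)%:C%C.
Proof. by case: x => a b; rewrite /nsq; congr Complex => /=; ring. Qed.

Lemma rdot_real_scale (r : R) x y : rdot (r%:C%C * x) y = r * rdot x y.
Proof. by rewrite rdotC rdotRr rdotC. Qed.

Lemma rho_sq (a : R[i]) : unit_disk a -> rho a ^+ 2 = 1 - nsq a.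
Proof.
move=> a1; rewrite /rho sqr_sqrtr normc_nsq // subr_ge0 -normc_nsq.
by rewrite expr_le1 ?normc_ge0 // ltW.
Qed.

Lemma rhoJ (a : R[i]) : rho a^*%C = rho a.
Proof. by rewrite /rho !normc_nsq nsqJ. Qed.

Lemma rho_le1 (a : R[i]) : rho a <= 1.
Proof.
rewrite /rho -[leRHS]sqrtr1; apply: ler_wsqrtr.
by rewrite gerBl sqr_ge0.
Qed.

Lemma rho_ge0 (a : R[i]) : 0 <= rho a. Proof. exact: sqrtr_ge0. Qed.

End ComplexDot.

Section Window.
Variable R : realType.
Implicit Types f g : int -> R.

(** The window [[-N, N]], indexed as the partial sums inside [sumZ]. *)
Definition win (V : nmodType) (f : int -> V) (N : nat) : V :=
  \sum_(i < N.*2.+1) f (i%:Z - N%:Z).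

Lemma winS (V : nmodType) (f : int -> V) N :
  win f N.+1 = f (- N.+1%:Z) + win f N + f N.+1%:Z.
Proof.
rewrite /win doubleS big_ord_recr /= big_ord_recl /=.
congr (_ + _); last by congr f; lia.
congr (_ + _); first by congr f; lia.
by apply: eq_bigr => i _; congr f; rewrite /bump /=; lia.
Qed.

Lemma win0 (V : nmodType) (f : int -> V) : win f 0 = f 0.
Proof. by rewrite /win big_ord1. Qed.

Lemma winD f g N : win (fun j => f j + g j) N = win f N + win g N.
Proof. by rewrite /win big_split. Qed.

Lemma winN f N : win (fun j => - f j) N = - win f N.
Proof. by rewrite /win sumrN. Qed.

Lemma winZ (r : R) f N : win (fun j => r * f j) N = r * win f N.
Proof. by rewrite /win mulr_sumr. Qed.

Lemma win_le f g N : (forall j, f j <= g j) -> win f N <= win g N.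
Proof. by move=> h; apply: ler_sum => i _. Qed.

Lemma win_ge0 f N : (forall j, 0 <= f j) -> 0 <= win f N.
Proof. by move=> h; apply: sumr_ge0 => i _. Qed.

Lemma win_nd f : (forall j, 0 <= f j) -> nondecreasing_seq (win f).
Proof.
move=> f0; apply/nondecreasing_seqP => N; rewrite winS.
by have := f0 (- N.+1%:Z); have := f0 N.+1%:Z; lra.
Qed.

Lemma win_telescope (t : int -> R) N :
  win (fun j => t j - t (j + 1)) N = t (- N%:Z) - t (N%:Z + 1).
Proof.
elim: N => [|N IH]; first by rewrite win0 oppr0 add0r.
rewrite winS IH.
have -> : - N.+1%:Z + 1 = - N%:Z by lia.
have -> : N%:Z + 1 = N.+1%:Z by lia.
by ring.
Qed.

Lemma win_shift (f : int -> R) (N : nat) : (forall j, 0 <= f j) ->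
  win (fun j => f (j + 1)) N <= win f N.+1.
Proof.
move=> f0; suff : f (- N.+1%:Z) + f (- N%:Z) + win (fun j => f (j + 1)) N = win f N.+1.
  by have := f0 (- N%:Z); have := f0 (- N.+1%:Z); lra.
elim: N => [|N IH]; first by rewrite winS !win0 oppr0 !add0r.
rewrite winS [RHS]winS -IH.
have -> : - N.+1%:Z + 1 = - N%:Z by lia.
have -> : N.+1%:Z + 1 = N.+2%:Z by lia.
by ring.
Qed.

Lemma win_shiftN (f : int -> R) (N : nat) : (forall j, 0 <= f j) ->
  win (fun j => f (j - 1)) N <= win f N.+1.
Proof.
have flip g M : win (fun j => g (- j)) M = win g M.
  elim: M => [|M IH]; first by rewrite !win0 oppr0.
  by rewrite !winS IH opprK; ring.
move=> f0; rewrite -flip -[win f _]flip.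
apply: le_trans (win_shift N (f := fun j => f (- j)) _); last by move=> j; exact: f0.
by rewrite le_eqVlt; apply/orP; left; apply/eqP; apply: eq_bigr => i _; congr f; lia.
Qed.

End Window.

Section Ell2.
Variable R : realType.
Implicit Types (c : R[i]) (u v w : int -> R[i]).

Definition vadd u v := fun n => u n + v n.
Definition vscale c u := fun n => c * u n.

(** Square-summability as a bound on windows; [l2_ell2] passes to it from [l2]. *)
Definition ell2 u := exists M, forall N, win (fun j => nsq (u j)) N <= M.
Definition ip u v : R := limn (win (fun j => rdot (u j) (v j))).

Lemma ell2_add u v : ell2 u -> ell2 v -> ell2 (vadd u v).
Proof.
move=> [M hM] [M' hM']; exists (2 * M + 2 * M') => N.
apply: (le_trans (win_le _ (fun j => nsqD_le (u j) (v j)))).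
by rewrite winD !winZ lerD // ler_pM2l.
Qed.

Lemma ell2_scale c u : ell2 u -> ell2 (vscale c u).
Proof.
move=> [M hM]; exists (nsq c * M) => N.
under eq_fun do rewrite nsqM.
by rewrite winZ ler_wpM2l ?nsq_ge0.
Qed.

Lemma nsq_cvg u : ell2 u -> cvgn (win (fun j => nsq (u j))).
Proof.
move=> [M hM]; apply: nondecreasing_is_cvgn; first by apply: win_nd => j; exact: nsq_ge0.
by exists M => _ [N _ <-].
Qed.

(** Polarization writes [rdot] as a difference of two squares, whose windows are monotone and
    bounded. *)
Lemma ip_cvg u v : ell2 u -> ell2 v -> cvgn (win (fun j => rdot (u j) (v j))).
Proof.
move=> lu lv.
have -> : win (fun j => rdot (u j) (v j)) =
    (fun N => 4^-1 * (win (fun j => nsq (vadd u v j)) N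
                      - win (fun j => nsq (vadd u (vscale (- 1) v) j)) N)).
  apply/funext => N; rewrite -winN -winD -winZ; congr win; apply/funext => j.
  by rewrite /vadd /vscale mulN1r nsqB nsqD; lra.
apply: is_cvgMr; apply: is_cvgB; apply: nsq_cvg; first exact: ell2_add.
by apply: ell2_add => //; exact: ell2_scale.
Qed.

Lemma ip_lim u v : ell2 u -> ell2 v ->
  win (fun j => rdot (u j) (v j)) N @[N --> \oo] --> ip u v.
Proof. by move=> lu lv; exact: ip_cvg. Qed.

Lemma ipC u v : ip u v = ip v u.
Proof. by rewrite /ip; under eq_fun do rewrite rdotC. Qed.

Lemma ipDr u v w : ell2 u -> ell2 v -> ell2 w ->
  ip u (vadd v w) = ip u v + ip u w.
Proof.
move=> lu lv lw; rewrite /ip -limD; try exact: ip_cvg.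
congr (limn _); apply/funext => N; rewrite -[RHS]winD.
by congr win; apply/funext => j; rewrite /vadd rdotDr.
Qed.

Lemma ipDl u v w : ell2 u -> ell2 v -> ell2 w ->
  ip (vadd u v) w = ip u w + ip v w.
Proof. by move=> *; rewrite ipC ipDr // ![ip w _]ipC. Qed.

Lemma ipZl c u v : ip (vscale c u) v = ip u (vscale c^*%C v).
Proof. by rewrite /ip; under eq_fun do rewrite /vscale rdotZl. Qed.

Lemma ipRr (r : R) u v : ell2 u -> ell2 v ->
  ip u (vscale r%:C%C v) = r * ip u v.
Proof.
move=> lu lv; rewrite /ip -[r in RHS](lim_cst (F := \oo%classic) (@norm_hausdorff _ R^o)) //.
rewrite -limM; [|exact: is_cvg_cst|exact: ip_cvg].
congr (limn _); apply/funext => N; rewrite -[RHS]winZ.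
by congr win; apply/funext => j; rewrite /vscale rdotRr.
Qed.

Lemma win_le_ip u N : ell2 u -> win (fun j => nsq (u j)) N <= ip u u.
Proof.
move=> lu; have -> : ip u u = limn (win (fun j => nsq (u j))).
  by rewrite /ip; under eq_fun do rewrite rdotxx.
by apply: nondecreasing_cvgn_le; [apply: win_nd => j; exact: nsq_ge0|exact: nsq_cvg].
Qed.

Lemma ip_ge0 u : ell2 u -> 0 <= ip u u.
Proof.
move=> lu; apply: le_trans (win_le_ip 0 lu); apply: win_ge0 => j; exact: nsq_ge0.
Qed.

Lemma ip_le u M : ell2 u -> (forall N, win (fun j => nsq (u j)) N <= M) -> ip u u <= M.
Proof.
move=> lu h; apply: limr_le; first exact: ip_cvg.
by apply: nearW => N; under eq_fun do rewrite rdotxx; exact: h.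
Qed.

Lemma ip_amgm u v : ell2 u -> ell2 v -> 2 * ip u v <= ip u u + ip v v.
Proof.
move=> lu lv; set v' := vscale (- 1)%:C%C v; have lv' : ell2 v' by exact: ell2_scale.
have := ip_ge0 (ell2_add lu lv').
rewrite ipDl ?ipDr //; try exact: ell2_add.
have -> : ip v' v' = ip v v.
  rewrite /v' ipZl; congr ip; apply/funext => j.
  by rewrite /vscale mulrA conjc_real -rmorphM mulrNN mulr1 mul1r.
by rewrite [ip v' u]ipC /v' ipRr // => h; lra.
Qed.

Lemma ip_scale2 c u : ell2 u -> ip (vscale c u) (vscale c u) = nsq c * ip u u.
Proof.
move=> lu; rewrite ipZl -ipRr //; congr ip; apply/funext => j.
by rewrite /vscale mulrA mulJ.
Qed.

Lemma ip_amgm_scaled (s : R) u v : 0 < s -> ell2 u -> ell2 v ->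
  2 * ip u v <= s * ip u u + s^-1 * ip v v.
Proof.
move=> s0 lu lv; set a := Num.sqrt s.
have a0 : 0 < a by rewrite sqrtr_gt0.
have -> : ip u v = ip (vscale a%:C%C u) (vscale a^-1%:C%C v).
  rewrite ipZl conjc_real; congr ip; apply/funext => j.
  by rewrite /vscale mulrA -rmorphM divff ?gt_eqF // mul1r.
apply: (le_trans (ip_amgm (ell2_scale _ lu) (ell2_scale _ lv))).
by rewrite !ip_scale2 // !nsqR exprVn sqr_sqrtr // ltW.
Qed.

End Ell2.

Section Blocks.
Variable R : realType.
Implicit Types (a : int -> R[i]) (u v : int -> R[i]).

Definition evenz (j : int) := j == 2 * (j %/ 2)%Z.

Lemma evenzS j : evenz (j + 1) = ~~ evenz j.
Proof. by rewrite /evenz; lia. Qed.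

Lemma evenzP j : evenz (j - 1) = ~~ evenz j.
Proof. by rewrite /evenz; lia. Qed.

Definition vconj a : int -> R[i] := fun j => (a j)^*%C.

(* The sum of the blocks [Theta (a j)] on [{j, j + 1}], with [j] even         *)
(* if [e] is true and odd otherwise.                                          *)
Definition blk (e : bool) a u : int -> R[i] := fun j =>
  if evenz j == e then (a j)^*%C * u j + (rho (a j))%:C%C * u (j + 1)
  else (rho (a (j - 1)))%:C%C * u (j - 1) - a (j - 1) * u j.

(** Each block is symmetric and unitary, so its inverse is its entrywise conjugate, the block of the
    conjugated coefficient. *)
Lemma blkK e a u : (forall n, unit_disk (a n)) -> blk e (vconj a) (blk e a u) = u.
Proof.
move=> ad; apply/funext => j; rewrite /blk evenzS evenzP /vconj.
case: (boolP (evenz j == e)) => h.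
  have -> : (~~ evenz j == e) = false by apply/negbTE; case: (evenz j) e h => [] [].
  rewrite addrK rhoJ conjcK.
  move: (rho_sq (ad j)); case: (a j) (u j) (u (j+1)) => p q [r s] [k l].
  by rewrite /nsq /= => hr; congr Complex; [have : (rho (p +i* q)%C ^+ 2 - (1 - (p ^+ 2 + q ^+ 2))) * r = 0 by rewrite hr subrr mul0r | have : (rho (p +i* q)%C ^+ 2 - (1 - (p ^+ 2 + q ^+ 2))) * s = 0 by rewrite hr subrr mul0r]; lra.
have -> : (~~ evenz j == e) = true by case: (evenz j) e h => [] [].
rewrite subrK rhoJ.
move: (rho_sq (ad (j-1))); case: (a (j-1)) (u j) (u (j-1)) => p q [r s] [k l].
by rewrite /nsq /= => hr; congr Complex; [have : (rho (p +i* q)%C ^+ 2 - (1 - (p ^+ 2 + q ^+ 2))) * r = 0 by rewrite hr subrr mul0r | have : (rho (p +i* q)%C ^+ 2 - (1 - (p ^+ 2 + q ^+ 2))) * s = 0 by rewrite hr subrr mul0r]; lra.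
Qed.

Let bdry a u v (j : int) : R :=
  rho (a (j - 1)) * (rdot (u (j - 1)) (v j) - rdot (u j) (v (j - 1))).

Lemma blk_adjoint_local e a u v j :
  let t i := if evenz i == e then 0 else bdry a u v i in
  rdot (blk e a u j) (v j) - rdot (u j) (blk e (vconj a) v j) = t j - t (j + 1).
Proof.
rewrite /= /blk evenzS /vconj /bdry conjcK addrK !rhoJ.
case: (boolP (evenz j == e)) => h.
  have -> : (~~ evenz j == e) = false by apply/negbTE; case: (evenz j) e h => [] [].
  rewrite rdotDl rdotDr rdotZl conjcK rdotRr rdot_real_scale; ring.
have -> : (~~ evenz j == e) = true by case: (evenz j) e h => [] [].
rewrite rdotDl rdotDr !rdotNr rdotRr rdot_real_scale -mulNr rdotZl.
by rewrite rmorphN mulNr rdotNr; ring.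
Qed.

Lemma bdry_le a u v j : `|bdry a u v j| <=
  nsq (u (j - 1)) + nsq (u j) + nsq (v (j - 1)) + nsq (v j).
Proof.
rewrite /bdry normrM ger0_norm ?rho_ge0 //.
apply: (le_trans (ler_wpM2r (normr_ge0 _) (rho_le1 _))); rewrite mul1r.
apply: (le_trans (ler_normB _ _)).
have := rdot_le (u (j-1)) (v j); have := rdot_le (u j) (v (j-1)).
have := nsq_ge0 (u j); have := nsq_ge0 (v j).
by have := nsq_ge0 (u (j-1)); have := nsq_ge0 (v (j-1)); lra.
Qed.

Lemma ell2_blk e a u : (forall n, unit_disk (a n)) -> ell2 u -> ell2 (blk e a u).
Proof.
move=> ad [M hM]; exists (6 * M) => N.
have le1 j : nsq (a j) <= 1.
  by have := rho_sq (ad j); have := sqr_ge0 (rho (a j)); lra.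
have hr j x : nsq ((rho (a j))%:C%C * x) <= nsq x.
  by rewrite nsqM nsqR ler_piMl ?nsq_ge0 // exprn_ile1 ?rho_ge0 ?rho_le1.
have key j : nsq (blk e a u j) <=
    2 * nsq (u j) + (2 * nsq (u (j + 1)) + 2 * nsq (u (j - 1))).
  have a0 := nsq_ge0 (u (j+1)); have b0 := nsq_ge0 (u (j-1)).
  rewrite /blk; case: ifP => _; apply: (le_trans (nsqD_le _ _)).
    rewrite nsqM nsqJ.
    have := ler_wpM2r (nsq_ge0 (u j)) (le1 j); have := hr j (u (j+1)); lra.
  rewrite nsqN (nsqM (a (j - 1))).
  by have := ler_wpM2r (nsq_ge0 (u j)) (le1 (j-1)); have := hr (j-1) (u (j-1)); lra.
apply: (le_trans (win_le _ key)); rewrite !winD !winZ.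
have h j : 0 <= nsq (u j) by exact: nsq_ge0.
have := @win_shift R (fun j => nsq (u j)) N h.
have := @win_shiftN R (fun j => nsq (u j)) N h.
by have := hM N; have := hM N.+1; lra.
Qed.

Lemma ell2_bdry u : ell2 u ->
  (fun N => nsq (u N.+1%:Z) + nsq (u (- N.+1%:Z))) @ \oo --> (0 : R).
Proof.
move=> lu; have c := nsq_cvg lu.
have -> : (fun N => nsq (u N.+1%:Z) + nsq (u (- N.+1%:Z))) =
   (fun N => win (fun j => nsq (u j)) N.+1 - win (fun j => nsq (u j)) N).
  by apply/funext => N; rewrite winS; ring.
rewrite -[X in _ --> X](subrr (limn (win (fun j => nsq (u j))))).
apply: cvgB; last exact: c.
by rewrite -(cvg_shiftS (win (fun j => nsq (u j)))) in c *; exact: c.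
Qed.

(** Summation by parts: the windowed defects telescope to two boundary terms, which tend to 0 by
    [ell2_bdry]. *)
Lemma blk_adjoint e a u v : (forall n, unit_disk (a n)) -> ell2 u -> ell2 v ->
  ip (blk e a u) v = ip u (blk e (vconj a) v).
Proof.
move=> ad lu lv.
have adJ n : unit_disk (vconj a n).
  by rewrite /unit_disk /= normc_sqrt_nsq nsqJ -normc_sqrt_nsq; exact: ad.
have lBu := ell2_blk e ad lu; have lBv := ell2_blk e adJ lv.
apply/eqP; rewrite -subr_eq0; apply/eqP.
have c1 := ip_lim lBu lv; have c2 := ip_lim lu lBv.
have c := cvgB c1 c2 _.
suff h0 : (fun N => win (fun j => rdot (blk e a u j) (v j)) N
     - win (fun j => rdot (u j) (blk e (vconj a) v j)) N) @ \oo --> (0 : R).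
  rewrite -(cvg_lim (@Rhausdorff R) (c _)); exact: (cvg_lim (@Rhausdorff R) h0).
rewrite -cvg_shiftS.
set t := fun i => if evenz i == e then 0 else bdry a u v i.
have -> : (fun N => win (fun j => rdot (blk e a u j) (v j)) N.+1
     - win (fun j => rdot (u j) (blk e (vconj a) v j)) N.+1) =
   (fun N => t (- N.+1%:Z) - t (N.+1%:Z + 1)).
  apply/funext => N; rewrite -winN -winD -win_telescope.
  by congr win; apply/funext => j; rewrite blk_adjoint_local.
have tle j : `|t j| <= nsq (u (j - 1)) + nsq (u j) + nsq (v (j - 1)) + nsq (v j).
  rewrite /t; case: ifP => _; last exact: bdry_le.
  rewrite normr0; have := nsq_ge0 (u j); have := nsq_ge0 (v j).
  by have := nsq_ge0 (u (j - 1)); have := nsq_ge0 (v (j - 1)); lra.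
pose g u N := nsq (u N.+1%:Z) + nsq (u (- N.+1%:Z)) : R.
apply/norm_cvg0P.
apply: (@squeeze_cvgr _ _ _ _ (fun=> 0) (fun N => g u N.+1 + g u N + (g v N.+1 + g v N))).
- apply: nearW => N /=; rewrite normr_ge0 /=.
  apply: (le_trans (ler_normB _ _)).
  have := tle (- N.+1%:Z); have := tle (N.+1%:Z + 1).
  have -> : - N.+1%:Z - 1 = - N.+2%:Z by lia.
  have -> : N.+1%:Z + 1 = N.+2%:Z by lia.
  have -> : N.+2%:Z - 1 = N.+1%:Z by lia.
  by rewrite /g; lra.
- exact: cvg_cst.
- have cg w : ell2 w -> (fun N => g w N.+1 + g w N) @ \oo --> (0 : R).
    move=> /ell2_bdry cw; rewrite -[X in _ --> X](addr0 0); apply: cvgD => //.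
    by rewrite (cvg_shiftS (g w)).
  rewrite -[X in _ --> X](addr0 0); apply: cvgD; exact: cg.
Qed.

End Blocks.

(** * The extended CMV operator *)

Section SumZ.
Variable R : realType.

Lemma cRe_sum (f : int -> R[i]) N : complex.Re (win f N) = win (fun j => complex.Re (f j)) N.
Proof.
rewrite /win; apply: (big_ind2 (fun (x : R[i]) (y : R) => complex.Re x = y)) => //.
by move=> [a b] x [c d] y /= -> ->.
Qed.

Lemma cIm_sum (f : int -> R[i]) N : complex.Im (win f N) = win (fun j => complex.Im (f j)) N.
Proof.
rewrite /win; apply: (big_ind2 (fun (x : R[i]) (y : R) => complex.Im x = y)) => //.
by move=> [a b] x [c d] y /= -> ->.
Qed.

Lemma win_fin (V : nmodType) (f : int -> V) N0 N : (forall k : int, (N0 < `|k|)%N -> f k = 0) ->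
  (N0 <= N)%N -> win f N = win f N0.
Proof.
move=> f0; elim: N => [|N IH]; first by rewrite leqn0 => /eqP ->.
rewrite leq_eqVlt => /orP[/eqP -> //|]; rewrite ltnS => le.
by rewrite winS !f0 ?add0r ?addr0 ?IH //; lia.
Qed.

Lemma sumZ_fin (f : int -> R[i]) N0 : (forall k : int, (N0 < `|k|)%N -> f k = 0) ->
  sumZ f = win f N0.
Proof.
move=> f0; rewrite /sumZ -/(win f _).
have h : \forall N \near \oo, win f N = win f N0.
  by exists N0 => // N /= le; exact: win_fin.
rewrite [RHS](_ : _ = complex.Re (win f N0) +i* complex.Im (win f N0))%C; last by case: (win f N0).
congr Complex; apply: (lim_near_cst (@Rhausdorff R)); near=> N; congr (_ _); near: N; exact: h.
Unshelve. all: by end_near. Qed.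

Lemma win_single (V : nmodType) (k0 : int) (c : V) N : (`|k0| <= N)%N ->
  win (fun k => if k == k0 then c else 0) N = c.
Proof.
elim: N => [|N IH] le.
  by rewrite win0; case: ifP => // /negP[]; lia.
rewrite winS; case: (boolP (`|k0| <= N)%N) => h.
  by rewrite IH // !ifF ?add0r ?addr0 //; lia.
rewrite [win _ N]big1 => [|i _]; last by have hi := ltn_ord i; rewrite ifF //; lia.
by case: eqP => h1; case: eqP => h2; rewrite ?addr0 ?add0r //; lia.
Qed.

Lemma l2_ell2 (u : int -> R[i]) : l2 u -> ell2 u.
Proof.
rewrite /l2 => h; set S := esum _ _ in h.
have S0 : (0 <= S)%E by apply: esum_ge0 => n _; rewrite lee_fin sqr_ge0.
exists (fine S) => N; rewrite -lee_fin fineK ?ge0_fin_numE //.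
apply: esum_ge; exists [set i%:Z - N%:Z | i in `I_N.*2.+1].
  by split => //; apply: finite_image; exact: finite_II.
rewrite fsbig_image; last by move=> x y _ _ /= h'; lia.
rewrite -(fsbig_ord _ _ (fun i : nat => ((normc (u (i%:Z - N%:Z)) ^+ 2)%:E))).
by rewrite -sumEFin; apply: lee_sum => i _; rewrite normc_nsq.
Qed.

End SumZ.

Section Ecmv.
Variable R : realType.
Variable a : int -> R[i].
Implicit Types u v : int -> R[i].

Lemma blk_start e u j : evenz j == e ->
  blk e a u j = (a j)^*%C * u j + (rho (a j))%:C%C * u (j + 1).
Proof. by rewrite /blk => ->. Qed.

Lemma blk_end e u j : evenz j != e ->
  blk e a u j = (rho (a (j - 1)))%:C%C * u (j - 1) - a (j - 1) * u j.
Proof. by rewrite /blk => /negbTE ->. Qed.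

Definition opE u := blk true a (blk false a u).
Definition opE' u := blk false (vconj a) (blk true (vconj a) u).

Lemma ecmv_apply u : apply_mx (ecmv a) u = opE u.
Proof.
apply/funext => j; rewrite /apply_mx.
set m := (j %/ 2)%Z.
(* Row [j] lives on the four columns from [2m - 1] to [2m + 2]; splitting it into point masses makes
   the infinite sum a finite window. *)
pose d (k0 k : int) : R[i] := if k == k0 then ecmv a j k0 * u k0 else 0.
have eqd k : ecmv a j k * u k = d (2 * m - 1) k + d (2 * m) k + d (2 * m + 1) k + d (2 * m + 2) k.
  have h1 : (2 * m == 2 * m - 1) = false by lia.
  have h2 : (2 * m + 1 == 2 * m - 1) = false by lia.
  have h3 : (2 * m + 2 == 2 * m - 1) = false by lia.
  have h4 : (2 * m + 1 == 2 * m) = false by lia.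
  have h5 : (2 * m + 2 == 2 * m) = false by lia.
  have h6 : (2 * m + 2 == 2 * m + 1) = false by lia.
  have h1' : (2 * m - 1 == 2 * m) = false by lia.
  have h2' : (2 * m - 1 == 2 * m + 1) = false by lia.
  have h3' : (2 * m - 1 == 2 * m + 2) = false by lia.
  have h4' : (2 * m == 2 * m + 1) = false by lia.
  have h5' : (2 * m == 2 * m + 2) = false by lia.
  have h6' : (2 * m + 1 == 2 * m + 2) = false by lia.
  rewrite /d.
  case: (eqVneq k (2 * m - 1)) => [->|n1]; first by rewrite h1' h2' h3' !addr0.
  case: (eqVneq k (2 * m)) => [->|n2]; first by rewrite h4' h5' !addr0 add0r.
  case: (eqVneq k (2 * m + 1)) => [->|n3]; first by rewrite h6' !addr0 !add0r.
  case: (eqVneq k (2 * m + 2)) => [->|n4]; first by rewrite !add0r.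
  rewrite !addr0 /ecmv -/m (negbTE n1) (negbTE n2) (negbTE n3) (negbTE n4).
  by rewrite !if_same mul0r.
pose N0 := (absz (2 * m)%R).+2.
rewrite (@sumZ_fin _ _ N0) => [|k hk]; last first.
  by rewrite eqd /d !ifF ?addr0 //; lia.
rewrite (_ : win _ N0 = win (d (2 * m - 1)) N0 + win (d (2 * m)) N0 + win (d (2 * m + 1)) N0
    + win (d (2 * m + 2)) N0); last first.
  by rewrite /win -!big_split /=; apply: eq_bigr => i _; rewrite eqd.
rewrite !win_single; try by lia.
have h1 : (2 * m == 2 * m - 1) = false by lia.
have h2 : (2 * m + 1 == 2 * m - 1) = false by lia.
have h3 : (2 * m + 2 == 2 * m - 1) = false by lia.
have h4 : (2 * m + 1 == 2 * m) = false by lia.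
have h5 : (2 * m + 2 == 2 * m) = false by lia.
have h6 : (2 * m + 2 == 2 * m + 1) = false by lia.
rewrite /ecmv -/m !eqxx h1 h2 h3 h4 h5 h6 /opE.
have ev : evenz (2 * m) by rewrite /evenz; lia.
have ev1 : ~~ evenz (2 * m + 1) by rewrite evenzS ev.
have ev2 : evenz (2 * m + 2) by rewrite /evenz; lia.
have e2 : 2 * m + 1 + 1 = 2 * m + 2 by lia.
case: (eqVneq j (2 * m)) => [->|jn].
  rewrite blk_start ?ev // blk_end ?ev // blk_start ?(negbTE ev1) // e2.
  ring.
have -> : j = 2 * m + 1 by rewrite /m in jn *; lia.
rewrite blk_end ?(negbTE ev1) // addrK blk_end ?ev // blk_start ?(negbTE ev1) // e2.
ring.
Qed.

End Ecmv.

(** * Functions of the operator and their adjoints *)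

Section Calc.
Variable R : realType.
Variable a : int -> R[i].
Hypothesis ad : forall n, unit_disk (a n).
Implicit Types u v : int -> R[i].
Local Notation E := (opE a).
Local Notation E' := (opE' a).

Lemma unit_diskJ n : unit_disk (vconj a n).
Proof. by rewrite /unit_disk /= normc_sqrt_nsq nsqJ -normc_sqrt_nsq; exact: ad. Qed.

Lemma vconjK (b : int -> R[i]) : vconj (vconj b) = b.
Proof. by apply/funext => j; rewrite /vconj conjcK. Qed.

Lemma opE'K u : E' (E u) = u.
Proof. by rewrite /opE' /opE !blkK //; exact: unit_diskJ. Qed.

Lemma opEK u : E (E' u) = u.
Proof.
rewrite /opE' /opE; have h e w : blk e a (blk e (vconj a) w) = w.
  by rewrite -{1}[a]vconjK blkK //; exact: unit_diskJ.
by rewrite !h.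
Qed.

Lemma ell2_opE u : ell2 u -> ell2 (E u).
Proof. by move=> lu; do 2!apply: (ell2_blk _ ad). Qed.

Lemma ell2_opE' u : ell2 u -> ell2 (E' u).
Proof. by move=> lu; do 2!apply: (ell2_blk _ unit_diskJ). Qed.

Lemma opE_adj u v : ell2 u -> ell2 v -> ip (E u) v = ip u (E' v).
Proof.
move=> lu lv; rewrite /opE /opE' blk_adjoint //; last exact: ell2_blk.
by rewrite blk_adjoint //; apply: (ell2_blk _ unit_diskJ).
Qed.

Lemma opE_isom u v : ell2 u -> ell2 v -> ip (E u) (E v) = ip u v.
Proof. by move=> lu lv; rewrite opE_adj ?opE'K //; exact: ell2_opE. Qed.

Lemma opE'_isom u v : ell2 u -> ell2 v -> ip (E' u) (E' v) = ip u v.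
Proof. by move=> lu lv; rewrite -opE_adj ?opEK //; exact: ell2_opE'. Qed.

Lemma blkD e (b : int -> R[i]) u v : blk e b (vadd u v) = vadd (blk e b u) (blk e b v).
Proof. by apply/funext => j; rewrite /vadd /blk; case: ifP => _; ring. Qed.

Lemma blkZ e (b : int -> R[i]) c u : blk e b (vscale c u) = vscale c (blk e b u).
Proof. by apply/funext => j; rewrite /vscale /blk; case: ifP => _; ring. Qed.

Lemma opED u v : E (vadd u v) = vadd (E u) (E v).
Proof. by rewrite /opE !blkD. Qed.

Lemma opEZ c u : E (vscale c u) = vscale c (E u).
Proof. by rewrite /opE !blkZ. Qed.

Lemma opE'Z c u : E' (vscale c u) = vscale c (E' u).
Proof. by rewrite /opE' !blkZ. Qed.

(* [calc f A A']: the operator [A] is [f(E)] and [A'] is its adjoint.         *)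
Inductive calc : (R[i] -> R[i]) -> ((int -> R[i]) -> (int -> R[i])) ->
    ((int -> R[i]) -> (int -> R[i])) -> Prop :=
| calc_cst c : calc (fun=> c) (vscale c) (vscale c^*%C)
| calc_id : calc id E E'
| calc_add f A A' g B B' : calc f A A' -> calc g B B' ->
    calc (fun x => f x + g x) (fun u => vadd (A u) (B u))
         (fun u => vadd (A' u) (B' u))
| calc_mul f A A' g B B' : calc f A A' -> calc g B B' ->
    calc (fun x => f x * g x) (fun u => A (B u)) (fun u => B' (A' u))
| calc_conj f A A' : calc f A A' -> calc (fun x => (f x)^*%C) A' A.

Lemma calc_ell2 f A A' : calc f A A' ->
  (forall u, ell2 u -> ell2 (A u)) /\ (forall u, ell2 u -> ell2 (A' u)).
Proof.
elim=> {f A A'}.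
- by move=> c; split => u lu; exact: ell2_scale.
- by split => u lu; [exact: ell2_opE|exact: ell2_opE'].
- by move=> f A A' g B B' _ [h1 h2] _ [h3 h4]; split => u lu; apply: ell2_add; auto.
- by move=> f A A' g B B' _ [h1 h2] _ [h3 h4]; split => u lu; auto.
- by move=> f A A' _ [].
Qed.

Lemma calc_adj f A A' : calc f A A' ->
  forall u v, ell2 u -> ell2 v -> ip (A u) v = ip u (A' v).
Proof.
elim=> {f A A'}.
- by move=> c u v _ _; rewrite ipZl.
- exact: opE_adj.
- move=> f A A' g B B' /calc_ell2[h1 h2] IHf /calc_ell2[h3 h4] IHg u v lu lv.
  by rewrite ipDl ?ipDr ?IHf ?IHg; auto.
- move=> f A A' g B B' /calc_ell2[h1 h2] IHf /calc_ell2[h3 h4] IHg u v lu lv.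
  by rewrite IHf ?IHg; auto.
- by move=> f A A' cA IH u v lu lv; rewrite ipC -IH // ipC.
Qed.

(** This bound fixes the step size [lam] in [measure_bound]. *)
Lemma calc_bounded f A A' : calc f A A' ->
  exists2 M : R, 0 <= M & forall x, nsq x = 1 -> nsq (f x) <= M.
Proof.
elim=> {f A A'}.
- by move=> c; exists (nsq c) => //; exact: nsq_ge0.
- by exists 1 => // x ->.
- move=> f A A' g B B' _ [M M0 hM] _ [M' M'0 hM'].
  exists (2 * M + 2 * M') => [|x x1]; first by rewrite addr_ge0 ?mulr_ge0.
  by apply: (le_trans (nsqD_le _ _)); rewrite lerD // ler_pM2l // ?hM ?hM'.
- move=> f A A' g B B' _ [M M0 hM] _ [M' M'0 hM'].
  exists (M * M') => [|x x1]; first by rewrite mulr_ge0.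
  by rewrite nsqM ler_pM ?nsq_ge0 ?hM ?hM'.
- by move=> f A A' _ [M M0 hM]; exists M => // x x1; rewrite nsqJ hM.
Qed.

End Calc.

(** * Integration over the circle *)

Section Borel.
Variable R : realType.

(** Balls of [R[i]^o] have radii in [R[i]]; here openness is reduced to real radii. *)
Lemma open_normc (A : set R[i]^o) :
  (forall x : R[i], A x -> exists2 r : R, 0 < r & forall y, normc (x - y) < r -> A y) -> open A.
Proof.
move=> h; rewrite openE => x /h[r r0 hr]; apply/nbhs_ballP; exists r%:C%C.
  by rewrite /= ltcR.
by move=> y; rewrite -ball_normE /= => xy; apply: hr; rewrite -ltcR; exact: xy.
Qed.

Lemma open_borelC (A : set R[i]^o) : open A -> measurable (A : set (borelC R)).
Proof. by move=> oA; apply: sub_sigma_algebra. Qed.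

Lemma closed_borelC (A : set R[i]^o) : closed A -> measurable (A : set (borelC R)).
Proof. by move/closed_openC/open_borelC/measurableC; rewrite setCK. Qed.

Lemma Re_le_normc (x : R[i]) : `|complex.Re x| <= normc x.
Proof.
by case: x => p q /=; rewrite -sqrtr_sqr ler_wsqrtr // lerDl sqr_ge0.
Qed.

Lemma Im_le_normc (x : R[i]) : `|complex.Im x| <= normc x.
Proof.
by case: x => p q /=; rewrite -sqrtr_sqr ler_wsqrtr // lerDr sqr_ge0.
Qed.

Lemma lipschitz_measurable (f : borelC R -> R) (D : set (borelC R)) :
  (forall x y, `|f x - f y| <= normc (x - y)) -> measurable_fun D f.
Proof.
move=> fl; apply: measurable_funTS; apply: (measurability _ (measurable_realfun.RGenOpens.measurableE R)).
move=> _ [_ [a [b ->] <-]]; rewrite setTI; apply: open_borelC; apply: open_normc => x /=.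
rewrite in_itv /= => /andP[ax xb]; exists (Num.min (f x - a) (b - f x)).
  by rewrite lt_min !subr_gt0 ax.
move=> y; rewrite lt_min => /andP[h1 h2]; rewrite in_itv /=.
have := fl x y; rewrite ler_norml => /andP[h3 h4].
by apply/andP; split; lra.
Qed.

Lemma measurable_Re (D : set (borelC R)) : measurable_fun D (@complex.Re R : borelC R -> R).
Proof.
apply: lipschitz_measurable => x y; apply: le_trans (Re_le_normc _).
by case: x y => p q [r s].
Qed.

Lemma measurable_Im (D : set (borelC R)) : measurable_fun D (@complex.Im R : borelC R -> R).
Proof.
apply: lipschitz_measurable => x y; apply: le_trans (Im_le_normc _).
by case: x y => p q [r s].
Qed.

Lemma lipschitz_normc (x y : R[i]) : `|normc x - normc y| <= normc (x - y).
Proof.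
rewrite ler_norml; apply/andP; split.
  by have := le_normcD (y - x) x; rewrite subrK -(normcN (x - y)) opprB; lra.
by have := le_normcD (x - y) y; rewrite subrK; lra.
Qed.

Lemma measurable_disc (z : R[i]) (e : R) :
  measurable ([set x | normc (x - z) <= e] : set (borelC R)).
Proof.
have m : measurable_fun setT (fun x : borelC R => normc (x - z)).
  apply: lipschitz_measurable => x y; apply: (le_trans (lipschitz_normc _ _)).
  by rewrite opprB addrA subrK.
have := m measurableT _ (@measurable_itv R `]-oo, e]).
by rewrite setTI; congr measurable; apply/seteqP; split => x; rewrite /= in_itv.
Qed.

Lemma measurable_circle : measurable (@unit_circle R : set (borelC R)).
Proof.
have m : measurable_fun setT (fun x : borelC R => normc x).
  by apply: lipschitz_measurable => x y; exact: lipschitz_normc.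
have := m measurableT _ (@measurable_set1 R 1).
by rewrite setTI.
Qed.

Lemma circleP (x : R[i]) : unit_circle x <-> nsq x = 1.
Proof.
rewrite /unit_circle /= -normc_nsq; split => [->|]; first by rewrite expr1n.
by move=> h; have := normc_ge0 x => h0; apply/eqP; rewrite -(eqrXn2 (n := 2)) // h expr1n.
Qed.

End Borel.

Section Good.
Variable R : realType.
Local Notation circ := (unit_circle : set (borelC R)).
Variable mu : {finite_measure set (borelC R) -> \bar R}.
Implicit Types f g : borelC R -> R.
Implicit Types F G : R[i] -> R[i].

Definition tame f := measurable_fun circ f /\
  exists M : R, forall x, circ x -> `|f x| <= M.

Definition cint f : R := (\int[mu]_(x in circ) f x).

Lemma tame_int f : tame f -> mu.-integrable circ (EFin \o f).
Proof.
move=> [mf [M hM]]; apply: measurable_bounded_integrable => //.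
- exact: measurable_circle.
- by rewrite ltey_eq fin_num_measure //; exact: measurable_circle.
- by exists M; split; [exact: num_real|] => y My x /hM h; apply: (le_trans h); rewrite ltW.
Qed.

Lemma tame_cst (r : R) : tame (fun=> r).
Proof. by split; [exact: measurable_cst|exists `|r|]. Qed.

Lemma tameD f g : tame f -> tame g -> tame (fun x => f x + g x).
Proof.
move=> [mf [M hM]] [mg [M' hM']]; split; first exact: measurable_funD.
by exists (M + M') => x cx; apply: (le_trans (ler_normD _ _)); rewrite lerD ?hM ?hM'.
Qed.

Lemma tameM f g : tame f -> tame g -> tame (fun x => f x * g x).
Proof.
move=> [mf [M hM]] [mg [M' hM']]; split; first exact: measurable_funM.
by exists (M * M') => x cx; rewrite normrM ler_pM ?hM ?hM'.
Qed.

Lemma tameN f : tame f -> tame (fun x => - f x).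
Proof.
move=> h; have := tameM (tame_cst (-1)) h; congr tame; apply/funext => x.
by rewrite mulN1r.
Qed.

Lemma tameB f g : tame f -> tame g -> tame (fun x => f x - g x).
Proof. by move=> hf hg; apply: tameD => //; exact: tameN. Qed.

Lemma cintD f g : tame f -> tame g -> cint (fun x => f x + g x) = cint f + cint g.
Proof. by move=> hf hg; rewrite /cint RintegralD //; [exact: measurable_circle|exact: tame_int|exact: tame_int]. Qed.

Lemma cintZ (r : R) f : tame f -> cint (fun x => r * f x) = r * cint f.
Proof. by move=> hf; rewrite /cint RintegralZl //; [exact: measurable_circle|exact: tame_int]. Qed.

Lemma cint_le f g : tame f -> tame g -> (forall x, circ x -> f x <= g x) ->
  cint f <= cint g.
Proof. by move=> hf hg h; apply: le_Rintegral => //; [exact: measurable_circle|exact: tame_int|exact: tame_int]. Qed.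

Lemma cint_eq f g : (forall x, circ x -> f x = g x) -> cint f = cint g.
Proof. by move=> h; apply: eq_Rintegral => x /set_mem; exact: h. Qed.

Lemma cint_cst (r : R) : cint (fun=> r) = r * fine (mu circ).
Proof. by rewrite /cint Rintegral_cst //; exact: measurable_circle. Qed.

Lemma cint_indic (B : set (borelC R)) : measurable B -> B `<=` circ ->
  cint (\1_B) = fine (mu B).
Proof.
move=> mB Bc; rewrite /cint /Rintegral integral_indic //; last exact: measurable_circle.
by congr (fine (mu _)); apply/seteqP; split => [x []|x Bx] //; split => //; exact: Bc.
Qed.

Definition ctame F := tame (fun x => complex.Re (F x)) /\ tame (fun x => complex.Im (F x)).

Lemma ctame_cst c : ctame (fun=> c).
Proof. by split; exact: tame_cst. Qed.

Lemma ctame_id : ctame id.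
Proof.
split; split; [exact: measurable_Re| |exact: measurable_Im|]; exists 1 => x cx.
  by apply: (le_trans (Re_le_normc _)); rewrite cx.
by apply: (le_trans (Im_le_normc _)); rewrite cx.
Qed.

Lemma ctameD F G : ctame F -> ctame G -> ctame (fun x => F x + G x).
Proof.
move=> [rF iF] [rG iG]; split.
  by have := tameD rF rG; congr tame; apply/funext => x; case: (F x) (G x) => p q [].
by have := tameD iF iG; congr tame; apply/funext => x; case: (F x) (G x) => p q [].
Qed.

Lemma ctameM F G : ctame F -> ctame G -> ctame (fun x => F x * G x).
Proof.
move=> [rF iF] [rG iG]; split.
  by have := tameB (tameM rF rG) (tameM iF iG); congr tame; apply/funext => x; case: (F x) (G x) => p q [].
by have := tameD (tameM rF iG) (tameM iF rG); congr tame; apply/funext => x; case: (F x) (G x) => p q [].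
Qed.

Lemma ctameJ F : ctame F -> ctame (fun x => (F x)^*%C).
Proof.
move=> [rF iF]; split.
  by move: rF; congr tame; apply/funext => x; case: (F x).
by have := tameN iF; congr tame; apply/funext => x; case: (F x).
Qed.

Lemma ctame_calc a F A A' : calc a F A A' -> ctame F.
Proof.
elim=> {F A A'}.
- exact: ctame_cst.
- exact: ctame_id.
- by move=> f A A' g B B' _ h _ h'; exact: ctameD.
- by move=> f A A' g B B' _ h _ h'; exact: ctameM.
- by move=> f A A' _ h; exact: ctameJ.
Qed.

Lemma tame_rdot F G : ctame F -> ctame G -> tame (fun x => rdot (F x) (G x)).
Proof. by move=> [rF iF] [rG iG]; apply: tameD; exact: tameM. Qed.

Lemma normc_subR_ge1 (w : R) (x : R[i]) : 2 <= w -> circ x -> 1 <= nsq (x - w%:C%C).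
Proof.
move=> w2 /circleP; case: x => p q; rewrite /nsq /= => h.
have p1 : p <= 1 by have := sqr_ge0 q; have := sqr_ge0 (p - 1); nra.
by nra.
Qed.

Lemma ctame_resolvent (w : R) : 2 <= w -> ctame (fun x => (x - w%:C%C)^-1).
Proof.
move=> w2; have c : ctame (fun x => x - w%:C%C).
  by apply: ctameD; [exact: ctame_id|exact: ctame_cst].
have g1 : tame (fun x => (nsq (x - w%:C%C))^-1).
  split; last first.
    exists 1 => x cx; have := normc_subR_ge1 w2 cx => h1.
    by rewrite ger0_norm ?invr_ge0 ?nsq_ge0 // invf_le1 // (lt_le_trans ltr01).
  apply: (@measurable_comp _ _ _ _ _ _ (`]0%R, +oo[%classic : set R) (fun t : R => t^-1) circ (fun x : borelC R => nsq (x - w%:C%C)) _ _ _ _); [by []| | |].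
  - by move=> _ [x cx <-] /=; rewrite in_itv /= andbT (lt_le_trans ltr01) ?normc_subR_ge1.
  - apply: open_continuous_measurable_fun; first exact: interval_open.
    move=> t /set_mem; rewrite /= in_itv /= andbT => t0.
    by apply: inv_continuous; rewrite gt_eqF.
  - by case: (tame_rdot c c) => + _; congr measurable_fun; apply/funext => x; rewrite rdotxx.
have e (x : R[i]) : x^-1 = (nsq x)^-1%:C%C * x^*%C.
  by case: x => p q; rewrite /nsq; congr Complex => /=; ring.
rewrite (_ : (fun x => _) = (fun x => (nsq (x - w%:C%C))^-1%:C%C * (x - w%:C%C)^*%C)); last first.
  by apply/funext => x; rewrite e.
apply: ctameM; last exact: ctameJ.
by split => //=; exact: tame_cst.
Qed.

End Good.

(** * Moments of a spectral measure *)

Section Moments.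
Variable R : realType.
Local Notation circ := (unit_circle : set (borelC R)).
Variable mu : {finite_measure set (borelC R) -> \bar R}.
Variable a : int -> R[i].
Hypothesis ad : forall n, unit_disk (a n).
Variable phi : int -> R[i].
Hypothesis lphi : ell2 phi.
Implicit Types u v : int -> R[i].
Local Notation E := (opE a).
Local Notation E' := (opE' a).
Local Notation cint := (cint mu).

Lemma ell2_iter k u : ell2 u -> ell2 (iter k E u).
Proof. by move=> lu; elim: k => //= k; exact: ell2_opE. Qed.

Lemma ell2_iter' k u : ell2 u -> ell2 (iter k E' u).
Proof. by move=> lu; elim: k => //= k; exact: ell2_opE'. Qed.

Lemma iterD k u v : iter k E (vadd u v) = vadd (iter k E u) (iter k E v).
Proof. by elim: k => //= k ->; rewrite opED. Qed.

Lemma iterZ k c u : iter k E (vscale c u) = vscale c (iter k E u).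
Proof. by elim: k => //= k ->; rewrite opEZ. Qed.

Lemma ip_iter k u v : ell2 u -> ell2 v -> ip (iter k E u) (iter k E v) = ip u v.
Proof.
move=> lu lv; elim: k => //= k IH.
by rewrite opE_isom //; exact: ell2_iter.
Qed.

Lemma ip_iter' k u v : ell2 u -> ell2 v -> ip (iter k E' u) v = ip u (iter k E v).
Proof.
move=> lu; elim: k v => //= k IH v lv.
rewrite ipC -(opE_adj ad lv (ell2_iter' k lu)) ipC IH; last exact: ell2_opE.
by rewrite -iterSr.
Qed.

Lemma cReD (x y : R[i]) : complex.Re (x + y) = complex.Re x + complex.Re y.
Proof. by case: x y => p q []. Qed.

Lemma cReZ (r : R) (x : R[i]) : complex.Re (r%:C%C * x) = r * complex.Re x.
Proof. by case: x => p q /=; rewrite mul0r subr0. Qed.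

Lemma tame_Re F : @ctame R F -> tame (fun x => complex.Re (F x)).
Proof. by case. Qed.

Lemma ctameX k : @ctame R (fun x : R[i] => x ^+ k).
Proof.
elim: k => [|k IH]; first by rewrite (_ : (fun=> _) = fun=> 1) //; exact: ctame_cst.
rewrite (_ : (fun=> _) = fun x => x * x ^+ k).
  by apply: ctameM => //; exact: ctame_id.
by apply/funext => x; rewrite exprS.
Qed.

(** The factor [c] lets the real inner product carry both components of the Cauchy transform. *)
Definition res (w : R) (psi : int -> R[i]) := [/\ ell2 psi,
  E psi = vadd (vscale w%:C%C psi) phi &
  forall c, ip phi (vscale c psi) = cint (fun x => complex.Re (c * (x - w%:C%C)^-1))].

(** Expand the norm of [w psi = E psi - phi], using that [E] is isometric; [w >= 2] absorbs the
    terms in [psi]. *)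
Lemma res_norm w psi : 2 <= w -> res w psi -> w ^+ 2 * ip psi psi <= 4 * ip phi phi.
Proof.
move=> w2 [lpsi eq _].
have e : vscale w%:C%C psi = vadd (E psi) (vscale (-1)%:C%C phi).
  by rewrite eq; apply/funext => j; rewrite /vadd /vscale rmorphN mulN1r addrK.
have lE := ell2_opE ad lpsi.
have lp : ell2 (vscale (-1)%:C%C phi) by exact: ell2_scale.
have h : w ^+ 2 * ip psi psi = ip psi psi + 2 * ip (E psi) (vscale (-1)%:C%C phi) + ip phi phi.
  rewrite -nsqR -ip_scale2 // e ipDl ?ipDr //; try exact: ell2_add.
  rewrite opE_isom // ip_scale2 // nsqR [ip (vscale _ _) _]ipC; ring.
have := ip_amgm lE lp; rewrite opE_isom // ip_scale2 // nsqR => h2.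
have h3 : 4 * ip psi psi <= w ^+ 2 * ip psi psi.
  by rewrite ler_wpM2r ?ip_ge0 //; nra.
have h4 := ip_ge0 lphi.
have : (-1) ^+ 2 = 1 :> R by ring.
by move=> e1; rewrite e1 in h2; lra.
Qed.

(** On the circle [|x - w| >= w / 2], so the integral decays like [1 / w], as [moment_step]
    requires. *)
Lemma res_cint_bound (w : R) (c : R[i]) k : 2 <= w ->
  2 * `|cint (fun x => complex.Re (c * x ^+ k * (x - w%:C%C)^-1))| <=
   w^-1 * ((1 + 4 * nsq c) * fine (mu circ)).
Proof.
move=> w2; have w0 : 0 < w by lra.
set f := fun x : borelC R => complex.Re (c * x ^+ k * (x - w%:C%C)^-1).
have gf : tame f.
  apply: tame_Re; apply: ctameM; last exact: ctame_resolvent.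
  by apply: ctameM; [exact: ctame_cst|exact: ctameX].
have key x : unit_circle x -> 2 * `|f x| <= w^-1 * (1 + 4 * nsq c).
  move=> cx; set y := c * x ^+ k * (x - w%:C%C)^-1.
  have ny : nsq y * (w ^+ 2) <= 4 * nsq c.
    have hy : nsq y * nsq (x - w%:C%C) = nsq c.
      have nz : x - w%:C%C != 0.
        apply/eqP => h; have := normc_subR_ge1 w2 cx; rewrite h nsq0; lra.
      rewrite -nsqM /y mulfVK // nsqM.
      suff -> : nsq (x ^+ k) = 1 by rewrite mulr1.
      elim: k {gf y nz f} => [|k IH]; first by rewrite expr0 /nsq /= expr0n expr1n addr0.
      by rewrite exprS nsqM IH; move/circleP : cx => ->; rewrite mulr1.
    have : w ^+ 2 <= 4 * nsq (x - w%:C%C).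
      move/circleP : cx; case: x {y hy} => p q; rewrite /nsq /= => h.
      have p1 : p <= 1 by have := sqr_ge0 q; have := sqr_ge0 (p - 1); nra.
      nra.
    by have := nsq_ge0 y; nra.
  have hre : (complex.Re y) ^+ 2 <= nsq y by rewrite /nsq lerDl sqr_ge0.
  rewrite -/(f x) /f -/y mulrC ler_pdivlMl // mulrC.
  have : `|complex.Re y| ^+ 2 <= nsq y by rewrite real_normK ?num_real.
  have := normr_ge0 (complex.Re y); set t := `|_| => t0 ht.
  have : 0 <= (t * w - 1) ^+ 2 by exact: sqr_ge0.
  have : t ^+ 2 * w ^+ 2 <= nsq y * w ^+ 2 by rewrite ler_wpM2r ?sqr_ge0.
  by nra.
set K := w^-1 * (1 + 4 * nsq c) in key.
have -> : w^-1 * ((1 + 4 * nsq c) * fine (mu circ)) = 2 * cint (fun=> K / 2).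
  by rewrite cint_cst /K; field; rewrite gt_eqF.
rewrite ler_pM2l // ler_norml; apply/andP; split.
  rewrite -mulN1r -cintZ; last exact: tame_cst.
  apply: cint_le => //; first by rewrite (_ : (fun=> _) = fun=> -1 * (K / 2)) //; exact: tame_cst.
  by move=> x cx; have := key x cx; rewrite -/(f x); have := lerNnormlW (lexx `|f x|); lra.
apply: cint_le => //; first exact: tame_cst.
by move=> x cx; have := key x cx; have := ler_norm (f x); lra.
Qed.

Hypothesis hres : forall w : R, 2 <= w -> exists psi, res w psi.

Let P k := forall w psi, 2 <= w -> res w psi -> forall c,
  ip phi (vscale c (iter k E psi)) = cint (fun x => complex.Re (c * x ^+ k * (x - w%:C%C)^-1)).
Let mom k := forall c, ip phi (vscale c (iter k E phi)) = cint (fun x => complex.Re (c * x ^+ k)).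

(* With [D_k w = <phi, c E^k psi_w> - int Re (c x^k / (x - w)) dmu] and [m_k] *)
(* the defect of the k-th moment, [D_(k+1) w = w D_k w + m_k] tends to 0 as   *)
(* [w] tends to infinity; hence [D_k = 0] gives [m_k = 0] and [D_(k+1) = 0].  *)
Lemma moment_step k : P k -> mom k /\ P k.+1.
Proof.
move=> Pk.
have step w psi c : 2 <= w -> res w psi ->
    ip phi (vscale c (iter k E phi)) - cint (fun x => complex.Re (c * x ^+ k)) =
    ip phi (vscale c (iter k.+1 E psi))
     - cint (fun x => complex.Re (c * x ^+ k.+1 * (x - w%:C%C)^-1)).
  move=> w2 rw; have [lpsi eq _] := rw.
  have -> : vscale c (iter k.+1 E psi) =
      vadd (vscale w%:C%C (vscale c (iter k E psi))) (vscale c (iter k E phi)).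
    rewrite iterSr eq iterD iterZ; apply/funext => j; rewrite /vadd /vscale; ring.
  have l1 : ell2 (vscale c (iter k E psi)) by apply: ell2_scale; exact: ell2_iter.
  have l2 : ell2 (vscale c (iter k E phi)) by apply: ell2_scale; exact: ell2_iter.
  rewrite ipDr //; last exact: ell2_scale.
  rewrite ipRr // (Pk w psi) //.
  have g1 : ctame (fun x : R[i] => c * x ^+ k) by apply: ctameM; [exact: ctame_cst|exact: ctameX].
  have g2 : ctame (fun x : R[i] => c * x ^+ k * (x - w%:C%C)^-1).
    by apply: ctameM => //; exact: ctame_resolvent.
  have -> : cint (fun x => complex.Re (c * x ^+ k.+1 * (x - w%:C%C)^-1)) =
     cint (fun x => w * complex.Re (c * x ^+ k * (x - w%:C%C)^-1) + complex.Re (c * x ^+ k)).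
    apply: cint_eq => x cx; rewrite -cReZ -cReD; congr complex.Re.
    have nz : x - w%:C%C != 0.
      by apply/eqP => h; have := normc_subR_ge1 w2 cx; rewrite h nsq0; lra.
    by rewrite exprS; field.
  rewrite cintD ?cintZ; try exact: tame_Re.
    by ring.
  by apply: tameM; [exact: tame_cst|exact: tame_Re].
have m0 : mom k.
  move=> c; apply/eqP; rewrite -subr_eq0; apply/eqP.
  set m := _ - _.
  pose K := ip phi phi + nsq c * (4 * ip phi phi) + (1 + 4 * nsq c) * fine (mu circ).
  have mle w : 2 <= w -> 2 * `|m| * w <= K.
    move=> w2; have [psi rw] := hres w2; have [lpsi eq _] := rw.
    have w0 : 0 < w by lra.
    rewrite /m (step w psi c w2 rw); set X := ip _ _.
    have lX : ell2 (vscale c (iter k.+1 E psi)) by apply: ell2_scale; exact: ell2_iter.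
    have nX : ip (vscale c (iter k.+1 E psi)) (vscale c (iter k.+1 E psi)) = nsq c * ip psi psi.
      by rewrite ip_scale2 ?ip_iter //; exact: ell2_iter.
    have h1 := ip_amgm_scaled w0 lX lphi; rewrite nX in h1.
    have h2 : - 2 * X <= w * (nsq c * ip psi psi) + w^-1 * ip phi phi.
      have lX' := ell2_scale (-1)%:C%C lX.
      have := ip_amgm_scaled w0 lX' lphi; rewrite ip_scale2 // nX nsqR ipC ipRr // /X.
      by move=> h; nra.
    rewrite ipC -/X in h1.
    have h3 := res_cint_bound c k.+1 w2.
    have h4 := res_norm w2 rw.
    have wV : w^-1 * w = 1 by rewrite mulVf ?gt_eqF.
    set Y := cint _ in h3 *.
    have h5 : 2 * `|X| <= w * (nsq c * ip psi psi) + w^-1 * ip phi phi.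
      by case: (ler0P X) => _; lra.
    have h6 : 2 * `|X - Y| <= w * (nsq c * ip psi psi) + w^-1 * ip phi phi
        + w^-1 * ((1 + 4 * nsq c) * fine (mu circ)).
      by have := ler_normB X Y; lra.
    have := ler_wpM2r (ltW w0) h6.
    have -> : (w * (nsq c * ip psi psi) + w^-1 * ip phi phi +
      w^-1 * ((1 + 4 * nsq c) * fine (mu circ))) * w =
      nsq c * (w ^+ 2 * ip psi psi) + w^-1 * w * (ip phi phi + (1 + 4 * nsq c) * fine (mu circ)).
      by ring.
    rewrite wV mul1r /K => h7.
    by have := ler_wpM2l (nsq_ge0 c) h4; lra.
  apply/eqP; rewrite -normr_eq0 eq_le normr_ge0 andbT leNgt; apply/negP => mp.
  have K0 : 0 <= K by have := mle 2 (lexx _); nra.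
  (* At this value of [w] the bound would read [4 |m| + 2 K <= K]. *)
  have := mle (2 + K / `|m|); rewrite lerDl divr_ge0 ?normr_ge0 // => /(_ isT).
  have -> : 2 * `|m| * (2 + K / `|m|) = 4 * `|m| + 2 * K by field; rewrite gt_eqF.
  lra.
split => // w psi w2 rw c; apply/eqP; rewrite -subr_eq0 -step //.
by rewrite m0 subrr.
Qed.

Lemma moments k : mom k.
Proof.
suff h : P k by case: (moment_step h).
elim: k => [|k IH]; last by case: (moment_step IH).
move=> w psi w2 [_ _ h] c; rewrite h; congr cint; apply/funext => x.
by rewrite expr0 mulr1.
Qed.

(* [u] represents [f]: its inner products with all [E^k phi], [k] in [Z], are *)
(* those of [f] with [x^k] in [L^2(mu)].                                      *)
Definition rep (f : R[i] -> R[i]) u := [/\ ell2 u, ctame f,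
  forall k c, ip (iter k E phi) (vscale c u) = cint (fun x => complex.Re (c * (x^*%C) ^+ k * f x)) &
  forall k c, ip (iter k E' phi) (vscale c u) = cint (fun x => complex.Re (c * x ^+ k * f x))].

Lemma rep_phi : rep (fun=> 1) phi.
Proof.
split => // [|k c|k c]; first exact: ctame_cst.
  rewrite ipC ipZl moments; congr cint; apply/funext => x.
  rewrite mulr1 (_ : c * _ = (c^*%C * x ^+ k)^*%C); last by rewrite rmorphM rmorphXn /= conjcK.
  by case: (_ * _).
rewrite ip_iter' //; last exact: ell2_scale.
by rewrite iterZ moments; congr cint; apply/funext => x; rewrite mulr1.
Qed.

Lemma rep_ext f g u : f =1 g -> rep f u -> rep g u.
Proof. by move=> /funext ->. Qed.

Lemma vscaleA c d u : vscale c (vscale d u) = vscale (c * d) u.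
Proof. by apply/funext => j; rewrite /vscale mulrA. Qed.

(** Moving [E] across the inner product shifts the power of [E] on [phi], just as multiplication by
    [x] shifts the monomial, because [|x| = 1]. Crossing the power 0 passes from one family of
    identities in [rep] to the other, hence the case split on [k]. *)
Lemma rep_calc f A A' : calc a f A A' -> forall g u, rep g u ->
  rep (fun x => f x * g x) (A u) /\ rep (fun x => (f x)^*%C * g x) (A' u).
Proof.
have cst c g u : rep g u -> rep (fun x => c * g x) (vscale c u).
  move=> [lu cg h1 h2]; split; [exact: ell2_scale|by apply: ctameM => //; exact: ctame_cst| |].
    by move=> k d; rewrite vscaleA h1; congr cint; apply/funext => x; congr complex.Re; ring.
  by move=> k d; rewrite vscaleA h2; congr cint; apply/funext => x; congr complex.Re; ring.
have cJ (x : R[i]) : unit_circle x -> x^*%C * x = 1 by move=> /circleP h; rewrite mulJ h.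
elim=> {f A A'}.
- by move=> c g u ru; split; exact: cst.
- move=> g u [lu cg h1 h2]; split; split.
  + exact: ell2_opE.
  + by apply: ctameM => //; exact: ctame_id.
  + move=> [|k] c; rewrite -opEZ.
      rewrite ipC opE_adj //; try exact: ell2_scale.
      rewrite ipC (h2 1%N); congr cint; apply/funext => x; congr complex.Re.
      by rewrite expr1 expr0; ring.
    rewrite /= opE_isom //; [|exact: ell2_iter|exact: ell2_scale].
    rewrite h1; apply: cint_eq => x cx; congr complex.Re.
    by rewrite exprSr -!mulrA [_^*%C * _]mulrA cJ // mul1r.
  + move=> k c; rewrite -opEZ ipC opE_adj //; [|exact: ell2_scale|exact: ell2_iter'].
    rewrite ipC (h2 k.+1); congr cint; apply/funext => x; congr complex.Re.
    by rewrite exprS; ring.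
  + exact: ell2_opE'.
  + by apply: ctameM => //; apply: ctameJ; exact: ctame_id.
  + move=> k c; rewrite -opE'Z -opE_adj //; [|exact: ell2_iter|exact: ell2_scale].
    rewrite (h1 k.+1); congr cint; apply/funext => x; congr complex.Re.
    by rewrite exprS; ring.
  + move=> [|k] c; rewrite -opE'Z.
      rewrite -opE_adj //; last exact: ell2_scale.
      rewrite (h1 1%N); congr cint; apply/funext => x; congr complex.Re.
      by rewrite expr1 expr0; ring.
    rewrite /= opE'_isom //; [|exact: ell2_iter'|exact: ell2_scale].
    rewrite h2; apply: cint_eq => x cx; congr complex.Re.
    by rewrite exprSr -!mulrA [x * (_ * _)]mulrA [x * _]mulrC cJ // mul1r.
- have add g1 g2 u1 u2 : rep g1 u1 -> rep g2 u2 -> rep (fun x => g1 x + g2 x) (vadd u1 u2).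
    move=> [l1 c1 h1 k1] [l2 c2 h2 k2].
    have cD c : vscale c (vadd u1 u2) = vadd (vscale c u1) (vscale c u2).
      by apply/funext => j; rewrite /vscale /vadd mulrDr.
    split; [exact: ell2_add|exact: ctameD| |] => k c.
      rewrite cD ipDr; [|exact: ell2_iter|exact: ell2_scale|exact: ell2_scale].
      rewrite h1 h2 -cintD.
      + by apply: cint_eq => x _; rewrite mulrDr cReD.
      + by apply: tame_Re; apply: ctameM => //; apply: ctameM; [exact: ctame_cst|have := ctameJ (ctameX k); congr ctame; apply/funext => x; rewrite rmorphXn].
      + by apply: tame_Re; apply: ctameM => //; apply: ctameM; [exact: ctame_cst|have := ctameJ (ctameX k); congr ctame; apply/funext => x; rewrite rmorphXn].
    rewrite cD ipDr; [|exact: ell2_iter'|exact: ell2_scale|exact: ell2_scale].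
    rewrite k1 k2 -cintD.
    + by apply: cint_eq => x _; rewrite mulrDr cReD.
    + by apply: tame_Re; apply: ctameM => //; apply: ctameM; [exact: ctame_cst|exact: ctameX].
    + by apply: tame_Re; apply: ctameM => //; apply: ctameM; [exact: ctame_cst|exact: ctameX].
  move=> f A A' g B B' _ IHf _ IHg h u ru.
  have [f1 f2] := IHf _ _ ru; have [g1 g2] := IHg _ _ ru; split.
    by apply: rep_ext (add _ _ _ _ f1 g1) => x; rewrite mulrDl.
  by apply: rep_ext (add _ _ _ _ f2 g2) => x; rewrite rmorphD mulrDl.
- move=> f A A' g B B' _ IHf _ IHg h u ru; split.
    have [g1 _] := IHg _ _ ru; have [f1 _] := IHf _ _ g1.
    by apply: rep_ext f1 => x; rewrite mulrA.
  have [_ f2] := IHf _ _ ru; have [_ g2] := IHg _ _ f2.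
  by apply: rep_ext g2 => x; rewrite rmorphM mulrA [_^*%C * _^*%C]mulrC.
- move=> f A A' _ IH g u ru; have [f1 f2] := IH _ _ ru; split => //.
  by apply: rep_ext f1 => x; rewrite conjcK.
Qed.

(** The functional calculus on which [measure_bound] rests, obtained from the moments alone. *)
Lemma ip_calc f A A' : calc a f A A' -> ip phi (A phi) = cint (fun x => complex.Re (f x)).
Proof.
move=> /rep_calc /(_ _ _ rep_phi)[[_ _ h _] _].
have := h 0%N 1; rewrite /= (_ : vscale 1 _ = A phi); last first.
  by apply/funext => j; rewrite /vscale mul1r.
by move=> ->; congr cint; apply/funext => x; rewrite expr0 !mulr1 mul1r.
Qed.

End Moments.

(** * Bounding the measure by functions of the operator *)

Section Spectral.
Variable R : realType.
Variable mu : {finite_measure set (borelC R) -> \bar R}.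
Variable a : int -> R[i].
Hypothesis ad : forall n, unit_disk (a n).
Variable phi : int -> R[i].
Hypothesis lphi : ell2 phi.
Hypothesis hmu : is_spectral_measure (ecmv a) phi mu.
Local Notation E := (opE a).
Local Notation cint := (cint mu).

Lemma spectral_res (w : R) : 2 <= w -> exists psi, res mu a phi w psi.
Proof.
move=> w2; have [_ /(_ w%:C%C)] := hmu.
have -> : normc w%:C%C != 1 :> R.
  by rewrite normc_sqrt_nsq nsqR sqrtr_sqr ger0_norm ?gt_eqF //; lra.
move=> /(_ isT)[psi [l2psi eq] hin]; exists psi.
have lpsi := l2_ell2 l2psi; have lp := lphi.
split => //.
  apply/funext => j; rewrite -ecmv_apply; have := eq j => /eqP.
  by rewrite subr_eq addrC => /eqP ->.
pose r (x : R[i]) := (x - w%:C%C)^-1.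
have hRe : ip phi psi = cint (fun x => complex.Re (r x)).
  rewrite [RHS](_ : _ = complex.Re (cauchy_transform mu w%:C%C)) // -hin /=.
  by congr (limn _); apply/funext => N; rewrite [RHS](_ : _ = complex.Re (win (fun n => (phi n)^*%C * psi n) N)) // cRe_sum;
    congr win; apply/funext => j; case: (phi j) (psi j) => p q [s t]; rewrite /rdot /=; ring.
(* Rotating [psi] by [i] turns the real inner product into minus the imaginary part. *)
have hIm : ip phi (vscale 'i%C psi) = - cint (fun x => complex.Im (r x)).
  rewrite (_ : cint _ = complex.Im (cauchy_transform mu w%:C%C)) // -hin /=.
  have -> : vscale 'i%C psi = vscale (-1)%:C%C (vscale (- 'i%C) psi).
    by apply/funext => j; rewrite /vscale rmorphN mulN1r mulNr opprK.
  rewrite ipRr ?mulN1r //; last exact: ell2_scale.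
  congr (- limn _); apply/funext => N; rewrite [RHS](_ : _ = complex.Im (win (fun n => (phi n)^*%C * psi n) N)) // cIm_sum.
  by congr win; apply/funext => j; rewrite /vscale; case: (phi j) (psi j) => p q [s t];
    rewrite /rdot /=; ring.
have cr : ctame r by exact: ctame_resolvent.
move=> c.
have -> : vscale c psi =
    vadd (vscale (complex.Re c)%:C%C psi) (vscale (complex.Im c)%:C%C (vscale 'i%C psi)).
  apply/funext => j; rewrite /vadd /vscale mulrA -mulrDl; congr (_ * _).
  by case: c => p q; congr Complex => /=; ring.
rewrite ipDr //; [|exact: ell2_scale|by do 2!apply: ell2_scale].
rewrite !ipRr //; last exact: ell2_scale.
rewrite hRe hIm mulrN -mulNr -(cintZ mu _ (proj1 cr)) -(cintZ mu _ (proj2 cr)).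
rewrite -cintD; first by apply: cint_eq => x _; rewrite /r; case: c (_^-1) => p q [s t] /=; ring.
  by apply: tameM; [exact: tame_cst|case: cr].
by apply: tameM; [exact: tame_cst|case: cr].
Qed.

(* Partial sums of the Neumann series of                                      *)
(* [(1 + Q)^-1 = lam / (1 - (1 - lam (1 + Q)))].                              *)
Lemma approx_inverse Q A A' (lam : R) n : calc a Q A A' -> 0 <= lam ->
  (forall x, unit_circle x -> [/\ complex.Im (Q x) = 0, 0 <= complex.Re (Q x) &
      lam * (1 + complex.Re (Q x)) <= 1]) ->
  exists p P P', calc a p P P' /\ forall x, unit_circle x -> complex.Im (p x) = 0 /\
    let r := complex.Re (p x) in let q := complex.Re (Q x) in
    [/\ 0 <= r, r * (1 + q) <= 1 & 1 - r * (1 + q) <= (1 - lam) ^+ n].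
Proof.
move=> cQ lam0 hQ; elim: n => [|n [p [P [P' [cP hp]]]]].
  exists (fun=> 0), (vscale 0), (vscale 0^*%C); split; first exact: calc_cst.
  by move=> x cx /=; rewrite mul0r subr0 expr0; split.
have c1 := calc_cst a 1.
have cl := calc_cst a lam%:C%C; have cml := calc_cst a (- lam)%:C%C.
have c := calc_add cl (calc_mul (calc_add c1 (calc_mul cml (calc_add c1 cQ))) cP).
do 3!eexists; split; first exact: c.
move=> x cx; have [iQ q0 l1] := hQ x cx; have [ip0 [r0 r1 rn]] := hp x cx.
case: (Q x) iQ q0 l1 (p x) ip0 r0 r1 rn => q q' /= -> q0 l1 [r r'] /= -> r0 r1 rn.
split; first by ring.
have lam1 : lam <= 1 by nra.
set s := 1 - lam * (1 + q); have s0 : 0 <= s by rewrite /s; lra.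
have sl : s <= 1 - lam by rewrite /s; nra.
rewrite (_ : lam + _ = lam + s * r); last by rewrite /s; ring.
have e : (lam + s * r) * (1 + q) = 1 - s * (1 - r * (1 + q)) by rewrite /s; ring.
split; first by apply: addr_ge0 => //; exact: mulr_ge0.
  by rewrite e; have := mulr_ge0 s0 (_ : 0 <= 1 - r * (1 + q)); rewrite subr_ge0 => /(_ r1); lra.
rewrite e opprB addrC subrK exprS.
by apply: ler_pM => //; rewrite subr_ge0.
Qed.

(** The hypothesis on [s] is the Legendre-dual form of [<b, Q(E) b> <= s]; in this form bounds for
    several [Q] simply add ([finite_union_form]). The factor 4 reflects [Q / (1 + Q) >= 1 / 2] on
    [B] and another factor 2 lost to the approximate inverse. *)
Lemma measure_bound Q A A' B b s : calc a Q A A' ->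
  (forall x, unit_circle x -> complex.Im (Q x) = 0 /\ 0 <= complex.Re (Q x)) ->
  measurable (B : set (borelC R)) -> (forall x, B x -> unit_circle x /\ 1 <= complex.Re (Q x)) ->
  ell2 b ->
  (forall th, ell2 th -> 2 * ip b (A th) <= s + ip th (A th)) ->
  (mu B <= (4 * (ip (vadd phi (vscale (-1)%:C%C b)) (vadd phi (vscale (-1)%:C%C b)) + s))%:E)%E.
Proof.
move=> cQ hQ mB hB lb hs; have lp := lphi.
have [M M0 hM] := calc_bounded cQ.
have QM x : unit_circle x -> complex.Re (Q x) <= M + 1.
  move=> /circleP cx; have := hM x cx; rewrite /nsq.
  have := sqr_ge0 (complex.Im (Q x)); have := sqr_ge0 (complex.Re (Q x) - 1); nra.
(* Chosen so that [lam (1 + Q) <= 1] on the circle. *)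
pose lam := (M + 2)^-1.
have lam0 : 0 < lam by rewrite invr_gt0; lra.
have lam1 : lam < 1 by rewrite invf_lt1; lra.
have hQl x : unit_circle x -> [/\ complex.Im (Q x) = 0, 0 <= complex.Re (Q x) &
      lam * (1 + complex.Re (Q x)) <= 1].
  move=> cx; have [h1 h2] := hQ x cx; split => //.
  by rewrite /lam mulrC ler_pdivrMr; [have := QM x cx|]; lra.
(* A residual of at most 1/2 gives [p (1 + Q) >= 1 / 2] on the circle. *)
have [n hn] : exists n, (1 - lam) ^+ n <= 2^-1.
  have c := @cvg_expr R (1 - lam) _.
  have : `|1 - lam| < 1 by rewrite ger0_norm; lra.
  move=> /c /cvgrPdist_le /(_ 2^-1 _)[|n _ hn]; first by rewrite invr_gt0.
  exists n; have := hn n (leqnn n); rewrite /= sub0r normrN ger0_norm //.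
  by rewrite exprn_ge0 //; lra.
have [p [P [P' [cP hp]]]] := approx_inverse n cQ (ltW lam0) hQl.
have gQ : tame (fun x => complex.Re (Q x)) by case: (ctame_calc cQ).
have gp : tame (fun x => complex.Re (p x)) by case: (ctame_calc cP).
pose q x := complex.Re (Q x); pose r x := complex.Re (p x).
pose F x := q x * r x.
have gF : tame F by exact: tameM.
have hr := spectral_res.
have lP : ell2 (P phi) by case: (calc_ell2 ad cP) => + _; apply.
have lAP : ell2 (A (P phi)) by case: (calc_ell2 ad cQ) => + _; apply.
have i1 : ip phi (A (P phi)) = cint F.
  rewrite (ip_calc ad lp hr (calc_mul cQ cP)); apply: cint_eq => x cx.
  have [iq _] := hQ x cx; have [ir _] := hp x cx.
  by rewrite /F /q /r; case: (Q x) (p x) iq ir => ? ? [? ?] /= -> ->; ring.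
have cAP := calc_mul cQ cP.
have i2 : ip (A (P phi)) (A (P phi)) = cint (fun x => F x * F x).
  rewrite (calc_adj ad cAP) // (ip_calc ad lp hr (calc_mul (calc_conj cAP) cAP)).
  apply: cint_eq => x cx; have [iq _] := hQ x cx; have [ir _] := hp x cx.
  by rewrite /F /q /r; case: (Q x) (p x) iq ir => ? ? [? ?] /= -> ->; ring.
have i3 : ip (P phi) (A (P phi)) = cint (fun x => F x * r x).
  rewrite (calc_adj ad cP) // (ip_calc ad lp hr (calc_mul (calc_conj cP) cAP)).
  apply: cint_eq => x cx; have [iq _] := hQ x cx; have [ir _] := hp x cx.
  by rewrite /F /q /r; case: (Q x) (p x) iq ir => ? ? [? ?] /= -> ->; ring.
set chi := vadd phi _.
have lchi : ell2 chi by apply: ell2_add => //; exact: ell2_scale.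
(* Evaluate the two quadratic forms of the parallel sum near the optimal      *)
(* splitting of [phi], given by [P phi] with [P] close to [(1 + Q(E))^-1].    *)
have h1 : 2 * ip phi (A (P phi)) <=
   ip chi chi + ip (A (P phi)) (A (P phi)) + (s + ip (P phi) (A (P phi))).
  have -> : ip phi (A (P phi)) = ip (vadd chi b) (A (P phi)).
    by congr ip; apply/funext => j; rewrite /chi /vadd /vscale rmorphN mulN1r subrK.
  by rewrite ipDl // mulrDr lerD ?hs // ip_amgm.
(* Pointwise, [F^2 + F r = F r (1 + q) <= F]. *)
have h2 : cint (fun x => F x * F x) + cint (fun x => F x * r x) <= cint F.
  rewrite -cintD; [|exact: tameM|exact: tameM].
  apply: cint_le => //; first by apply: tameD; exact: tameM.
  move=> x cx; have [_ q0] := hQ x cx; have [_ [r0 r1 _]] := hp x cx.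
  rewrite -mulrDr ler_piMr //; first exact: mulr_ge0.
  by rewrite /F /q /r; rewrite mulrDr mulr1 in r1; rewrite mulrC addrC.
have h3 : cint F <= ip chi chi + s by rewrite i1 i2 i3 in h1; lra.
have gB : tame (\1_B : borelC R -> R).
  split; first by apply: measurable_indic.
  by exists 1 => x _; rewrite ger0_norm // indicE; case: (_ \in _).
(* On [B], [q r >= q / (2 (1 + q)) >= 1 / 4]. *)
have h4 : 4^-1 * cint (\1_B) <= cint F.
  rewrite -cintZ //; apply: cint_le => //; first by apply: tameM => //; exact: tame_cst.
  move=> x cx; have [_ q0] := hQ x cx; have [_ [r0 r1 rn]] := hp x cx.
  rewrite indicE; case: (boolP (x \in B)) => [/set_mem /hB[_ q1]|_]; last first.
    by rewrite mulr0 mulr_ge0.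
  rewrite mulr1 /F /q /r; move: (complex.Re _) (complex.Re _) q0 r0 r1 rn q1 => q' r' *.
  nra.
have muB := cint_indic mu mB (fun x Bx => proj1 (hB x Bx)).
rewrite -[mu B]fineK ?fin_num_measure // lee_fin.
by rewrite muB in h4; lra.
Qed.

End Spectral.

(** * The Szego recursion *)

Section Transfer.
Variable R : realType.
Implicit Types (z : R[i]) (alpha : nat -> R[i]).

Definition pnsq (p : R[i] * R[i]) : R := nsq p.1 + nsq p.2.

Lemma pnsq_ge0 p : 0 <= pnsq p.
Proof. by rewrite addr_ge0 ?nsq_ge0. Qed.

(* In the notation of the paper, [(p n).1 = eta_(2n+1)] and                   *)
(* [(p n).2 = eta_(2n)].                                                      *)
Definition szego z (a : R[i]) (p : R[i] * R[i]) : R[i] * R[i] :=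
  ((rho a)%:C%C^-1 * (z * p.1 - a^*%C * p.2),
   (rho a)%:C%C^-1 * (- a * z * p.1 + p.2)).

Definition szego_orbit alpha z (p : nat -> R[i] * R[i]) :=
  forall n, p n.+1 = szego z (alpha n) (p n).

Definition mass (p : nat -> R[i] * R[i]) K : R := \sum_(n < K.+1) pnsq (p n).

Lemma mass_ge0 p K : 0 <= mass p K.
Proof. by apply: sumr_ge0 => i _; exact: pnsq_ge0. Qed.

Lemma massS p K : mass p K.+1 = mass p K + pnsq (p K.+1).
Proof. by rewrite /mass big_ord_recr. Qed.

Lemma mass_nd p K K' : (K <= K')%N -> mass p K <= mass p K'.
Proof.
move=> h; rewrite -(subnK h); elim: (K' - K)%N => [|d IH]; first by rewrite add0n.
by rewrite addSn massS; apply: (le_trans IH); rewrite lerDl pnsq_ge0.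
Qed.

(** Odd lengths [2K + 1] end at complete pairs, and at integers the interpolation in [norm_interp]
    drops out. *)
Lemma orbit_power_law alpha z p (g1 g2 C1 C2 L0 : R) K :
  power_law_bounds alpha g1 g2 z C1 C2 L0 -> szego_orbit alpha z p -> pnsq (p 0%N) = 2 ->
  L0 <= K.*2.+1%:R ->
  C1 * K.*2.+1%:R `^ g1 <= Num.sqrt (mass p K) <= C2 * K.*2.+1%:R `^ g2.
Proof.
move=> hpl sp p0 hL; pose eta j := if odd j then (p j./2).1 else (p j./2).2.
have := hpl eta _ _ K.*2.+1%:R _ hL.
have -> : norm_interp eta K.*2.+1%:R = Num.sqrt (mass p K).
  rewrite /norm_interp natrK subrr mul0r addr0 /norm_upto; congr Num.sqrt.
  elim: K {hL} => [|K IH].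
    by rewrite big_ord_recr /= big_ord1 /mass big_ord1 /eta /= !normc_nsq addrC.
  rewrite doubleS big_ord_recr /= big_ord_recr /= IH massS -addrA; congr (_ + _).
  by rewrite /eta /= !odd_double /= !doubleK !normc_nsq uphalf_double addrC.
apply.
- move=> n; rewrite /eta /= !odd_double /= !uphalf_double !doubleK sp /szego /transfer_matrix.
  apply/matrixP => i j; rewrite !mxE; have -> : j = 0 by apply/val_inj; case: j => -[].
  rewrite big_ord_recl big_ord1 !mxE /=.
  by case: i => -[|[|]] //= _; ring.
- by rewrite /normalized /eta /= !normc_nsq addrC.
- by rewrite ltr0n.
Qed.

Fixpoint orbit_from alpha z (p0 : R[i] * R[i]) n :=
  if n is n'.+1 then szego z (alpha n') (orbit_from alpha z p0 n') else p0.

Lemma orbit_fromP alpha z p0 : szego_orbit alpha z (orbit_from alpha z p0).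
Proof. by []. Qed.

Section Disk.
Variable alpha : nat -> R[i].
Hypothesis ad : forall n, unit_disk (alpha n).
Variable z : R[i].
Hypothesis z1 : nsq z = 1.

Lemma rhoC_neq0 n : (rho (alpha n))%:C%C != 0 :> R[i].
Proof. by rewrite fmorph_eq0 gt_eqF // rho_gt0. Qed.

Lemma rhoC_sq n : (rho (alpha n))%:C%C ^+ 2 = 1 - (alpha n)^*%C * alpha n.
Proof. by rewrite mulJ -rmorphXn rho_sq // rmorphB. Qed.

Lemma z_neq0 : z != 0.
Proof. by apply/eqP => h; move: z1; rewrite h nsq0 => /eqP; rewrite eq_sym oner_eq0. Qed.

Lemma szego_inv n y : exists x, szego z (alpha n) x = y.
Proof.
set r := (rho (alpha n))%:C%C : R[i].
exists (z^-1 * r^-1 * (y.1 + (alpha n)^*%C * y.2), r^-1 * (y.2 + alpha n * y.1)).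
rewrite /szego -/r; have rn := rhoC_neq0 n; have rs := rhoC_sq n; rewrite -/r in rn rs.
have e : alpha n * (alpha n)^*%C = 1 - r ^+ 2 by rewrite rs; ring.
case: y => y1 y2 /=; congr (_, _).
  transitivity (r^-1 ^+ 2 * (y1 * (1 - alpha n * (alpha n)^*%C))).
    by have zn := z_neq0; field; rewrite rn.
  by rewrite e; field; rewrite rn.
transitivity (r^-1 ^+ 2 * (y2 * (1 - alpha n * (alpha n)^*%C))).
  by have zn := z_neq0; field; rewrite rn.
by rewrite e; field; rewrite rn.
Qed.

Lemma orbit_through N y : exists2 p, szego_orbit alpha z p & p N = y.
Proof.
elim: N y => [|N IH] y; first by exists (orbit_from alpha z y).
have [x hx] := szego_inv N y; have [p sp pN] := IH x.
by exists p => //; rewrite sp pN.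
Qed.

Definition pscale c (p : R[i] * R[i]) := (c * p.1, c * p.2).

Lemma szegoZ a c p : szego z a (pscale c p) = pscale c (szego z a p).
Proof. by rewrite /szego /pscale /=; congr (_, _); ring. Qed.

Lemma pnsqZ (c : R[i]) (p : R[i] * R[i]) : pnsq (pscale c p) = nsq c * pnsq p.
Proof. by rewrite /pnsq /pscale /= !nsqM -mulrDr. Qed.

(** The recursion is invertible, so [y] can be traced back to index 0, where its size determines
    [k]. The zero pair takes [k = 0] with an arbitrary normalized orbit. *)
Lemma orbit_normalized_through N y : exists k p, [/\ 0 <= k, szego_orbit alpha z p, pnsq (p 0%N) = 2 &
  y = pscale k%:C%C (p N)].
Proof.
case: (eqVneq y (0, 0)) => [->|y0].
  exists 0, (orbit_from alpha z (1, 1)); split; [by []|exact: orbit_fromP| |].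
    by rewrite /pnsq /nsq /=; ring.
  by rewrite /pscale !mul0r.
have [q sq qN] := orbit_through N y.
have q0 : 0 < pnsq (q 0%N).
  rewrite lt_def pnsq_ge0 andbT; apply: contra_neq y0 => h; rewrite -qN {qN}.
  elim: N => [|N IH].
    have := nsq_ge0 (q 0%N).1; have := nsq_ge0 (q 0%N).2 => h1 h2.
    rewrite /pnsq in h; rewrite [q 0%N]surjective_pairing; congr (_, _).
      by apply: nsq_eq0; lra.
    by apply: nsq_eq0; lra.
  by rewrite sq IH /szego /= !(mulr0, oppr0, addr0).
pose k := Num.sqrt (pnsq (q 0%N) / 2).
have k0 : 0 < k by rewrite sqrtr_gt0 divr_gt0.
exists k, (fun n => pscale k^-1%:C%C (q n)); split.
- exact: ltW.
- by move=> n; rewrite szegoZ sq.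
- rewrite pnsqZ nsqR exprVn sqr_sqrtr; last by rewrite divr_ge0 // ltW.
  by field; rewrite gt_eqF.
- rewrite qN /pscale /= !mulrA -rmorphM divff ?gt_eqF // !mul1r; exact: surjective_pairing.
Qed.

Definition wedge (p r : R[i] * R[i]) : R[i] := p.1 * r.2 - p.2 * r.1.

(** The transfer matrix has determinant [z], so the modulus of the Wronskian is conserved for [z] on
    the circle. *)
Lemma wedge_szego n p r :
  wedge (szego z (alpha n) p) (szego z (alpha n) r) = z * wedge p r.
Proof.
have rn := rhoC_neq0 n; have rs := rhoC_sq n.
rewrite /wedge /szego /=; set t := (rho _)%:C%C in rn rs *.
transitivity (t^-1 ^+ 2 * z * (1 - (alpha n)^*%C * alpha n) * (p.1 * r.2 - p.2 * r.1)).
  by ring.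
by rewrite -rs; field; rewrite rn.
Qed.

Lemma wedge_orbit p r n : szego_orbit alpha z p -> szego_orbit alpha z r ->
  nsq (wedge (p n) (r n)) = nsq (wedge (p 0%N) (r 0%N)).
Proof.
move=> sp sr; elim: n => // n IH.
by rewrite sp sr wedge_szego nsqM z1 mul1r.
Qed.

Lemma nsq_wedge p r : nsq (wedge p r) <= pnsq p * pnsq r.
Proof.
case: p r => [[a b] [c d]] [[e f] [g h]]; rewrite /wedge /pnsq /nsq /= -subr_ge0.
rewrite (_ : _ - _ = (a * e + b * f + c * g + d * h) ^+ 2 + (a * f - b * e + c * h - d * g) ^+ 2); last by ring.
by rewrite addr_ge0 ?sqr_ge0.
Qed.

(** One step of Cauchy-Schwarz, shaped for the induction in [drift_bound]. *)
Lemma nsqD_prod (x y : R[i]) (A B A' B' : R) : 0 <= A -> 0 <= B -> 0 <= A' -> 0 <= B' ->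
  nsq x <= A * B -> nsq y <= A' * B' -> nsq (x + y) <= (A + A') * (B + B').
Proof.
move=> A0 B0 A'0 B'0 hx hy; rewrite nsqD.
have cs : rdot x y ^+ 2 <= nsq x * nsq y.
  case: x y {hx hy} => a b [c d]; rewrite /rdot /nsq /= -subr_ge0.
  rewrite (_ : _ - _ = (a * d - b * c) ^+ 2); last by ring.
  exact: sqr_ge0.
have h : rdot x y ^+ 2 <= (A * B') * (A' * B).
  apply: (le_trans cs); apply: (le_trans (ler_pM (nsq_ge0 _) (nsq_ge0 _) hx hy)).
  by rewrite le_eqVlt; apply/orP; left; apply/eqP; ring.
have X0 : 0 <= A * B' by rewrite mulr_ge0.
have Y0 : 0 <= A' * B by rewrite mulr_ge0.
suff : 2 * rdot x y <= A * B' + A' * B by lra.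
have := sqr_ge0 (A * B' - A' * B); move: (A * B') (A' * B) X0 Y0 h => X Y X0 Y0 h h2.
have [t0|t0] := lerP (rdot x y) 0; first by lra.
rewrite -(@ler_sqr _ (2 * _)) ?nnegrE; [|by lra..].
by nra.
Qed.

(* By Cramer's rule the coefficients of a perturbed orbit [u] on two orbits   *)
(* [p] and [r] drift by the Wronskians of the perturbation with [r] and [p].  *)
Section Duhamel.
Variables (p r u h : nat -> R[i] * R[i]) (N0 : nat).
Hypothesis sp : szego_orbit alpha z p.
Hypothesis sr : szego_orbit alpha z r.
Hypothesis pr : nsq (wedge (p 0%N) (r 0%N)) = 4.
Hypothesis hu : forall n, (N0 <= n)%N -> u n.+1 = szego z (alpha n) ((u n).1 + (h n).1, (u n).2 + (h n).2).
Variable k : R[i].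
Hypothesis hk : u N0 = pscale k (p N0).

Let W n := wedge (p n) (r n).
Let c n := wedge (u n) (r n) / W n.
Let d n := wedge (p n) (u n) / W n.

Let W4 n : nsq (W n) = 4. Proof. by rewrite /W wedge_orbit. Qed.
Let Wn0 n : W n != 0.
Proof. by apply/eqP => e; have := W4 n; rewrite e nsq0 => /eqP; rewrite eq_sym pnatr_eq0. Qed.

Lemma cramer n : u n = ((c n) * (p n).1 + d n * (r n).1, c n * (p n).2 + d n * (r n).2).
Proof.
have := Wn0 n; rewrite /c /d /W /wedge [u n]surjective_pairing /= => w0.
by congr (_, _); field.
Qed.

Lemma drift_c n : (N0 <= n)%N -> c n.+1 = c n + wedge (h n) (r n) / W n.
Proof.
move=> hn; rewrite /c hu // sr /W sp sr !wedge_szego -mulrDl.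
rewrite invfM mulrACA divff ?z_neq0 // mul1r; congr (_ / _).
by rewrite /wedge /=; ring.
Qed.

Lemma drift_d n : (N0 <= n)%N -> d n.+1 = d n + wedge (p n) (h n) / W n.
Proof.
move=> hn; rewrite /d hu // sp /W sp sr !wedge_szego -mulrDl.
rewrite invfM mulrACA divff ?z_neq0 // mul1r; congr (_ / _).
by rewrite /wedge /=; ring.
Qed.

(** The coefficients start at [c = k] and [d = 0], and their increments are summed by
    Cauchy-Schwarz; 1/4 is the inverse squared modulus of the Wronskian. *)
Lemma drift_bound n :
  nsq (c (N0 + n)%N - k) <= 4^-1 * (\sum_(i < n) pnsq (r (N0 + i)%N)) * \sum_(i < n) pnsq (h (N0 + i)%N) /\
  nsq (d (N0 + n)%N) <= 4^-1 * (\sum_(i < n) pnsq (p (N0 + i)%N)) * \sum_(i < n) pnsq (h (N0 + i)%N).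
Proof.
have sum0 (f : nat -> R[i] * R[i]) m : 0 <= \sum_(i < m) pnsq (f (N0 + i)%N).
  by apply: sumr_ge0 => i _; exact: pnsq_ge0.
have Vq m y : nsq (y / W m) = 4^-1 * nsq y.
  have : nsq ((y / W m) * W m) = nsq y by rewrite divfK.
  by rewrite nsqM W4 => <-; field.
elim: n => [|n [IHc IHd]].
  rewrite addn0 !big_ord0 !mulr0 /c /d hk; split.
    rewrite (_ : wedge (pscale k (p N0)) (r N0) = k * W N0); last first.
      by rewrite /wedge /pscale /W /wedge /=; ring.
    by rewrite mulfK // subrr nsq0.
  rewrite (_ : wedge (p N0) (pscale k (p N0)) = 0); last by rewrite /wedge /pscale /=; ring.
  by rewrite mul0r nsq0.
rewrite addnS !big_ord_recr /= drift_c ?leq_addr // drift_d ?leq_addr //; split.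
  rewrite addrAC [X in _ <= X * _]mulrDr; apply: nsqD_prod; rewrite ?mulr_ge0 ?invr_ge0 ?sum0 ?pnsq_ge0 //.
  by rewrite Vq -mulrA ler_pM2l // mulrC (le_trans (nsq_wedge _ _)) // mulrC.
rewrite [X in _ <= X * _]mulrDr; apply: nsqD_prod; rewrite ?mulr_ge0 ?invr_ge0 ?sum0 ?pnsq_ge0 //.
by rewrite Vq -mulrA ler_pM2l // nsq_wedge.
Qed.

End Duhamel.

(** Squared norm interpolated between [K] and [K.+1]; continuity in [t] permits an exact balance in
    [balance_point]. *)
Definition wmass (p : nat -> R[i] * R[i]) K (t : R) := mass p K + t * pnsq (p K.+1).

(** Write [k p = u - ((c - k) p + d r)]. By [drift_bound] the bracket costs at most
    [Phi (Q |p|^2 + P |r|^2)] at each index, and summing with the weights of [wmass] turns this into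
    [2 P Q Phi]. *)
Lemma duhamel p r u h N0 K (t : R) k (Phi : R) :
  szego_orbit alpha z p -> szego_orbit alpha z r -> nsq (wedge (p 0%N) (r 0%N)) = 4 ->
  (forall n, (N0 <= n)%N -> u n.+1 = szego z (alpha n) ((u n).1 + (h n).1, (u n).2 + (h n).2)) ->
  u N0 = pscale k (p N0) -> (N0 <= K)%N -> 0 <= t <= 1 ->
  \sum_(N0 <= n < K.+1) pnsq (h n) <= Phi ->
  nsq k * (wmass p K t - mass p N0) <=
    2 * \sum_(N0 <= n < K.+2) pnsq (u n) + 2 * (wmass p K t * wmass r K t) * Phi.
Proof.
move=> sp sr pr hu hk NK /andP[t0 t1] hPhi.
set P := wmass p K t; set Q := wmass r K t.
have shift (f : nat -> R) n : \sum_(i < n) f (N0 + i)%N = \sum_(N0 <= i < N0 + n) f i.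
  rewrite [RHS](_ : _ = \sum_(0 + N0 <= i < N0 + n) f i) // big_addn addKn big_mkord.
  by apply: eq_bigr => i _; rewrite addnC.
have sub_mass q n : (n <= K.+1)%N -> \sum_(N0 <= i < n) pnsq (q i) <= mass q K.
  move=> hn; rewrite /mass -(big_mkord xpredT (fun i => pnsq (q i))).
  have [nN|Nn] := leqP n N0; first by rewrite [leLHS]big_geq //; apply: sumr_ge0 => i _; exact: pnsq_ge0.
  rewrite [leRHS](big_cat_nat _ (n := N0)) //=; last exact: (leq_trans (ltnW Nn)).
  rewrite [X in _ <= _ + X](big_cat_nat _ (n := n)) //=; last exact: ltnW.
  rewrite addrCA lerDl addr_ge0 // sumr_ge0 // => i _; exact: pnsq_ge0.
have hPhi' n : (n <= K.+1)%N -> \sum_(N0 <= i < n) pnsq (h i) <= Phi.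
  move=> hn; apply: le_trans hPhi.
  have [nN|Nn] := leqP n N0; first by rewrite [leLHS]big_geq //; apply: sumr_ge0 => i _; exact: pnsq_ge0.
  rewrite [leRHS](big_cat_nat _ (n := n)) //=; last exact: ltnW.
  by rewrite lerDl sumr_ge0 // => i _; exact: pnsq_ge0.
have Phi0 : 0 <= Phi by apply: le_trans hPhi; apply: sumr_ge0 => i _; exact: pnsq_ge0.
have mP : mass p K <= P by rewrite /P /wmass lerDl mulr_ge0 ?pnsq_ge0.
have mQ : mass r K <= Q by rewrite /Q /wmass lerDl mulr_ge0 ?pnsq_ge0.
have P0 : 0 <= P by apply: le_trans mP; exact: mass_ge0.
have Q0 : 0 <= Q by apply: le_trans mQ; exact: mass_ge0.
have key n : (N0 <= n <= K.+1)%N ->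
    nsq k * pnsq (p n) <= 2 * pnsq (u n) + Phi * (Q * pnsq (p n) + P * pnsq (r n)).
  move=> /andP[Nn nK]; have [hc hd] := drift_bound sp sr pr hu hk (n - N0)%N.
  have sum0 q : 0 <= \sum_(N0 <= i < n) pnsq (q i) by apply: sumr_ge0 => i _; exact: pnsq_ge0.
  rewrite !(shift (fun i => pnsq (_ i))) subnKC // in hc hd.
  have cr := cramer u sp sr pr n.
  set c := _ / _ in hc cr; set d := (wedge (p n) (u n)) / _ in hd cr.
  have hc' : nsq (c - k) <= 4^-1 * Q * Phi.
    apply: (le_trans hc); rewrite -!mulrA ler_pM2l //.
    by apply: ler_pM => //; [exact: le_trans (sub_mass _ _ nK) mQ|exact: hPhi'].
  have hd' : nsq d <= 4^-1 * P * Phi.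
    apply: (le_trans hd); rewrite -!mulrA ler_pM2l //.
    by apply: ler_pM => //; [exact: le_trans (sub_mass _ _ nK) mP|exact: hPhi'].
  have bd (x x' y y' : R[i]) (m : R[i]) : m = c * x + d * y ->
      nsq k * nsq x <= 2 * nsq m + 4 * (nsq (c - k) * nsq x + nsq d * nsq y).
    move=> ->; have -> : nsq k * nsq x = nsq ((c * x + d * y) + - ((c - k) * x + d * y)).
      by rewrite -nsqM; congr nsq; ring.
    apply: (le_trans (nsqD_le _ _)); rewrite nsqN.
    have := nsqD_le ((c - k) * x) (d * y); rewrite !nsqM; lra.
  have b1 := bd (p n).1 0 (r n).1 0 (u n).1 _.
  have b2 := bd (p n).2 0 (r n).2 0 (u n).2 _.
  have {}b1 := b1 (congr1 fst cr); have {}b2 := b2 (congr1 snd cr).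
  have e1 : 4 * (nsq (c - k) * pnsq (p n)) <= Phi * (Q * pnsq (p n)).
    by have := ler_wpM2r (pnsq_ge0 (p n)) hc'; lra.
  have e2 : 4 * (nsq d * pnsq (r n)) <= Phi * (P * pnsq (r n)).
    by have := ler_wpM2r (pnsq_ge0 (r n)) hd'; lra.
  by rewrite /pnsq in e1 e2 *; lra.
have NK1 : (N0 <= K.+1)%N by exact: leq_trans NK _.
have sumkey : nsq k * \sum_(N0 <= n < K.+1) pnsq (p n) <=
    2 * \sum_(N0 <= n < K.+1) pnsq (u n) +
    Phi * (Q * \sum_(N0 <= n < K.+1) pnsq (p n) + P * \sum_(N0 <= n < K.+1) pnsq (r n)).
  rewrite !mulr_sumr -!big_split /= mulr_sumr -big_split /=.
  rewrite big_seq_cond [leRHS]big_seq_cond; apply: ler_sum => n; rewrite andbT mem_index_iota => /andP[h1 h2].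
  by rewrite key // h1 ltnW.
have lastkey := key K.+1; rewrite NK1 leqnn in lastkey; have {}lastkey := lastkey isT.
have lastkey' := ler_wpM2l t0 lastkey.
have sp1 := sub_mass p K.+1 (leqnn _); have sr1 := sub_mass r K.+1 (leqnn _).
have lhs : nsq k * (P - mass p N0) <=
   nsq k * \sum_(N0 <= n < K.+1) pnsq (p n) + t * (nsq k * pnsq (p K.+1)).
  rewrite mulrCA -mulrDr; apply: ler_wpM2l; first exact: nsq_ge0.
  rewrite /P /wmass -addrA [_ + (_ - _)]addrCA -[leRHS]addrC lerD2l lerBlDr.
  rewrite {1}/mass -(big_mkord xpredT (fun i => pnsq (p i))) (big_cat_nat _ (n := N0)) //=.
  rewrite addrC lerD2l {1}/mass -(big_mkord xpredT (fun i => pnsq (p i))) big_nat_recr //=.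
  by rewrite lerDl pnsq_ge0.
apply: (le_trans lhs).
rewrite [in leRHS]big_nat_recr //=.
have tu : t * pnsq (u K.+1) <= pnsq (u K.+1) by rewrite ler_piMl ?pnsq_ge0.
have pq1 : Phi * (Q * \sum_(N0 <= n < K.+1) pnsq (p n)) <= Phi * (Q * mass p K).
  by rewrite ler_wpM2l // ler_wpM2l.
have pq2 : Phi * (P * \sum_(N0 <= n < K.+1) pnsq (r n)) <= Phi * (P * mass r K).
  by rewrite ler_wpM2l // ler_wpM2l.
have eP : Phi * (Q * mass p K) + Phi * (Q * (t * pnsq (p K.+1))) = Phi * (Q * P).
  by rewrite -!mulrDr.
have eQ : Phi * (P * mass r K) + Phi * (P * (t * pnsq (r K.+1))) = Phi * (P * Q).
  by rewrite -!mulrDr.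
by lra.
Qed.

End Disk.
End Transfer.

(** * From the operator to perturbed Szego orbits *)

Section Bridge.
Variable R : realType.
Variable a : int -> R[i].
Hypothesis ad : forall n, unit_disk (a n).
Implicit Types (y : int -> R[i]) (z : R[i]).
Local Notation E := (opE a).
Local Notation alpha := (fun n : nat => a n%:Z).
Local Notation M := (blk false a).

Lemma rhoZ_neq0 n : (rho (a n))%:C%C != 0 :> R[i].
Proof. by rewrite fmorph_eq0 gt_eqF // rho_gt0. Qed.

Lemma rhoZ_sq n : (rho (a n))%:C%C ^+ 2 = 1 - (a n)^*%C * a n.
Proof. by rewrite mulJ -rmorphXn rho_sq // rmorphB. Qed.

Lemma blk_pair e y j : evenz j == e ->
  blk e a y j = (a j)^*%C * y j + (rho (a j))%:C%C * y (j + 1) /\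
  blk e a y (j + 1) = (rho (a j))%:C%C * y j - a j * y (j + 1).
Proof.
move=> ej; split; first exact: blk_start.
by rewrite blk_end ?addrK // evenzS; case: (evenz j) e ej => [] [].
Qed.

Lemma evenz_nat (n : nat) : evenz n%:Z = ~~ odd n.
Proof.
elim: n => // n IH; have -> : n.+1%:Z = n%:Z + 1 by lia.
by rewrite evenzS IH.
Qed.

(* The pair [(E y, M y)] read off a block satisfies the Szego recursion; the  *)
(* error [E y - z y] enters without any division by [rho].                    *)
Definition pairs z y (n : nat) : R[i] * R[i] :=
  let s := z ^+ n./2 in
  if odd n then (s * M y n%:Z, s * E y n%:Z) else (s * y n%:Z, s * M y n%:Z).

Definition perturb z y (n : nat) : R[i] * R[i] :=
  let s := z ^+ n./2 in let F := E y n%:Z - z * y n%:Z in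
  if odd n then (0, - (s * F)) else (s * z^-1 * F, 0).

Lemma pairs_rec z y n : z != 0 ->
  pairs z y n.+1 = szego z (alpha n)
    ((pairs z y n).1 + (perturb z y n).1, (pairs z y n).2 + (perturb z y n).2).
Proof.
move=> z0; have rn := rhoZ_neq0 n; have rs := rhoZ_sq n.
have en := evenz_nat n.
have e1 : n.+1%:Z = n%:Z + 1 by lia.
rewrite /pairs /perturb /= e1 /szego; set r := (rho _)%:C%C in rn rs *.
case: (boolP (odd n)) en => on /= en.
  have ev : evenz n%:Z == false by rewrite en.
  have [h1 h2] := blk_pair y ev; rewrite -/r in h1 h2.
  have -> : uphalf n = n./2.+1 by rewrite uphalf_half on.
  rewrite exprS; set s := z ^+ n./2; set F := E y n - _.
  have -> : s * E y n + - (s * F) = s * z * y n by rewrite /F; ring.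
  rewrite addr0 h1 h2; congr (_, _).
    by field; rewrite rn.
  transitivity (r^-1 * (s * z * (r ^+ 2 * y n - a n * r * y (n%:Z + 1)))).
    by field; rewrite rn.
  by rewrite rs; ring.
have ev : evenz n%:Z == true by rewrite en.
have [h1 h2] := blk_pair (M y) ev; rewrite -/r in h1 h2.
have -> : uphalf n = n./2 by rewrite uphalf_half (negbTE on).
set s := z ^+ _; set F := E y n - _.
have -> : s * y n + s / z * F = s * z^-1 * E y n by rewrite /F; field.
rewrite addr0 /opE h1 h2; congr (_, _).
  by field; rewrite rn z0.
transitivity (r^-1 * (s * (r ^+ 2 * M y n - a n * r * M y (n%:Z + 1)))).
  by field; rewrite rn.
by rewrite rs; field; rewrite rn z0.
Qed.

Lemma nsqX z n : nsq z = 1 -> nsq (z ^+ n) = 1.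
Proof.
move=> z1; elim: n => [|n IH]; first by rewrite expr0 /nsq /= expr0n expr1n addr0.
by rewrite exprS nsqM z1 IH mulr1.
Qed.

Lemma pnsq_pairs z y n : nsq z = 1 ->
  pnsq (pairs z y n) <= nsq (y n%:Z) + nsq (M y n%:Z) + nsq (E y n%:Z).
Proof.
move=> z1; rewrite /pairs /pnsq; case: ifP => _ /=; rewrite !nsqM nsqX // !mul1r.
  by have := nsq_ge0 (y n%:Z); lra.
by have := nsq_ge0 (E y n%:Z); lra.
Qed.

(** At an even index the pair consists of [y] and [M y] up to a unimodular factor, hence the even
    starting index in [initial_bound]. *)
Lemma pnsq_pairs_even z y n : nsq z = 1 -> ~~ odd n ->
  pnsq (pairs z y n) = nsq (y n%:Z) + nsq (M y n%:Z).
Proof.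
by move=> z1 /negbTE on; rewrite /pairs on /pnsq /= !nsqM nsqX // !mul1r.
Qed.

Lemma pnsq_perturb z y n : nsq z = 1 -> pnsq (perturb z y n) = nsq (E y n%:Z - z * y n%:Z).
Proof.
move=> z1; rewrite /perturb /pnsq; case: ifP => _ /=.
  by rewrite nsq0 add0r nsqN nsqM nsqX // mul1r.
have zV : nsq z^-1 = 1.
  have : nsq (z^-1 * z) = nsq 1 by rewrite mulVf ?(z_neq0 z1).
  by rewrite nsqM z1 mulr1 => ->; rewrite /nsq /= expr0n expr1n addr0.
by rewrite nsq0 addr0 !nsqM nsqX // zV !mul1r.
Qed.

(** Each block is solved leftwards at the cost of [rho^-2]. This serves across the support of [b],
    where [f] is bounded but not small, so only uniformity in [w], [y] and [f] matters and the
    constant is crude. *)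
Lemma backward_step (j : int) : exists2 K : R, 0 < K &
  forall (w : R[i]) y f G, 1 <= nsq w -> nsq w <= 4 ->
  (forall i, E y i = w * y i + f i) -> (forall i, nsq (f i) <= G) ->
  nsq (y j) + nsq (M y j) <= K * (nsq (y (j + 1)) + nsq (M y (j + 1)) + G).
Proof.
have rn := rhoZ_neq0 j; have rs := rhoZ_sq j.
set r := (rho (a j))%:C%C in rn rs.
pose t := (rho (a j) ^+ 2)^-1.
have r0 : 0 < rho (a j) by exact: rho_gt0.
have t0 : 0 < t by rewrite invr_gt0 exprn_gt0.
have tr x : nsq (r^-1 * x) = t * nsq x.
  have : nsq (r * (r^-1 * x)) = nsq x by rewrite mulrA divff // mul1r.
  by rewrite nsqM nsqR /t => <-; field; rewrite gt_eqF.
have a1 : nsq (a j) <= 1.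
  by have := rho_sq (ad j); have := sqr_ge0 (rho (a j)); lra.
have mu1 (c x : R[i]) : nsq c <= 1 -> nsq (c * x) <= nsq x.
  by move=> c1; rewrite nsqM ler_piMl // nsq_ge0.
have r1 : nsq r <= 1 by rewrite nsqR exprn_ile1 ?rho_ge0 ?rho_le1.
exists (200 * (t + 1)); first by lra.
move=> w y f G w1 w4 hE hf.
have G0 : 0 <= G by apply: le_trans (hf 0); exact: nsq_ge0.
have Y0 := nsq_ge0 (y (j + 1)); have V0 := nsq_ge0 (M y (j + 1)).
set Y := nsq (y (j + 1)) in Y0 *; set V := nsq (M y (j + 1)) in V0 *.
case: (boolP (evenz j)) => ev.
  have ej : evenz j == true by rewrite ev.
  have [h1 h2] := blk_pair (M y) ej.
  rewrite -/r -/(opE a y) !hE in h1 h2.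
  have hv : M y j = r^-1 * (w * y (j + 1) + f (j + 1) + a j * M y (j + 1)).
    by rewrite h2 subrK mulrA mulVf // mul1r.
  have b1 : nsq (M y j) <= t * (16 * Y + 4 * G + 2 * V).
    rewrite hv tr ler_pM2l //; apply: (le_trans (nsqD_le _ _)).
    have := nsqD_le (w * y (j + 1)) (f (j + 1)); rewrite nsqM.
    have := ler_wpM2r Y0 w4; have := hf (j + 1); have := mu1 (a j) (M y (j + 1)) a1.
    rewrite -/Y -/V; lra.
  have b2 : nsq (y j) <= 4 * (nsq (M y j) + V) + 2 * G.
    have e : w * y j = (a j)^*%C * M y j + r * M y (j + 1) + - f j by rewrite -h1 addrK.
    have : nsq (y j) <= nsq (w * y j) by rewrite nsqM ler_peMl // nsq_ge0.
    rewrite e => /le_trans; apply; apply: (le_trans (nsqD_le _ _)); rewrite nsqN.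
    have := nsqD_le ((a j)^*%C * M y j) (r * M y (j + 1)).
    have := mu1 (a j)^*%C (M y j); rewrite nsqJ => /(_ a1).
    have := mu1 r (M y (j + 1)) r1; have := hf j; rewrite -/V; lra.
  have tY : 0 <= t * Y by rewrite mulr_ge0 // ltW.
  have tV : 0 <= t * V by rewrite mulr_ge0 // ltW.
  have tG : 0 <= t * G by rewrite mulr_ge0 // ltW.
  by lra.
have ej : evenz j == false by rewrite (negbTE ev).
have [h1 h2] := blk_pair y ej.
rewrite -/r in h1 h2.
have hy : y j = r^-1 * (M y (j + 1) + a j * y (j + 1)).
  by rewrite h2 subrK mulrA mulVf // mul1r.
have b1 : nsq (y j) <= t * (2 * V + 2 * Y).
  rewrite hy tr ler_pM2l //; apply: (le_trans (nsqD_le _ _)).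
  have := mu1 (a j) (y (j + 1)) a1; rewrite -/Y -/V; lra.
have b2 : nsq (M y j) <= 2 * nsq (y j) + 2 * Y.
  rewrite h1; apply: (le_trans (nsqD_le _ _)).
  have := mu1 (a j)^*%C (y j); rewrite nsqJ => /(_ a1).
  have := mu1 r (y (j + 1)) r1; rewrite -/Y; lra.
have tY : 0 <= t * Y by rewrite mulr_ge0 // ltW.
have tV : 0 <= t * V by rewrite mulr_ge0 // ltW.
have tG : 0 <= t * G by rewrite mulr_ge0 // ltW.
by lra.
Qed.

Lemma backward_bound (N : int) (D : nat) : exists2 K : R, 0 < K &
  forall (w : R[i]) y f G, 1 <= nsq w -> nsq w <= 4 ->
  (forall i, E y i = w * y i + f i) -> (forall i, nsq (f i) <= G) ->
  forall d : nat, (d <= D)%N ->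
  nsq (y (N - d%:Z)) + nsq (M y (N - d%:Z)) <= K * (nsq (y N) + nsq (M y N) + G).
Proof.
elim: D => [|D [K K0 IH]].
  exists 1 => // w y f G w1 w4 hE hf d; rewrite leqn0 => /eqP ->.
  have G0 : 0 <= G by apply: le_trans (hf 0); exact: nsq_ge0.
  by rewrite subr0 mul1r lerDl.
have [K' K'0 hK'] := backward_step (N - D.+1%:Z).
exists (K + K' * (K + 1)); first by rewrite addr_gt0 // mulr_gt0 //; lra.
move=> w y f G w1 w4 hE hf d.
have G0 : 0 <= G by apply: le_trans (hf 0); exact: nsq_ge0.
have S0 : 0 <= nsq (y N) + nsq (M y N) + G.
  by have := nsq_ge0 (y N); have := nsq_ge0 (M y N); lra.
have hD := IH w y f G w1 w4 hE hf.
rewrite leq_eqVlt => /orP[/eqP ->|]; last first.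
  rewrite ltnS => dD; apply: (le_trans (hD _ dD)).
  rewrite ler_wpM2r // lerDl mulr_ge0 ?(ltW K'0) //; lra.
apply: (le_trans (hK' w y f G w1 w4 hE hf)).
have -> : N - D.+1%:Z + 1 = N - D%:Z by lia.
have h := hD _ (leqnn D).
have S1 : G <= nsq (y N) + nsq (M y N) + G.
  by have := nsq_ge0 (y N); have := nsq_ge0 (M y N); lra.
set S := nsq (y N) + _ + G in h S0 S1 *.
apply: (@le_trans _ _ (K' * (K * S + S))); first by rewrite ler_pM2l // lerD.
have : 0 <= K * S by rewrite mulr_ge0 // ltW.
rewrite mulrDl -mulrA [X in _ <= _ + K' * X]mulrDl mul1r; lra.
Qed.

End Bridge.

(** * Balancing power laws *)

Section Powers.
Variable R : realType.
Implicit Types g X : R.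

Lemma odd_powR_unbounded g X K0 : 0 < g ->
  exists2 K, (K0 <= K)%N & X < K.*2.+1%:R `^ g.
Proof.
move=> g0; pose X' := Num.max X 1; have X1 : 1 <= X' by rewrite /X' le_max lexx orbT.
pose m := Num.truncn (X' `^ g^-1).
exists (maxn K0 m.+1); first exact: leq_maxl.
have hm : X' `^ g^-1 < m.+1%:R by rewrite -truncn_lt_nat ?powR_ge0.
apply: (@le_lt_trans _ _ X'); first by rewrite le_max lexx.
have -> : X' = (X' `^ g^-1) `^ g by rewrite -powRrM mulVf ?gt_eqF // powRr1 // (le_trans ler01).
apply: gt0_ltr_powR => //; rewrite ?nnegrE ?powR_ge0 //.
apply: (lt_le_trans hm); rewrite ler_nat.
by apply: (leq_trans (leq_maxr K0 m.+1)); rewrite -addnn; lia.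
Qed.

Lemma powR_sq (x g : R) : (x `^ g) ^+ 2 = x `^ (g * 2).
Proof. by rewrite powRrM powR_mulrn ?powR_ge0. Qed.

(** Raising the bound on [P] to the power [g2] and that on [Q] to the power [g1] gives the same
    power of [l], which cancels: [P^g2 >= (A / D) Q^g1]. Multiplying by [P^g1] brings in [P Q]. *)
Lemma balance_lower (g1 g2 C1 C2 : R) : 0 < g1 -> g1 <= g2 -> 0 < C1 -> 0 < C2 ->
  exists2 c : R, 0 < c & forall P Q l eps : R, 0 < P -> 0 < Q -> 0 < l -> 0 < eps ->
    (C1 * l `^ g1) ^+ 2 <= P -> Q <= (C2 * (3 * l) `^ g2) ^+ 2 -> P * Q = eps ^- 2 ->
    c <= P * eps `^ (2 * g1 / (g1 + g2)).
Proof.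
move=> g10 g12 C10 C20; have g20 : 0 < g2 by exact: lt_le_trans g12.
set s := g1 + g2; have s0 : 0 < s by rewrite addr_gt0.
pose A := (C1 ^+ 2) `^ g2; pose D := ((C2 * 3 `^ g2) ^+ 2) `^ g1.
have A0 : 0 < A by rewrite powR_gt0 // exprn_gt0.
have D0 : 0 < D by rewrite powR_gt0 // exprn_gt0 // mulr_gt0 // powR_gt0.
exists ((A / D) `^ s^-1); first by rewrite powR_gt0 // divr_gt0.
move=> P Q l eps P0 Q0 l0 e0 hP hQ hPQ.
pose T := l `^ (g1 * 2 * g2).
have T0 : 0 < T by rewrite powR_gt0.
have h1 : A * T <= P `^ g2.
  have -> : A * T = ((C1 * l `^ g1) ^+ 2) `^ g2.
    by rewrite exprMn powR_sq powRM ?sqr_ge0 ?powR_ge0 // -powRrM.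
  by apply: ge0_ler_powR; rewrite ?nnegrE ?sqr_ge0 // ltW.
have h2 : Q `^ g1 <= D * T.
  have -> : D * T = ((C2 * (3 * l) `^ g2) ^+ 2) `^ g1.
    rewrite [(3 * l) `^ _]powRM ?(ltW l0) // mulrA exprMn powR_sq powRM ?sqr_ge0 ?powR_ge0 //.
    by rewrite -powRrM /T; congr (_ * _ `^ _); ring.
  by apply: ge0_ler_powR; rewrite ?nnegrE ?sqr_ge0 // ltW.
have h3 : A / D * Q `^ g1 <= P `^ g2.
  apply: le_trans h1; rewrite -mulrA ler_pM2l // ler_pdivrMl //.
have h4 : A / D * (eps ^- 2) `^ g1 <= P `^ s.
  rewrite -hPQ powRM ?(ltW P0) ?(ltW Q0) // mulrCA.
  rewrite /s powRD; last by rewrite gt_eqF // implybT.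
  by rewrite ler_pM2l ?powR_gt0.
have h5 : (A / D * (eps ^- 2) `^ g1) `^ s^-1 <= P.
  rewrite [leRHS](_ : P = (P `^ s) `^ s^-1); last by rewrite -powRrM divff ?gt_eqF // powRr1 // ltW.
  apply: ge0_ler_powR; rewrite ?nnegrE ?powR_ge0 // ?invr_ge0 ?(ltW s0) //.
  by rewrite mulr_ge0 ?powR_ge0 // divr_ge0 ?ltW.
have e1 : ((eps ^- 2) `^ g1) `^ s^-1 = (eps `^ (2 * g1 / s))^-1.
  rewrite -powR_mulrn ?(ltW e0) // -powRN -!powRrM -powRN.
  by congr (_ `^ _); ring.
rewrite powRM ?powR_ge0 // ?divr_ge0 ?(ltW A0) ?(ltW D0) // e1 in h5.
by rewrite -ler_pdivrMr // powR_gt0.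
Qed.

Lemma archi_odd (L0 : R) N : exists2 K, (N <= K)%N & forall K', (K <= K')%N -> L0 <= K'.*2.+1%:R.
Proof.
exists (maxn N (Num.truncn (Num.max L0 0)).+1); first exact: leq_maxl.
move=> K' hK; apply: (@le_trans _ _ (Num.max L0 0)); first by rewrite le_max lexx.
have h : Num.max L0 0 < (Num.truncn (Num.max L0 0)).+1%:R.
  by rewrite -truncn_lt_nat // le_max lexx orbT.
apply: (le_trans (ltW h)); rewrite ler_nat.
by move: hK; rewrite geq_max -addnn => /andP[_]; lia.
Qed.

(** A single normalized orbit violates one of the two laws at large length when [g2 < g1]. *)
Lemma power_law_order (alpha : nat -> R[i]) z (g1 g2 C1 C2 L0 : R) : 0 < C1 ->
  power_law_bounds alpha g1 g2 z C1 C2 L0 -> g1 <= g2.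
Proof.
move=> C10 hpl; rewrite leNgt; apply/negP => g21.
pose p := orbit_from alpha z (1, 1).
have p0 : pnsq (p 0%N) = 2 by rewrite /pnsq /nsq /=; ring.
have [K1 _ hK1] := archi_odd L0 0.
have g0 : 0 < g1 - g2 by rewrite subr_gt0.
have [K hK hX] := odd_powR_unbounded (C2 / C1) K1 g0.
have /andP[h1 h2] := orbit_power_law hpl (orbit_fromP alpha z (1, 1)) p0 (hK1 K hK).
have := le_trans h1 h2; set l := K.*2.+1%:R in hX *.
have l0 : 0 < l by rewrite /l ltr0n.
rewrite leNgt => /negP; apply.
have -> : l `^ g1 = l `^ (g1 - g2) * l `^ g2.
  by rewrite -powRD ?subrK //; apply/implyP => _; rewrite gt_eqF.
by rewrite mulrA ltr_pM2r ?powR_gt0 // mulrC -ltr_pdivrMr.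
Qed.

(** Take the first length at which the product exceeds [X], then use the intermediate value theorem
    on the step leading to it. *)
Lemma balance_point (p r : nat -> R[i] * R[i]) (X : R) K0 :
  mass p K0 * mass r K0 <= X -> (exists K', X < mass p K' * mass r K') ->
  exists K t, [/\ (K0 <= K)%N, 0 <= t <= 1 & wmass p K t * wmass r K t = X].
Proof.
move=> hK0 hex.
case: (ex_minnP hex) => K' hK' hmin.
have K0K' : (K0 < K')%N.
  rewrite ltnNge; apply/negP => h; move: hK'; rewrite ltNge => /negP; apply.
  by apply: le_trans hK0; apply: ler_pM; rewrite ?mass_ge0 ?mass_nd.
case: K' hK' hmin K0K' => // K hK hmin; rewrite ltnS => K0K.
have hle : mass p K * mass r K <= X.
  by rewrite leNgt; apply/negP => /hmin; rewrite ltnn.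
pose f t := wmass p K t * wmass r K t.
have f0 : f 0 = mass p K * mass r K by rewrite /f /wmass !mul0r !addr0.
have f1 : f 1 = mass p K.+1 * mass r K.+1 by rewrite /f /wmass !mul1r !massS.
have f01 : f 0 <= f 1.
  by rewrite f0 f1; apply: ler_pM; rewrite ?mass_ge0 ?mass_nd.
have [] := @IVT R f 0 1 X ler01.
- apply: continuous_subspaceT => t; apply: cvgM; (apply: cvgD; first exact: cvg_cst);
    apply: cvgMl; exact: cvg_id.
- by rewrite (min_idPl f01) (max_idPr f01) f0 f1 hle ltW.
by move=> t; rewrite in_itv /= => ht ft; exists K, t; split.
Qed.

(** In [key_estimate], [e] is [eps], [eb] is [eps^beta], [Psi] is [|y|^2], and [k2] is the squared
    factor of the normalized orbit. *)
Lemma final_balance (K4 K5 B : R) : 0 < K4 -> 0 < K5 -> 0 <= B ->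
  exists2 C : R, 0 < C & forall e eb Psi k2 : R, 0 < e -> e <= 1 -> e <= eb -> 0 <= Psi ->
    k2 <= K5 * eb * (Psi + 1) ->
    (forall s, 0 < s -> e * Psi <= 4 * s * K4 * (k2 + 1) + s^-1 * B + 4) ->
    16 * e ^+ 2 * Psi <= C * eb.
Proof.
move=> K40 K50 B0; exists (16 * (9 + K5^-1 + 16 * K4 * K5 * B)).
  have h1 : 0 <= 16 * K4 * K5 * B by rewrite !mulr_ge0 // ltW.
  have h2 : 0 < K5^-1 by rewrite invr_gt0.
  by lra.
move=> e eb Psi k2 e0 e1 eeb Psi0 hk2 hs.
have eb0 : 0 < eb by exact: lt_le_trans eeb.
(* With this [s] the part of the [k2] term proportional to [Psi] is exactly [e Psi / 2], which the
   left side absorbs. *)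
pose s := e / (8 * K4 * K5 * eb).
have s0 : 0 < s by rewrite divr_gt0 // !mulr_gt0.
have h := hs _ s0.
have sK : 0 <= 4 * s * K4 by have := mulr_gt0 s0 K40; lra.
have h1 : 4 * s * K4 * (k2 + 1) <= e / 2 * (Psi + 1) + e / (2 * K5 * eb).
  apply: (@le_trans _ _ (4 * s * K4 * (K5 * eb * (Psi + 1) + 1))).
    by rewrite ler_wpM2l // lerD2r.
  rewrite le_eqVlt; apply/orP; left; apply/eqP; rewrite /s; field.
  by rewrite !gt_eqF.
have h2 : e / (2 * K5 * eb) <= (2 * K5)^-1.
  rewrite [_ * eb]mulrC invfM mulrA mulrC ler_piMr //.
    by rewrite invr_ge0 mulr_ge0 // ltW.
  by rewrite ler_pdivrMr // mul1r.
have h3 : e * Psi <= 1 + K5^-1 + 8 + 2 * (s^-1 * B).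
  have -> : K5^-1 = 2 * (2 * K5)^-1 by field; rewrite gt_eqF.
  by nra.
have h4 : e * (s^-1 * B) = 8 * K4 * K5 * B * eb.
  by rewrite /s; field; rewrite !gt_eqF.
have h5 : e * (e * Psi) <= e * (1 + K5^-1 + 8) + 2 * (e * (s^-1 * B)).
  by have := ler_wpM2l (ltW e0) h3; lra.
have K5i : 0 < K5^-1 by rewrite invr_gt0.
have h6 : e * (1 + K5^-1 + 8) <= eb * (1 + K5^-1 + 8).
  by rewrite ler_wpM2r //; lra.
by rewrite h4 in h5; lra.
Qed.

End Powers.

(** * The estimate near one point of the circle *)

Section Key.
Variable R : realType.
Variable a : int -> R[i].
Hypothesis ad : forall n, unit_disk (a n).
Local Notation E := (opE a).
Local Notation alpha := (fun n : nat => a n%:Z).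
Local Notation M := (blk false a).

Lemma sum_le_win (f : int -> R) m K : (forall j, 0 <= f j) ->
  \sum_(m <= n < K) f n%:Z <= win f K.
Proof.
move=> f0; apply: (@le_trans _ _ (\sum_(n < K) f n%:Z)).
  rewrite -(big_mkord xpredT (fun n => f n%:Z)).
  have [Km|mK] := leqP K m; first by rewrite [leLHS]big_geq //; apply: sumr_ge0.
  rewrite [leRHS](big_cat_nat _ (n := m)) //=; last exact: ltnW.
  by rewrite lerDr sumr_ge0.
elim: K => [|K IH]; first by rewrite big_ord0 win0.
rewrite big_ord_recr /= winS.
have h : f K%:Z <= f K%:Z + f K.+1%:Z by rewrite lerDl.
case: K IH h => [|K] IH h.
  by rewrite big_ord0 add0r win0; have := f0 (- 1%:Z); have := f0 1%:Z; lra.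
rewrite winS; have := f0 (- K.+2%:Z); have := f0 K.+2%:Z.
suff : \sum_(i < K.+1) f i%:Z <= f (- K.+1%:Z) + win f K by lra.
elim: K {IH h} => [|K IH]; first by rewrite big_ord1 win0; have := f0 (- 1%:Z); lra.
rewrite big_ord_recr /= winS; have := f0 (- K.+2%:Z); lra.
Qed.

Lemma odd_succ_le3 K : (K.+1.*2.+1 <= 3 * K.*2.+1)%N.
Proof. lia. Qed.

Lemma nsq_le_ip (u : int -> R[i]) j : ell2 u -> nsq (u j) <= ip u u.
Proof.
move=> lu; apply: le_trans (win_le_ip `|j|%N lu).
have f0 i : 0 <= nsq (u i) by exact: nsq_ge0.
case hN: `|j|%N => [|N].
  by have -> : j = 0 by [lia]; rewrite win0 lexx.
rewrite winS; have := win_ge0 N f0; have := f0 (- N.+1%:Z); have := f0 N.+1%:Z.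
have : j = N.+1%:Z \/ j = - N.+1%:Z by lia.
by case=> ->; lra.
Qed.

Lemma sum_nsq_le (u : int -> R[i]) m K : ell2 u ->
  \sum_(m <= n < K) nsq (u n%:Z) <= ip u u.
Proof.
move=> lu; apply: le_trans (win_le_ip K lu).
by apply: (@sum_le_win (fun j => nsq (u j))) => j; exact: nsq_ge0.
Qed.

Lemma ip_fin (u v : int -> R[i]) N : (forall j : int, (N < `|j|)%N -> v j = 0) ->
  ip u v = win (fun j => rdot (u j) (v j)) N.
Proof.
move=> v0; rewrite /ip; apply: (lim_near_cst (@Rhausdorff R)).
exists N => // K /= NK; apply: win_fin => // j /v0 ->.
by rewrite /rdot /= !mulr0 addr0.
Qed.

Lemma blk_isom e u : ell2 u -> ip (blk e a u) (blk e a u) = ip u u.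
Proof.
by move=> lu; rewrite blk_adjoint // ?blkK //; exact: ell2_blk.
Qed.

(* [q = sum_(k < n) w^(-k-1) x^k].                                            *)
Lemma truncated_resolvent (w : R[i]) n : w != 0 -> exists q A A', [/\ calc a q A A',
  forall x, (w - x) * q x = 1 - w ^- n * x ^+ n &
  forall u j, E (A u) j = w * A u j - u j + w ^- n * iter n E u j].
Proof.
move=> w0; elim: n => [|n [q [A [A' [cA hq hA]]]]].
  exists (fun=> 0), (vscale 0), (vscale 0^*%C); split; first exact: calc_cst.
    by move=> x; rewrite !expr0 invr1 mulr0 mulr1 subrr.
  move=> u j; rewrite opEZ /vscale !mul0r expr0 invr1 /= mul1r mulr0; ring.
exists (fun x => w^-1 * (1 + x * q x)).
exists (fun u => vscale w^-1 (vadd (vscale 1 u) (E (A u)))).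
exists (fun u => vadd (vscale 1^*%C (vscale (w^-1)^*%C u)) (A' (opE' a (vscale (w^-1)^*%C u)))).
split.
- exact: (calc_mul (calc_cst a _) (calc_add (calc_cst a 1) (calc_mul (calc_id a) cA))).
- move=> x; transitivity (w^-1 * ((w - x) + x * ((w - x) * q x))); first by ring.
  by rewrite hq !exprSr invfM; field; rewrite ?w0 ?expf_neq0.
- move=> u j.
  have -> : vscale w^-1 (vadd (vscale 1 u) (E (A u))) =
      vadd (A u) (vscale (w ^- n.+1) (iter n E u)).
    apply/funext => i; rewrite /vscale /vadd hA exprSr invfM.
    by field; rewrite ?w0 ?expf_neq0.
  rewrite opED opEZ /vadd /vscale hA iterS exprSr invfM.
  by field; rewrite ?w0 ?expf_neq0.
Qed.

Variables (g1 g2 C1 C2 L0 : R).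
Hypothesis g10 : 0 < g1.
Hypothesis C10 : 0 < C1.
Hypothesis C20 : 0 < C2.
Variable N1 : nat.
Local Notation N0 := N1.*2.
Local Notation beta := (2 * g1 / (g1 + g2)).

(* The balance [P Q = eps^-2] makes the perturbation of size [eps] cost only  *)
(* a bounded factor, while the power laws then force [P >= c eps^-beta].      *)
Lemma initial_bound (B0 c : R) K0 : 0 < B0 -> 
  (N0 <= K0)%N -> (forall K, (K0 <= K)%N -> L0 <= K.*2.+1%:R) ->
  B0 = (C2 * K0.*2.+1%:R `^ g2) ^+ 2 -> g1 <= g2 ->
  (forall P Q l eps : R, 0 < P -> 0 < Q -> 0 < l -> 0 < eps ->
    (C1 * l `^ g1) ^+ 2 <= P -> Q <= (C2 * (3 * l) `^ g2) ^+ 2 -> P * Q = eps ^- 2 ->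
    c <= P * eps `^ beta) ->
  forall z (eps : R) y (Phi : R), nsq z = 1 -> power_law_bounds alpha g1 g2 z C1 C2 L0 ->
  0 < eps -> B0 ^+ 2 <= eps ^- 2 -> 2 * B0 * eps `^ beta <= c -> ell2 y ->
  (forall K, \sum_(N0 <= n < K) nsq (E y n%:Z - z * y n%:Z) <= Phi) ->
  exists k2 : R, [/\ 0 <= k2, nsq (y N0%:Z) + nsq (M y N0%:Z) <= k2 * B0 &
    k2 * c <= (12 * ip y y + 4 * eps ^- 2 * Phi) * eps `^ beta].
Proof.
move=> B00 NK0 hK0 eB0 g12 hbal z eps y Phi z1 hpl e0 Be ce ly hPhi.
have ad' n : unit_disk (alpha n) by exact: ad.
have [k [p [k0 sp p0 hk]]] := orbit_normalized_through ad' z1 N0 (pairs a z y N0).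
(* Initial data orthogonal to those of [p] and of equal norm, so the Wronskian has squared modulus
   4. *)
pose r := orbit_from alpha z (- conjc (p 0%N).2, conjc (p 0%N).1).
have sr : szego_orbit alpha z r by exact: orbit_fromP.
have r0 : pnsq (r 0%N) = 2 by rewrite /pnsq /= nsqN !nsqJ addrC.
have wr : nsq (wedge (p 0%N) (r 0%N)) = 4.
  rewrite /wedge /= mulrN opprK ![_ * _^*%C]mulrC !mulJ -rmorphD.
  by rewrite nsqR -/(pnsq _) p0; ring.
have z0 := z_neq0 z1.
have massbd q K : szego_orbit alpha z q -> pnsq (q 0%N) = 2 -> (K0 <= K)%N ->
    (C1 * K.*2.+1%:R `^ g1) ^+ 2 <= mass q K <= (C2 * K.*2.+1%:R `^ g2) ^+ 2.
  move=> sq q0 hK; have /andP[h1 h2] := orbit_power_law hpl sq q0 (hK0 K hK).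
  rewrite -[mass q K]sqr_sqrtr ?mass_ge0 //.
  by rewrite !ler_sqr ?h1 ?h2 // nnegrE ?sqrtr_ge0 // ?mulr_ge0 ?powR_ge0 // ltW.
have mB q : szego_orbit alpha z q -> pnsq (q 0%N) = 2 -> mass q K0 <= B0.
  by move=> sq q0; rewrite eB0; case/andP: (massbd q K0 sq q0 (leqnn _)).
have m2 (q : nat -> R[i] * R[i]) K : pnsq (q 0%N) = 2 -> 2 <= mass q K.
  by move=> q0; apply: le_trans (mass_nd q (leq0n K)); rewrite /mass big_ord1 q0.
(* [mass p] is unbounded because [g1 > 0], while [mass r] stays at least 2. *)
have hex : exists K', eps ^- 2 < mass p K' * mass r K'.
  have [K hK hX] := odd_powR_unbounded (eps ^- 2 / C1 ^+ 2) K0 (mulr_gt0 g10 (ltr0n R 2)).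
  exists K; have /andP[h1 _] := massbd p K sp p0 hK.
  rewrite exprMn powR_sq in h1.
  have h2 : eps ^- 2 < mass p K.
    by apply: lt_le_trans h1; rewrite mulrC -ltr_pdivrMr // exprn_gt0.
  have h3 := m2 r K r0.
  have h4 := mass_ge0 p K.
  have : mass p K * 2 <= mass p K * mass r K by rewrite ler_wpM2l.
  by lra.
have hB2 : mass p K0 * mass r K0 <= eps ^- 2.
  apply: le_trans Be; rewrite expr2; apply: ler_pM; rewrite ?mass_ge0 ?mB //.
have [K [t [KK0 t01 PQ]]] := balance_point hB2 hex.
have /andP[t0 t1] := t01.
set P := wmass p K t in PQ *; set Q := wmass r K t in PQ *.
have mP : mass p K <= P by rewrite lerDl mulr_ge0 ?pnsq_ge0.
have P0 : 0 < P by apply: lt_le_trans mP; apply: lt_le_trans (m2 _ _ p0).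
have mQ : mass r K <= Q by rewrite lerDl mulr_ge0 ?pnsq_ge0.
have Q0 : 0 < Q by apply: lt_le_trans mQ; apply: lt_le_trans (m2 _ _ r0).
have hP : (C1 * K.*2.+1%:R `^ g1) ^+ 2 <= P.
  by apply: le_trans mP; case/andP: (massbd p K sp p0 KK0).
(* As [t <= 1], [Q] is at most the mass at length [2K + 3 <= 3 (2K + 1)]; hence the factor 3 in
   [balance_lower]. *)
have hQ : Q <= (C2 * (3 * K.*2.+1%:R) `^ g2) ^+ 2.
  apply: (@le_trans _ _ (mass r K.+1)).
    by rewrite massS lerD2l ler_piMl ?pnsq_ge0.
  have /andP[_ h] := massbd r K.+1 sr r0 (leqW KK0).
  apply: (le_trans h); rewrite ler_sqr ?nnegrE ?mulr_ge0 ?powR_ge0 ?(ltW C20) //.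
  rewrite ler_pM2l //; apply: ge0_ler_powR; rewrite ?nnegrE ?ler0n ?mulr_ge0 ?ler0n //.
    by apply: ltW; apply: lt_le_trans g12.
  by rewrite -natrM ler_nat odd_succ_le3.
have hc := hbal P Q K.*2.+1%:R eps P0 Q0 (ltr0Sn _ _) e0 hP hQ PQ.
have eb0 : 0 < eps `^ beta by exact: powR_gt0.
(* The mass of [p] up to [N0] is then at most [P / 2], so subtracting it in [duhamel] costs only a
   factor 2. *)
have PB : 2 * B0 <= P.
  by rewrite -(ler_pM2r eb0); exact: le_trans hc.
have NK : (N0 <= K)%N by exact: leq_trans KK0.
exists (k ^+ 2); split; first exact: sqr_ge0.
  rewrite -(pnsq_pairs_even a y z1) ?odd_double // hk pnsqZ nsqR ler_wpM2l ?sqr_ge0 //.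
  apply: le_trans (mB p sp p0); apply: le_trans (mass_nd p NK0).
  by rewrite /mass big_ord_recr /= lerDr sumr_ge0 // => i _; exact: pnsq_ge0.
have hh : \sum_(N0 <= n < K.+1) pnsq (perturb a z y n) <= Phi.
  under eq_bigr do rewrite (pnsq_perturb a y _ z1).
  exact: hPhi.
have hu n : (N0 <= n)%N -> pairs a z y n.+1 = szego z (alpha n)
    ((pairs a z y n).1 + (perturb a z y n).1, (pairs a z y n).2 + (perturb a z y n).2).
  by move=> _; exact: pairs_rec.
have D := duhamel ad' z1 sp sr wr hu hk NK t01 hh.
rewrite -/P -/Q PQ nsqR in D.
(* The pairs are read off [y], [M y] and [E y], three vectors of equal norm. *)
have hU : \sum_(N0 <= n < K.+2) pnsq (pairs a z y n) <= 3 * ip y y.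
  apply: (@le_trans _ _ (\sum_(N0 <= n < K.+2) (nsq (y n%:Z) + nsq (M y n%:Z) + nsq (E y n%:Z)))).
    by apply: ler_sum => n _; exact: pnsq_pairs.
  have lM : ell2 (M y) by exact: ell2_blk.
  have lE : ell2 (E y) by exact: ell2_opE.
  rewrite 2!big_split /=.
  have s1 := sum_nsq_le N0 K.+2 ly; have s2 := sum_nsq_le N0 K.+2 lM.
  have s3 := sum_nsq_le N0 K.+2 lE; rewrite opE_isom // in s3.
  by rewrite (blk_isom false ly) in s2; lra.
have mN : mass p N0 <= B0 by apply: le_trans (mB p sp p0); exact: mass_nd.
have k20 : 0 <= k ^+ 2 by exact: sqr_ge0.
have h1 : k ^+ 2 * P <= 2 * (k ^+ 2 * (P - mass p N0)).
  by rewrite mulrCA ler_wpM2l //; lra.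
have h2 : k ^+ 2 * P <= 12 * ip y y + 4 * eps ^- 2 * Phi by lra.
apply: (@le_trans _ _ (k ^+ 2 * (P * eps `^ beta))); first by rewrite ler_wpM2l.
by rewrite mulrA ler_wpM2r // ltW.
Qed.

End Key.

Section KeyEstimate.
Variable R : realType.
Variable a : int -> R[i].
Hypothesis ad : forall n, unit_disk (a n).
Local Notation E := (opE a).
Local Notation alpha := (fun n : nat => a n%:Z).
Local Notation M := (blk false a).

Lemma dist_reflect (N : nat) (j : int) : (`|j| <= N)%N ->
  N%:Z - (`|N%:Z - j|%N)%:Z = j /\ (`|N%:Z - j| <= N.*2)%N.
Proof. by split; lia. Qed.

Lemma window_abs N (i : 'I_N.*2.+1) : (`|i%:Z - N%:Z| <= N)%N.
Proof. by have := ltn_ord i; lia. Qed.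

Lemma rdot_amgm (x y : R[i]) (s : R) : 0 < s ->
  2 * rdot x y <= s * nsq x + s^-1 * nsq y.
Proof.
move=> s0; have := nsq_ge0 (s%:C%C * x - y); rewrite nsqB nsqM nsqR rdot_real_scale => h.
rewrite -(ler_pM2l s0) (_ : s * (s * nsq x + s^-1 * nsq y) = s ^+ 2 * nsq x + nsq y).
  by lra.
by field; rewrite gt_eqF.
Qed.

(** The function [q] is [4 eps] times a truncated resolvent at [w = (1 + eps) z]. The constants are
    chosen before [z], so they serve coverings by many arcs at once. *)
Lemma key_estimate (g1 g2 C1 C2 L0 : R) N1 (b : int -> R[i]) :
  0 < g1 -> 0 < C1 -> 0 < C2 -> ell2 b ->
  (forall j : int, (N1.*2 <= `|j|)%N -> b j = 0) ->
  exists C e0 : R, [/\ 0 < C, 0 < e0 & forall z (eps : R), nsq z = 1 ->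
    power_law_bounds alpha g1 g2 z C1 C2 L0 -> 0 < eps < e0 ->
    exists q A A', [/\ calc a q A A',
      forall x, nsq x = 1 -> nsq (x - z) <= eps ^+ 2 -> 1 <= nsq (q x) &
      ip (A b) (A b) <= C * eps `^ (2 * g1 / (g1 + g2))]].
Proof.
move=> g10 C10 C20 lb hb; set N0 := N1.*2.
(* If [g2 < g1], no [z] satisfies the power laws. *)
have [g21|g12] := ltP g2 g1.
  exists 1, 1; split => // z eps _ /(power_law_order C10).
  by rewrite leNgt g21.
set beta := 2 * g1 / (g1 + g2).
have s0 : 0 < g1 + g2 by rewrite addr_gt0 //; exact: lt_le_trans g12.
have beta0 : 0 < beta by rewrite divr_gt0 // mulr_gt0.
have beta1 : beta <= 1 by rewrite ler_pdivrMr //; lra.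
have [K0 NK0 hK0] := archi_odd L0 N0.
pose B0 := (C2 * K0.*2.+1%:R `^ g2) ^+ 2.
have B00 : 0 < B0 by rewrite exprn_gt0 // mulr_gt0 // powR_gt0 // ltr0n.
have [c c0 hbal] := balance_lower g10 g12 C10 C20.
have [K3 K30 hK3] := backward_bound ad N0%:Z N0.*2.
set bb := ip b b; have bb0 : 0 <= bb by exact: ip_ge0.
pose G := 2 * bb + 2.
pose K4 := N0.*2.+1%:R * K3 * (B0 + G) : R.
have G0 : 0 < G by rewrite /G; lra.
have K40 : 0 < K4 by rewrite /K4 !mulr_gt0 ?ltr0n // addr_gt0.
pose K5 := 20 / c.
have K50 : 0 < K5 by rewrite divr_gt0.
have [C C0 hC] := final_balance K40 K50 bb0.
(* The last two conditions give [B0^2 <= eps^-2], which puts the balance point beyond [K0], and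
   [2 B0 eps^beta <= c], as required by [initial_bound]. *)
pose e0 := Num.min 1 (Num.min B0^-1 ((c / (2 * B0)) `^ beta^-1)).
exists C, e0; split => //.
  rewrite !lt_min ltr01 invr_gt0 B00 powR_gt0 // divr_gt0 // mulr_gt0 //.
move=> z eps z1 hpl /andP[eps0]; rewrite !lt_min => /andP[eps1 /andP[epsB epsc]].
have eb0 : 0 < eps `^ beta by exact: powR_gt0.
have eeb : eps <= eps `^ beta by apply: ger1_powR => //; rewrite eps0 ltW.
have hB : B0 ^+ 2 <= eps ^- 2.
  rewrite -exprVn ler_sqr ?nnegrE ?invr_ge0 ?(ltW B00) ?(ltW eps0) //.
  by rewrite -[B0]invrK lef_pV2 ?posrE ?invr_gt0 // ltW.
have hce : 2 * B0 * eps `^ beta <= c.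
  rewrite mulrC -ler_pdivlMr ?mulr_gt0 //.
  have -> : c / (2 * B0) = ((c / (2 * B0)) `^ beta^-1) `^ beta.
    by rewrite -powRrM mulVf ?gt_eqF // powRr1 // divr_ge0 ?mulr_ge0 // ltW.
  by apply: ge0_ler_powR; rewrite ?nnegrE ?powR_ge0 // ltW.
set w := (1 + eps)%:C%C * z.
have w2 : nsq w = (1 + eps) ^+ 2 by rewrite nsqM z1 mulr1 nsqR.
have w1 : 1 <= nsq w by rewrite w2; nra.
have w4 : nsq w <= 4 by rewrite w2; nra.
have w0 : w != 0 by apply/eqP => h; move: w1; rewrite h nsq0; lra.
pose lam := (nsq w)^-1.
have lamP : 0 < lam by rewrite invr_gt0; lra.
have lam1 : lam < 1 by rewrite invf_lt1 w2; nra.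
(* The truncation error is to be at most 1/2 in modulus on the circle, and its value at [b] at most
   [eps] in norm. *)
have [n hn] : exists n, lam ^+ n <= Num.min (4^-1) (eps ^+ 2 / (bb + 1)).
  have m0 : 0 < Num.min (4^-1) (eps ^+ 2 / (bb + 1)).
    by rewrite lt_min invr_gt0 divr_gt0 ?exprn_gt0 //; lra.
  have c' := @cvg_expr R lam _.
  have : `|lam| < 1 by rewrite gtr0_norm.
  move=> /c' /cvgrPdist_le /(_ _ m0)[k _ hk].
  exists k; have := hk k (leqnn k); rewrite /= sub0r normrN ger0_norm //.
  by rewrite exprn_ge0 // ltW.
have {hn} [hn4 hne] : lam ^+ n <= 4^-1 /\ lam ^+ n <= eps ^+ 2 / (bb + 1).
  by move: hn; rewrite le_min => /andP.
have nwn : nsq (w ^- n) = lam ^+ n.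
  have nV : nsq w^-1 = lam.
    have : nsq (w^-1 * w) = 1 by rewrite mulVf // /nsq /= expr0n expr1n addr0.
    by rewrite nsqM /lam => h; rewrite -[LHS](mulfK (_ : nsq w != 0)) ?h ?mul1r // gt_eqF //; lra.
  rewrite -exprVn; elim: n {hn4 hne} => [|k IH]; first by rewrite !expr0 /nsq /= expr0n expr1n addr0.
  by rewrite !exprS nsqM IH nV.
have [q [A [A' [cA hq hA]]]] := truncated_resolvent a n w0.
pose y := A b.
have ly : ell2 y by case: (calc_ell2 ad cA) => + _; apply.
pose g := vscale (w ^- n) (iter n E b).
have lg : ell2 g by apply: ell2_scale; exact: ell2_iter.
have hg : ip g g <= eps ^+ 2.
  rewrite ip_scale2; last exact: ell2_iter.
  rewrite (ip_iter ad) // nwn -/bb.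
  have : lam ^+ n * (bb + 1) <= eps ^+ 2 by rewrite -ler_pdivlMr //; lra.
  have : 0 <= lam ^+ n by rewrite exprn_ge0 // ltW.
  by nra.
pose f := vadd (vscale (-1)%:C%C b) g.
have hE j : E y j = w * y j + f j.
  by rewrite hA /f /g /vadd /vscale rmorphN mulN1r /y; ring.
have lf : ell2 f by apply: ell2_add => //; exact: ell2_scale.
have hf j : nsq (f j) <= G.
  apply: (le_trans (nsqD_le _ _)).
  have h1 := nsq_le_ip j lb; have h2 := nsq_le_ip j lg.
  rewrite nsqM nsqR; have e1 : (-1) ^+ 2 = 1 :> R by ring.
  by rewrite e1 mul1r /G -/bb; rewrite -/bb in h1; nra.
set Psi := ip y y; have Psi0 : 0 <= Psi by exact: ip_ge0.
(* To the right of the support [b] drops out, leaving [E y - z y = eps z y + g]. *)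
have hPhi K : \sum_(N0 <= k < K) nsq (E y k%:Z - z * y k%:Z) <= 2 * eps ^+ 2 * Psi + 2 * eps ^+ 2.
  have step k : (N0 <= k)%N -> nsq (E y k%:Z - z * y k%:Z) <= 2 * (eps ^+ 2 * nsq (y k%:Z)) + 2 * nsq (g k%:Z).
    move=> hk; have -> : E y k%:Z - z * y k%:Z = eps%:C%C * z * y k%:Z + g k%:Z.
      rewrite hE /f /vadd /vscale (hb k%:Z) // mulr0 add0r /w rmorphD rmorph1; ring.
    apply: (le_trans (nsqD_le _ _)).
    by rewrite !nsqM nsqR z1 mulr1.
  apply: (@le_trans _ _ (\sum_(N0 <= k < K) (2 * (eps ^+ 2 * nsq (y k%:Z)) + 2 * nsq (g k%:Z)))).
    rewrite big_seq_cond [leRHS]big_seq_cond; apply: ler_sum => k.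
    by rewrite andbT mem_index_iota => /andP[h _]; exact: step.
  rewrite big_split /= -!mulr_sumr.
  have s1 := sum_nsq_le N0 K ly; have s2 := sum_nsq_le N0 K lg.
  have e20 : 0 <= eps ^+ 2 by exact: sqr_ge0.
  have := ler_wpM2l e20 s1; rewrite -/Psi; lra.
have [k2 [k20 hk2 hk2']] := initial_bound ad g10 C10 C20 B00 NK0 hK0 (erefl _) g12
   hbal z1 hpl eps0 hB hce ly hPhi.
have ee : eps ^- 2 * eps ^+ 2 = 1 by rewrite mulVf // expf_eq0 gt_eqF.
have hk2b : k2 <= K5 * eps `^ beta * (Psi + 1).
  have e1 : 4 * eps ^- 2 * (2 * eps ^+ 2 * Psi + 2 * eps ^+ 2) = 8 * Psi + 8.
    transitivity (eps ^- 2 * eps ^+ 2 * (8 * Psi + 8)); first by ring.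
    by rewrite ee mul1r.
  rewrite e1 -/Psi -ler_pdivlMr // in hk2'; apply: (le_trans hk2').
  rewrite /K5 -subr_ge0 -/Psi.
  rewrite (_ : _ - _ = 12 * (eps `^ beta / c)); last by field; rewrite gt_eqF.
  by rewrite mulr_ge0 // divr_ge0 // ltW.
(* Unitarity, [|w y + f| = |y|], expanded; since [|w|^2 - 1 >= 2 eps], it will control [eps |y|^2]
   by inner products with [f]. *)
have hE2 : nsq w * Psi + 2 * ip (vscale w y) f + ip f f = Psi.
  rewrite [RHS](_ : Psi = ip (E y) (E y)); last by rewrite opE_isom.
  have -> : E y = vadd (vscale w y) f by apply/funext => j; rewrite hE.
  have lw : ell2 (vscale w y) by exact: ell2_scale.
  have lwf : ell2 (vadd (vscale w y) f) by exact: ell2_add.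
  rewrite (ipDl lw lf lwf) (ipDr lw lw lf) (ipDr lf lw lf).
  by rewrite ip_scale2 // [ip f (vscale w y)]ipC -/Psi; ring.
have lw : ell2 (vscale w y) by exact: ell2_scale.
have ef : ip (vscale w y) f = - ip (vscale w y) b + ip (vscale w y) g.
  by rewrite ipDr //; [rewrite ipRr // mulN1r|exact: ell2_scale].
have hg2 : - 2 * ip (vscale w y) g <= eps * Psi + 4.
  have e4 : 0 < eps / 4 by rewrite divr_gt0.
  have lNg : ell2 (vscale (-1)%:C%C g) by exact: ell2_scale.
  have := ip_amgm_scaled e4 lw lNg; rewrite (ipRr (-1) lw lg) (ip_scale2 _ ly) (ip_scale2 _ lg) nsqR -/Psi => h.
  have h2 : (eps / 4)^-1 * ((-1) ^+ 2 * ip g g) <= 4.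
    rewrite ler_pdivrMl // (_ : (-1) ^+ 2 = 1); last by ring.
    rewrite mul1r; apply: (le_trans hg); rewrite expr2.
    by have := ler_wpM2l (ltW eps0) (ltW eps1); lra.
  have h3 : eps / 4 * (nsq w * Psi) <= eps / 4 * (4 * Psi).
    by rewrite ler_pM2l // ler_wpM2r.
  lra.
(* The inner product of [w y] with [b] sees [y] only on the support of [b], which [backward_bound]
   reaches from the pair at [N0]. *)
have hcore s : 0 < s -> eps * Psi <= 4 * s * K4 * (k2 + 1) + s^-1 * bb + 4.
  move=> s0'; have s0i : 0 < s^-1 by rewrite invr_gt0.
  have hmain : eps * Psi <= 2 * ip (vscale w y) b + 4.
    have ff := ip_ge0 lf.
    have : 2 * eps * Psi <= (nsq w - 1) * Psi by rewrite ler_wpM2r // w2; nra.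
    by rewrite ef in hE2; lra.
  apply: (le_trans hmain); rewrite lerD2r.
  rewrite (@ip_fin _ _ b N0); last by move=> j hj; apply: hb; exact: ltnW.
  pose T := win (fun j => nsq (y j)) N0.
  have hT : T <= K4 * (k2 + 1).
    have Y j : (`|j| <= N0)%N -> nsq (y j) <= K3 * (B0 + G) * (k2 + 1).
      move=> hj; have := hK3 w y f G w1 w4 hE hf `|N0%:Z - j|%N.
      have [-> ->] := dist_reflect hj.
      move=> /(_ isT) h.
      apply: (@le_trans _ _ (K3 * (k2 * B0 + G))).
        have h1 : nsq (y N0%:Z) + nsq (M y N0%:Z) + G <= k2 * B0 + G by rewrite lerD2r.
        have := ler_wpM2l (ltW K30) h1; have := nsq_ge0 (M y j); lra.
      rewrite -mulrA ler_pM2l //.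
      have := mulr_ge0 k20 (ltW G0); nra.
    apply: (@le_trans _ _ (\sum_(i < N0.*2.+1) (K3 * (B0 + G) * (k2 + 1)))).
      apply: ler_sum => i _; apply: Y.
      exact: window_abs.
    rewrite sumr_const card_ord -mulr_natl /K4 !mulrA //.
  have h1 : 2 * win (fun j => rdot (vscale w y j) (b j)) N0 <=
     4 * s * T + s^-1 * win (fun j => nsq (b j)) N0.
    rewrite -!winZ -winD; apply: win_le => j; rewrite /vscale.
    have := rdot_amgm (w * y j) (b j) s0'; rewrite nsqM => h.
    have hw : s * (nsq w * nsq (y j)) <= s * (4 * nsq (y j)).
      by rewrite ler_pM2l // ler_wpM2r ?nsq_ge0.
    by lra.
  have h2 := win_le_ip N0 lb; rewrite -/bb in h2.
  have h3 := ler_wpM2l (ltW s0i) h2.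
  have h4 := ler_wpM2l (ltW s0') hT.
  by rewrite -[4 * s * K4 * _]mulrA -[4 * s * (K4 * _)]mulrA; lra.
have hfin := hC eps (eps `^ beta) Psi k2 eps0 (ltW eps1) eeb Psi0 hk2b hcore.
exists (fun x => (4 * eps)%:C%C * q x), (fun u => vscale (4 * eps)%:C%C (A u)).
exists (fun u => A' (vscale (4 * eps)%:C%C^*%C u)); split.
- exact: (calc_mul (calc_cst a _) cA).
(* Here [|w - x| <= 2 eps] and [|1 - w^-n x^n| >= 1 / 2], so the truncated resolvent has modulus at
   least [1 / (4 eps)]. *)
- move=> x x1 xz; rewrite nsqM nsqR.
  have h1 : 4^-1 <= nsq (1 - w ^- n * x ^+ n).
    have h2 : nsq (w ^- n * x ^+ n) <= 4^-1 by rewrite nsqM nwn nsqX // mulr1.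
    have := nsqD_le (1 - w ^- n * x ^+ n) (w ^- n * x ^+ n); rewrite subrK.
    rewrite (_ : nsq 1 = 1); last by rewrite /nsq /= expr0n expr1n addr0.
    lra.
  have h2 : nsq (w - x) <= 4 * eps ^+ 2.
    have -> : w - x = eps%:C%C * z + (- (x - z)) by rewrite /w rmorphD rmorph1; ring.
    apply: (le_trans (nsqD_le _ _)); rewrite nsqN nsqM nsqR z1 mulr1; lra.
  rewrite -hq nsqM in h1.
  have := ler_wpM2r (nsq_ge0 (q x)) h2; rewrite exprMn; lra.
- by rewrite ip_scale2 // nsqR exprMn -/y -/Psi; rewrite (_ : 4 ^+ 2 = 16); last by ring.
Qed.

End KeyEstimate.

(** * Arcs and coverings *)

Section Arcs.
Variable R : realType.

Lemma mvt_lipschitz (f df : R -> R) (s t : R) : (forall x : R, is_derive x 1 f (df x)) ->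
  continuous f -> (forall x, `|df x| <= 1) -> (f s - f t) ^+ 2 <= (s - t) ^+ 2.
Proof.
move=> fd fc df1.
wlog st : s t / t <= s.
  move=> H; have [|/ltW ts] := leP t s; first exact: H.
  by rewrite -sqrrN opprB -(sqrrN (s - t)) opprB; exact: H.
have cf : {within `[t, s], continuous f} by exact: continuous_subspaceT.
have [c _ ->] := MVT_segment st (fun x _ => fd x) cf.
rewrite exprMn ler_piMl ?sqr_ge0 // -real_normK ?num_real //.
by rewrite exprn_ile1.
Qed.

(** The mean value theorem on each coordinate; the lossy factor 2 is covered by the radius [2 * e]
    in [holder_measure]. *)
Lemma nsq_cis (s t : R) : nsq (cis s - cis t) <= 2 * (s - t) ^+ 2.
Proof.
have hs := @mvt_lipschitz sin cos s t (@is_derive_sin R) (@continuous_sin R) (@cos_max R).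
have hc : (cos s - cos t) ^+ 2 <= (s - t) ^+ 2.
  apply: (@mvt_lipschitz cos (fun x => - sin x)) => [|x].
    exact: continuous_cos.
  by rewrite normrN; exact: sin_max.
by rewrite /nsq /cis /=; lra.
Qed.

Lemma cis_circle (t : R) : nsq (cis t) = 1.
Proof. by rewrite /nsq /cis /= cos2Dsin2. Qed.

Lemma normc_le (x : R[i]) (r : R) : 0 <= r -> (normc x <= r) = (nsq x <= r ^+ 2).
Proof. by move=> r0; rewrite -normc_nsq ler_sqr ?nnegrE ?normc_ge0. Qed.

Lemma cis_continuous : continuous (@cis R : R -> R[i]^o).
Proof.
move=> t; apply/cvg_ballP => e e0; have [eI eR] : complex.Im e = 0 /\ 0 < complex.Re e.
  by move: e0; rewrite ltcE /= => /andP[/eqP -> ->].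
have r0 : 0 < complex.Re e / 3 by rewrite divr_gt0.
near=> s; rewrite -ball_normE /=.
have h : `|t - s| < complex.Re e / 3 by near: s; exact: (@nbhsx_ballx _ _ t _ r0).
have -> : e = (complex.Re e)%:C%C by move: eI; case: (e) => p q /= ->.
rewrite -[X in X < _]/((normc (cis t - cis s))%:C%C) ltcR.
apply: (@le_lt_trans _ _ (2 * `|t - s|)); last by lra.
rewrite normc_le ?mulr_ge0 //; apply: (le_trans (nsq_cis _ _)).
by rewrite exprMn real_normK ?num_real //; have := sqr_ge0 (t - s); lra.
Unshelve. all: by end_near. Qed.

Lemma measurable_arc (t e : R) : measurable (circle_arc t e).
Proof.
apply: closed_borelC.
have -> : circle_arc t e = (@cis R : R -> R[i]^o) @` `[t - e, t + e].
  apply/seteqP; split => x [s hs <-]; exists s => //; move: hs; rewrite /= ?in_itv /=.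
    by rewrite ler_norml => /andP[h1 h2]; apply/andP; split; lra.
  by move=> /andP[h1 h2]; rewrite ler_norml; apply/andP; split; lra.
apply: compact_closed; first exact: (@norm_hausdorff _ R[i]^o).
apply: continuous_compact; last exact: segment_compact.
by apply: continuous_subspaceT => s; exact: cis_continuous.
Qed.

End Arcs.

Section Approximation.
Variable R : realType.
Implicit Types u : int -> R[i].

Definition truncate u (N : nat) : int -> R[i] := fun j => if (`|j| <= N)%N then u j else 0.

Lemma win_nsq_truncate u N K : (N <= K)%N ->
  win (fun j => nsq (truncate u N j)) K = win (fun j => nsq (u j)) N.
Proof.
move=> NK; rewrite (@win_fin _ _ N) //; last first.
  by move=> k hk; rewrite /truncate leqNgt hk nsq0.
by apply: eq_bigr => i _; rewrite /truncate window_abs.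
Qed.

Lemma ell2_finite u N : (forall j : int, (N < `|j|)%N -> u j = 0) -> ell2 u.
Proof.
move=> u0; exists (win (fun j => nsq (u j)) N) => K.
have [NK|KN] := leqP N K; first by rewrite (@win_fin _ _ N) // => k /u0 ->; rewrite nsq0.
by apply: (@win_nd R (fun j => nsq (u j))) => [j|]; [exact: nsq_ge0|exact: ltnW].
Qed.

Lemma ell2_truncate u N : ell2 (truncate u N).
Proof. by apply: (@ell2_finite _ N) => j hj; rewrite /truncate leqNgt hj. Qed.

Lemma truncate_close u (d : R) : ell2 u -> 0 < d -> exists N,
  let v := vadd u (vscale (-1)%:C%C (truncate u N)) in ip v v <= d.
Proof.
move=> lu d0; have c := nsq_cvg lu.
set f := win _ in c; have nf : nondecreasing_seq f by apply: win_nd => j; exact: nsq_ge0.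
have [N hN] : exists N, limn f - d <= f N.
  move/cvgrPdist_le : c => /(_ d d0)[N _ hN]; exists N.
  have := hN N (leqnn N); rewrite /= ler_norml => /andP[_]; lra.
exists N => v.
have lv : ell2 v by apply: ell2_add => //; apply: ell2_scale; exact: ell2_truncate.
have hv j : nsq (v j) = nsq (u j) - nsq (truncate u N j).
  rewrite /v /vadd /vscale /truncate rmorphN mulN1r; case: ifP => _.
    by rewrite !subrr nsq0.
  by rewrite nsq0 !subr0.
apply: ip_le => // K.
apply: (@le_trans _ _ (win (fun j => nsq (v j)) (maxn K N))).
  by apply: (@win_nd R (fun j => nsq (v j))) => [j|]; [exact: nsq_ge0|exact: leq_maxl].
rewrite (_ : win _ _ = f (maxn K N) - f N); last first.
  rewrite /f -(@win_nsq_truncate u N (maxn K N)) ?leq_maxr // -winN -winD.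
  by congr win; apply/funext.
have := nondecreasing_cvgn_le nf c (maxn K N); lra.
Qed.

End Approximation.

(** * Unions of captured sets *)

Section Covering.
Variable R : realType.
Variable mu : {finite_measure set (borelC R) -> \bar R}.
Variable a : int -> R[i].
Hypothesis ad : forall n, unit_disk (a n).
Variable phi : int -> R[i].
Hypothesis lphi : ell2 phi.
Hypothesis hmu : is_spectral_measure (ecmv a) phi mu.
Variable b : int -> R[i].
Hypothesis lb : ell2 b.

(* [B] is captured by [s]: some [q(E)] with [|q| >= 1] on [B] has             *)
(* [|q(E) b|^2 <= s].                                                         *)
Definition captured (B : set (borelC R)) (s : R) := exists q A A', [/\ calc a q A A',
  forall x, B x -> unit_circle x /\ 1 <= nsq (q x) & ip (A b) (A b) <= s].

Let defect := ip (vadd phi (vscale (-1)%:C%C b)) (vadd phi (vscale (-1)%:C%C b)).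

(** [Q] is the sum of the [|q_i|^2]. In the last clause the adjoint moves [q_i(E)] onto [b], and the
    inequality of arithmetic and geometric means applies to each term. *)
Lemma finite_union_form (B : nat -> set (borelC R)) (s : nat -> R) m :
  (forall i, captured (B i) (s i)) -> exists Q A A', [/\ calc a Q A A',
    forall x, unit_circle x -> complex.Im (Q x) = 0 /\ 0 <= complex.Re (Q x),
    forall i x, (i < m)%N -> B i x -> 1 <= complex.Re (Q x) &
    forall th, ell2 th -> 2 * ip b (A th) <= \sum_(i < m) s i + ip th (A th)].
Proof.
move=> hB; elim: m => [|m [Q [A [A' [cQ hQ hQ1 hQF]]]]].
  exists (fun=> 0), (vscale 0), (vscale 0^*%C); split => //; first exact: calc_cst.
  move=> th lth; have e u : ell2 u -> ip u (vscale 0 th) = 0.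
    by move=> lu; rewrite -[0]/(0%:C%C) ipRr // mul0r.
  by rewrite big_ord0 !e // mulr0 addr0.
have [q [P [P' [cq hq hs]]]] := hB m.
have c := calc_add cQ (calc_mul (calc_conj cq) cq).
do 3!eexists; split; first exact: c.
- move=> x cx; have [h1 h2] := hQ x cx; rewrite mulJ cReD /=.
  by case: (Q x) h1 h2 => ? ? /= -> h2; rewrite addr0; split => //; rewrite addr_ge0 ?nsq_ge0.
- move=> i x; rewrite ltnS leq_eqVlt mulJ cReD /=.
  move=> /orP[/eqP -> Bx|im Bx].
    have [cx h1] := hq x Bx; have [_ h2] := hQ x cx; lra.
  by have := hQ1 i x im Bx; have := nsq_ge0 (q x); lra.
- move=> th lth; rewrite big_ord_recr /=.
  have [l1 l1'] := calc_ell2 ad cQ; have [l2 l2'] := calc_ell2 ad cq.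
  have lP := l2 _ lth; have lPP := l2' _ lP; have lA := l1 _ lth.
  rewrite !ipDr //.
  have e u : ell2 u -> ip u (P' (P th)) = ip (P u) (P th) by move=> lu; rewrite (calc_adj ad cq).
  rewrite !e //.
  have := hQF th lth; have := ip_amgm (l2 _ lb) lP; lra.
Qed.

Lemma measure_finite_union (B : nat -> set (borelC R)) (s : nat -> R) m :
  (forall i, measurable (B i)) -> (forall i, captured (B i) (s i)) ->
  (mu (\big[setU/set0]_(i < m) B i) <= (4 * (defect + \sum_(i < m) s i))%:E)%E.
Proof.
move=> mB hB; have [Q [A [A' [cQ hQ hQ1 hQF]]]] := finite_union_form m hB.
apply: (measure_bound ad lphi hmu cQ hQ) => //.
  by apply: bigsetU_measurable => i _.
move=> x; rewrite -bigcup_mkord => -[i /= im Bx]; split; last exact: hQ1 Bx.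
by have [q [P [P' [_ hq _]]]] := hB i; have [] := hq x Bx.
Qed.

(** The bound for finite unions is uniform in their number, so continuity from below applies. *)
Lemma measure_countable_union (B : nat -> set (borelC R)) (s : nat -> R) (S : R) :
  (forall i, measurable (B i)) -> (forall i, captured (B i) (s i)) ->
  (forall m, \sum_(i < m) s i <= S) ->
  (mu (\bigcup_i B i) <= (4 * (defect + S))%:E)%E.
Proof.
move=> mB hB hS; pose F m := \big[setU/set0]_(i < m) B i.
have FU : \bigcup_i B i = \bigcup_m F m.
  apply/seteqP; split => [x [i _ Bx]|x [m _]].
    by exists i.+1 => //; rewrite /F -bigcup_mkord; exists i => //=.
  by rewrite /F -bigcup_mkord => -[i _ Bx]; exists i.
have mF i : measurable (F i) by apply: bigsetU_measurable => j _.
have c : mu (F m) @[m --> \oo] --> mu (\bigcup_m F m).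
  apply: nondecreasing_cvg_mu => //; first exact: bigcupT_measurable.
  by move=> n m nm; apply/subsetPset; exact: subset_bigsetU.
rewrite FU -(cvg_lim (@ereal_hausdorff R) c).
apply: lime_le; first by apply/cvg_ex; exists (mu (\bigcup_m F m)).
apply: nearW => m; apply: (le_trans (measure_finite_union m mB hB)).
by rewrite lee_fin ler_pM2l // lerD2l.
Qed.

Lemma measure_captured (B : set (borelC R)) (s : R) : measurable B -> captured B s ->
  (mu B <= (4 * (defect + s))%:E)%E.
Proof.
move=> mB hB; have := @measure_finite_union (fun=> B) (fun=> s) 1 (fun=> mB) (fun=> hB).
by rewrite !big_ord1.
Qed.

Lemma captured0 s : 0 <= s -> captured set0 s.
Proof.
move=> s0; exists (fun=> 0), (vscale 0), (vscale 0^*%C); split => //; first exact: calc_cst.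
by rewrite ip_scale2 // nsq0 mul0r.
Qed.

End Covering.

Section Hausdorff.
Variable R : realType.
Local Open Scope ereal_scope.

Lemma hausdorff_weight_ge0 (be : R) (U : set R[i]) : 0 <= hausdorff_weight be U.
Proof. rewrite /hausdorff_weight; destruct (pselect (U = set0)); [by []|exact: poweR_ge0]. Qed.

Lemma hausdorff_null_cover (be d e : R) (S : set R[i]) : hausdorff_measure be S = 0 ->
  (0 < d)%R -> (0 < e)%R -> exists U : nat -> set R[i], [/\ S `<=` \bigcup_k U k,
    forall k, diam (U k) <= d%:E &
    forall m, \sum_(k < m) hausdorff_weight be (U k) <= e%:E].
Proof.
move=> h d0 e0.
have : hausdorff_premeasure be d S < e%:E.
  apply: (@le_lt_trans _ _ 0); last by rewrite lte_fin.
  by rewrite -h; apply: ereal_sup_ubound; exists d.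
move=> /ereal_inf_lt[_ [U [SU dU] <-] lt].
exists U; split => // m; apply: le_trans (ltW lt).
have := @nneseries_lim_ge R (fun k => hausdorff_weight be (U k)) xpredT 0%N m.
by rewrite big_mkord; apply => n _ _; exact: hausdorff_weight_ge0.
Qed.

Lemma diam_ub (U : set R[i]) x y : U x -> U y -> (normc (x - y))%:E <= diam U.
Proof. by move=> Ux Uy; apply: ereal_sup_ubound; exists (x, y). Qed.

Lemma hausdorff_weightN0 (be : R) (U : set R[i]) x : U x ->
  hausdorff_weight be U = diam U `^ be.
Proof.
move=> Ux; rewrite /hausdorff_weight; destruct (pselect (U = set0)) as [U0|?]; last by [].
by exfalso; rewrite U0 in Ux.
Qed.

(** At dimension 0 a nonempty covering set has weight 1, so a cover of total weight at most 1/2 has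
    no room for a point. *)
Lemma hausdorff0_null (S : set R[i]) : hausdorff_measure 0%R S = 0 -> S = set0.
Proof.
move=> h; have e0 : (0 < 2^-1 :> R)%R by rewrite invr_gt0.
have [U [SU _ hU]] := hausdorff_null_cover h ltr01 e0.
apply/seteqP; split => // x /SU[k _ Ukx].
have := hU k.+1; rewrite big_ord_recr /= (hausdorff_weightN0 _ Ukx) poweRe0 => hk.
have : 1 <= (2^-1)%:E :> \bar R.
  apply: le_trans hk; apply: leeDr; apply: sume_ge0 => i _; exact: hausdorff_weight_ge0.
by rewrite lee_fin; lra.
Qed.

End Hausdorff.

(** * Null sets and Holder continuity *)

Section Continuity.
Variable R : realType.
Variable mu : {finite_measure set (borelC R) -> \bar R}.
Variable a : int -> R[i].
Hypothesis ad : forall n, unit_disk (a n).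
Variable phi : int -> R[i].
Hypothesis lphi : ell2 phi.
Hypothesis hmu : is_spectral_measure (ecmv a) phi mu.
Local Notation alpha := (fun n : nat => a n%:Z).

Lemma sum_half m : \sum_(i < m) (2^-1 : R) ^+ i.+1 <= 1.
Proof.
suff -> : \sum_(i < m) (2^-1 : R) ^+ i.+1 = 1 - 2^-1 ^+ m.
  by rewrite gerBl exprn_ge0 // invr_ge0.
elim: m => [|m IH]; first by rewrite big_ord0 expr0 subrr.
by rewrite big_ord_recr /= IH exprS; lra.
Qed.

(** A covering set may be a single point, while [key_estimate] needs a positive radius. *)
Lemma enlarge_radius (be d e dd : R) : 0 < be -> 0 < d -> 0 < e -> 0 <= dd <= d ->
  exists eps, [/\ 0 < eps <= d, dd <= eps & eps `^ be <= dd `^ be + e].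
Proof.
move=> be0 d0 e0 /andP[dd0 ddd]; have [dd1|dd1] := ltP 0 dd.
  by exists dd; split; rewrite ?dd1 // lerDl ltW.
exists (Num.min d (e `^ be^-1)); split.
- by rewrite lt_min d0 powR_gt0 //= ge_min lexx.
- by apply: (le_trans dd1); rewrite le_min ltW // powR_ge0.
- apply: (@le_trans _ _ ((e `^ be^-1) `^ be)).
    apply: ge0_ler_powR; rewrite ?nnegrE ?powR_ge0 ?(ltW be0) //.
      by rewrite le_min (ltW d0) powR_ge0.
    by rewrite ge_min lexx orbT.
  by rewrite -powRrM mulVf ?gt_eqF // powRr1 ?lerDr ?powR_ge0 // ltW.
Qed.

(** [T] is defined by power laws and carries no measurability, so the conclusion is a measurable
    superset of small measure. *)
Lemma hausdorff_null_small (g1 g2 C1 C2 L0 : R) (T S : set (borelC R)) (del : R) :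
  0 < g1 -> g1 <= g2 -> 0 < C1 -> 0 < C2 -> T `<=` unit_circle ->
  (forall z, T z -> power_law_bounds alpha g1 g2 z C1 C2 L0) ->
  hausdorff_measure (2 * g1 / (g1 + g2)) S = 0%E -> 0 < del ->
  exists B : set (borelC R), [/\ measurable B, T `&` S `<=` B & (mu B <= del%:E)%E].
Proof.
move=> g10 g12 C10 C20 Tc hT hS del0.
set be := _ / _ in hS; have be0 : 0 < be.
  by rewrite divr_gt0 ?mulr_gt0 // addr_gt0 // (lt_le_trans g10).
(* The truncation of [phi] and the capturing bounds get [del / 8] each, and
   [measure_countable_union] multiplies their sum by 4. *)
have [N hN] := truncate_close lphi (divr_gt0 del0 (ltr0n R 8)).
set b := truncate phi N in hN.
have lb : ell2 b by exact: ell2_truncate.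
have hb (j : int) : (N.+1.*2 <= `|j|)%N -> b j = 0.
  by rewrite /b /truncate => hj; rewrite ifF //; apply/negbTE; rewrite -ltnNge; apply: leq_trans hj; rewrite -addnn leq_addr.
have [C [e0 [C0 e00 key]]] := @key_estimate R a ad g1 g2 C1 C2 L0 N.+1 b g10 C10 C20 lb hb.
(* [eta] pays once for the weights of the cover and once for all enlargements:
   [C (eta + eta) = del / 8]. *)
pose eta := del / (16 * C); have eta0 : 0 < eta by rewrite divr_gt0 // mulr_gt0.
have d0 : 0 < e0 / 2 by rewrite divr_gt0.
have [U [SU dU wU]] := hausdorff_null_cover hS d0 eta0.
pose W i := fine (hausdorff_weight be (U i)).
have hW i : ((W i)%:E <= hausdorff_weight be (U i))%E.
  have := hausdorff_weight_ge0 be (U i); rewrite /W.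
  by case: hausdorff_weight => [r||] //= _; rewrite leey.
have W0 i : 0 <= W i by rewrite fine_ge0 // hausdorff_weight_ge0.
have step i : exists Bs : set (borelC R) * R, [/\ measurable Bs.1, captured a b Bs.1 Bs.2,
    T `&` S `&` U i `<=` Bs.1 & Bs.2 <= C * (W i + eta * 2^-1 ^+ i.+1)].
  have ei : 0 < eta * 2^-1 ^+ i.+1 by rewrite mulr_gt0 // exprn_gt0 // invr_gt0.
  have [[z [[Tz Sz] Uz]]|none] := pselect (exists z, (T `&` S `&` U i) z); last first.
    exists (set0, 0); split => //=; first by exact: captured0.
      by move=> x hx; case: none; exists x.
    by rewrite mulr_ge0 ?(ltW C0) // addr_ge0 ?W0 // ltW.
  have [dd dE] : exists dd, diam (U i) = dd%:E.
    have := dU i; have := diam_ub Uz Uz; case: (diam (U i)) => [r|//|//] _ _.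
    by exists r.
  have dd0 : 0 <= dd.
    by have := diam_ub Uz Uz; rewrite dE lee_fin; apply: le_trans; exact: normc_ge0.
  have ddd : dd <= e0 / 2 by have := dU i; rewrite dE lee_fin.
  have dd0d : 0 <= dd <= e0 / 2 by rewrite dd0.
  have [eps [/andP[eps0 epsd] ddeps hpow]] := enlarge_radius be0 d0 ei dd0d.
  have We : W i = dd `^ be by rewrite /W (hausdorff_weightN0 _ Uz) dE poweR_EFin.
  have z1 : nsq z = 1 by apply/circleP; exact: Tc.
  have epse : 0 < eps < e0 by rewrite eps0 /=; apply: (le_lt_trans epsd); lra.
  have [q [A [A' [cA hq hA]]]] := key z eps z1 (hT z Tz) epse.
  (* [U i] lies in the disc about any of its points whose radius is its diameter. *)
  exists ([set x | normc (x - z) <= eps] `&` unit_circle, C * eps `^ be); split => /=.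
  - by apply: measurableI; [exact: measurable_disc|exact: measurable_circle].
  - exists q, A, A'; split => // x [/= xz cx]; split => //.
    by apply: hq; [exact/circleP|rewrite -normc_le // ltW].
  - move=> x [[Tx Sx] Ux]; split; last exact: Tc.
    by rewrite /= -lee_fin (le_trans (diam_ub Ux Uz)) // dE lee_fin.
  - by rewrite ler_pM2l // We.
have [Bs hBs] := choice step.
exists (\bigcup_i (Bs i).1); split.
- by apply: bigcupT_measurable => i; case: (hBs i).
- move=> x [Tx Sx]; have [i _ Ux] := SU x Sx; exists i => //.
  by case: (hBs i) => _ _ h _; apply: h.
- apply: (le_trans (@measure_countable_union _ mu a ad phi lphi hmu b lb
    (fun i => (Bs i).1) (fun i => (Bs i).2) (del / 8) _ _ _)).
  + by move=> i; case: (hBs i).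
  + by move=> i; case: (hBs i).
  + move=> m; apply: (@le_trans _ _ (\sum_(i < m) C * (W i + eta * 2^-1 ^+ i.+1))).
      by apply: ler_sum => i _; case: (hBs i).
    rewrite -mulr_sumr big_split /= -mulr_sumr.
    have h1 : \sum_(i < m) W i <= eta.
      rewrite -lee_fin -sumEFin; apply: le_trans (wU m).
      by apply: lee_sum => i _; exact: hW.
    have h2 := ler_wpM2l (ltW eta0) (sum_half m).
    apply: (@le_trans _ _ (C * (eta + eta))); first by rewrite ler_pM2l // lerD // (le_trans h2) ?mulr1.
    rewrite /eta le_eqVlt; apply/orP; left; apply/eqP; field; by rewrite gt_eqF.
  + by rewrite lee_fin; move: hN => /=; lra.
Qed.

Lemma purely_continuous_measure (g1 g2 : R) (Sigma S : set (borelC R)) :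
  0 < g1 -> Sigma `<=` unit_circle -> measurable Sigma -> measurable S ->
  (forall z : R[i], Sigma z -> exists C1 C2 L0 : R,
     [/\ 0 < C1, 0 < C2 & power_law_bounds alpha g1 g2 z C1 C2 L0]) ->
  hausdorff_measure (2 * g1 / (g1 + g2)) S = 0%E -> mu (Sigma `&` S) = 0%E.
Proof.
move=> g10 Sc mSigma mS hb hS.
have [[z0 Sz0]|none] := pselect (exists z, Sigma z); last first.
  rewrite (_ : _ `&` _ = set0) ?measure0 //.
  by apply/seteqP; split => // x [Sx _]; case: none; exists x.
have g12 : g1 <= g2 by have [? [? [? [h _ /(power_law_order h)]]]] := hb z0 Sz0.
(* Countably many levels, each with uniform constants, exhaust [Sigma]. *)
pose T k : set (borelC R) := [set z | Sigma z /\
  power_law_bounds alpha g1 g2 z k.+1%:R^-1 k.+1%:R k.+1%:R].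
have SigmaT : Sigma `&` S = \bigcup_k (T k `&` S).
  apply/seteqP; split => [z [Sz Sz']|z [k _ [[Sz _] Sz']]] //.
  have [C1 [C2 [L0 [C10 C20 hpl]]]] := hb z Sz.
  pose m := Num.max (Num.max C1^-1 C2) L0.
  have m0 : 0 <= m by rewrite !le_max (ltW C20) !orbT.
  exists (Num.truncn m) => //; split => //; split => // eta se ne L L0' hL.
  set k := (Num.truncn m).+1%:R in hL *.
  have mk : m < k by rewrite /k -truncn_lt_nat.
  have k0 : 0 < k by rewrite ltr0n.
  have kC1 : k^-1 <= C1.
    rewrite -[C1]invrK lef_pV2 ?posrE ?invr_gt0 //.
    by apply: le_trans (ltW mk); rewrite !le_max lexx.
  have kC2 : C2 <= k by apply: le_trans (ltW mk); rewrite !le_max lexx orbT.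
  have kL : L0 <= L.
    by apply: le_trans hL; apply: le_trans (ltW mk); rewrite !le_max lexx !orbT.
  have /andP[h1 h2] := hpl eta se ne L L0' kL.
  apply/andP; split.
    by apply: le_trans h1; rewrite ler_wpM2r ?powR_ge0.
  by apply: (le_trans h2); rewrite ler_wpM2r ?powR_ge0.
apply: measure_negligible; first exact: measurableI.
rewrite SigmaT; apply: negligible_bigcup => k.
have small n : exists B : set (borelC R),
    [/\ measurable B, T k `&` S `<=` B & (mu B <= (n.+1%:R^-1)%:E)%E].
  apply: (@hausdorff_null_small g1 g2 k.+1%:R^-1 k.+1%:R k.+1%:R) => //.
  - by move=> z [Sz _]; exact: Sc.
  - by move=> z [].
have [B hB] := choice small.
exists (\bigcap_n B n); split.
- by apply: bigcapT_measurable => n; case: (hB n).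
- apply/eqP; rewrite eq_le measure_ge0 andbT.
  apply/lee_addgt0Pr => e e0; rewrite add0e.
  have [n hn] : exists n : nat, n.+1%:R^-1 <= e.
    exists (Num.truncn e^-1); rewrite -[e]invrK lef_pV2 ?posrE ?invr_gt0 // ?invrK.
    by apply: ltW; rewrite -truncn_lt_nat // invr_ge0 ltW.
  apply: (@le_trans _ _ (mu (B n))); last first.
    by case: (hB n) => _ _ h; apply: (le_trans h); rewrite lee_fin.
  apply: le_measure; rewrite ?inE; [by apply: bigcapT_measurable => i; case: (hB i)|by case: (hB n)|].
  exact: bigcap_inf.
- by move=> x hx n _; case: (hB n) => _ h _; exact: h.
Qed.

Lemma holder_measure (g1 g2 C1 C2 L0 : R) (Sigma : set (borelC R)) N :
  0 < g1 -> 0 < C1 -> 0 < C2 ->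
  (forall z, Sigma z -> power_law_bounds alpha g1 g2 z C1 C2 L0) ->
  (forall j : int, (N.*2 <= `|j|)%N -> phi j = 0) ->
  uniformly_holder (2 * g1 / (g1 + g2)) mu Sigma.
Proof.
move=> g10 C10 C20 hb hphi; set be := _ / _.
have [C [e0 [C0 e00 key]]] := @key_estimate R a ad g1 g2 C1 C2 L0 N phi g10 C10 C20 lphi hphi.
exists (4 * (C * 2 `^ be)), (e0 / 2); split.
- by rewrite !mulr_gt0 // powR_gt0.
- by rewrite divr_gt0.
move=> t e St /andP[e1 e2].
have e20 : 0 < 2 * e < e0 by apply/andP; split; lra.
have [q [A [A' [cA hq hA]]]] := key (cis t) (2 * e) (cis_circle t) (hb _ St) e20.
have cap : captured a phi (circle_arc t e) (C * (2 * e) `^ be).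
  exists q, A, A'; split => // x [s hs <-]; split; first by apply/circleP; exact: cis_circle.
  apply: hq; first exact: cis_circle.
  apply: (le_trans (nsq_cis s t)).
  have : `|s - t| ^+ 2 <= e ^+ 2 by rewrite ler_sqr ?nnegrE // ltW.
  by rewrite real_normK ?num_real //; have := sqr_ge0 e; lra.
apply: (le_trans (measure_captured ad lphi hmu lphi (measurable_arc t e) cap)).
(* With [b = phi] the approximation defect vanishes. *)
rewrite (_ : vadd phi _ = vscale 0 phi); last first.
  by apply/funext => j; rewrite /vadd /vscale rmorphN mulN1r subrr mul0r.
rewrite ip_scale2 // nsq0 mul0r add0r lee_fin powRM //; last exact: ltW.
by rewrite !mulrA.
Qed.

End Continuity.

Lemma finitely_supported_bound (R : realType) (phi : int -> R[i]) :
  finitely_supported phi -> exists N, forall j : int, (N <= `|j|)%N -> phi j = 0.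
Proof.
move=> /finite_seqP[s hs]; exists (\max_(j <- s) `|j|%N).+1 => j hj.
apply/eqP; apply/negPn/negP => nz.
have js : j \in s by have : [set` s] j by rewrite -hs.
have := @leq_bigmax_seq _ s xpredT (fun j : int => `|j|%N) j js isT.
by rewrite leqNgt hj.
Qed.

Theorem theorem2 (R : realType) (Sigma : set (borelC R))
    (hSigma_circle : Sigma `<=` unit_circle)
    (hSigma_borel : measurable Sigma)
    (alpha : nat -> R[i]) (halpha : forall n, unit_disk (alpha n))
    (gamma1 gamma2 : R) (hgamma1 : 0 <= gamma1)
    (hbounds : forall z : R[i], Sigma z ->
       exists C1 C2 L0 : R,
         [/\ 0 < C1, 0 < C2 & power_law_bounds alpha gamma1 gamma2 z C1 C2 L0]) :
  let C := cmv alpha in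
  let beta := 2 * gamma1 / (gamma1 + gamma2) in
  forall E : int -> int -> R[i], cmv_extension C E ->
    purely_continuous_spectrum beta E Sigma /\
    ((exists C1 C2 L0 : R, [/\ 0 < C1, 0 < C2 &
        forall z : R[i], Sigma z ->
          power_law_bounds alpha gamma1 gamma2 z C1 C2 L0]) ->
     forall phi : int -> R[i], finitely_supported phi ->
     forall mu : {finite_measure set (borelC R) -> \bar R},
       is_spectral_measure E phi mu -> uniformly_holder beta mu Sigma).
Proof.
move=> C beta E /(cmv_extensionP E halpha)[a [ad ha ->]].
have ea : alpha = (fun n : nat => a n%:Z) by apply/funext => n; rewrite ha.
rewrite ea in hbounds *.
(* When [gamma1 = 0] also [beta = 0]: null sets are empty, and the total mass serves as a Holder
   constant. *)
have [g0|g0] := ltP 0 gamma1; last first.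
  have b0 : beta = 0 by rewrite /beta (_ : gamma1 = 0) ?mulr0 ?mul0r //; apply/eqP; rewrite eq_le g0.
  rewrite b0; split.
    move=> phi _ mu _ S _ /hausdorff0_null ->; by rewrite setI0 measure0.
  move=> _ phi _ mu _; exists (fine (mu setT) + 1), 1; split => //.
    by rewrite ltr_wpDl // fine_ge0 // measure_ge0.
  move=> t e _ _; rewrite powRr0 mulr1 EFinD fineK ?fin_num_measure //.
  apply: (@le_trans _ _ (mu setT)); last by rewrite leeDl // lee_fin.
  by apply: le_measure; rewrite ?inE //; exact: measurable_arc.
split.
  move=> phi /l2_ell2 lphi mu hmu S mS hS.
  exact: (purely_continuous_measure ad lphi hmu g0 hSigma_circle hSigma_borel mS hbounds hS).
move=> [C1 [C2 [L0 [C10 C20 hb]]]] phi /finitely_supported_bound[N hN] mu hmu.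
have lphi : ell2 phi by apply: (@ell2_finite _ _ N) => j hj; apply: hN; exact: ltnW.
apply: (holder_measure ad lphi hmu g0 C10 C20 hb (N := N)).
by move=> j hj; apply: hN; apply: leq_trans hj; rewrite -addnn leq_addr.
Qed.
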